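(* Let $K$ be an arbitrary field, let $(s_q,\ldots,s_1)$ be a tuple of positive integers, where $q\ge 3$, and let $\mathbf{P}\mathbf{N}_{s_q}\cdots\mathbf{N}_{s_1}$ be the variety of Lie polynilpotent Poisson algebras over $K$ corresponding to this tuple. Then its ordinary codimension growth satisfies $$c_n(\mathbf{P}\mathbf{N}_{s_q}\cdots\mathbf{N}_{s_1})=\frac{n!}{(\ln^{(q-2)}n)^{n/s_1}}\left(\frac{s_2+o(1)}{s_1}\right)^{n/s_1},\qquad n\to\infty.$$
   Context: A Poisson algebra over $K$ is a $K$-vector space $A$ with two $K$-bilinear operations: a commutative associative multiplication with unit $a\cdot b$, and a Lie bracket $\{a,b\}$ (the Poisson bracket), related by the Leibniz rule $\{a\cdot b,c\}=a\cdot\{b,c\}+b\cdot\{a,c\}$. $\mathbf{N}_s$ denotes the variety of Lie algebras that are nilpotent of class at most $s$. $\mathbf{N}_{s_q}\cdots\mathbf{N}_{s_2}\mathbf{N}_{s_1}$ denotes the variety of polynilpotent Lie algebras: Lie algebras $L$ having a chain of ideals $0=L_{q+1}\subset L_q\subset\dots\subset L_2\subset L_1=L$ such that $L_i/L_{i+1}$ is nilpotent of class at most $s_i$, $i=1,\dots,q$. For a variety $\mathbf{V}$ of Lie algebras, $\mathbf{P}\mathbf{V}$ denotes the variety of Poisson algebras defined by the Lie identical relations of $\mathbf{V}$ (i.e. the Poisson algebras which, as Lie algebras with respect to the Poisson bracket, belong to $\mathbf{V}$). Let $X=\{X_i\mid i\in\mathbb{N}\}$ and let $L(X)$ be the free Lie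 algebra on $X$. The free Poisson algebra on $X$ is the symmetric algebra $F(X)=S(L(X))$ with the Poisson bracket extending the bracket of $L(X)$ by the Leibniz rule. Let $P_n\subset F(X)$ be the span of all multilinear monomials of degree $n$ in $X_1,\dots,X_n$ (products of Lie commutators in which each of $X_1,\dots,X_n$ occurs exactly once). For a variety $\mathbf{W}$ of Poisson algebras, let $F(\mathbf{W},X)$ be its relatively free algebra on $X$ and $\phi:F(X)\to F(\mathbf{W},X)$ the natural epimorphism. The (ordinary) codimension sequence is $c_n(\mathbf{W})=\dim_K\phi(P_n)$, $n\ge 0$. Iterated logarithms: $\ln^{(1)}x=\ln x$, $\ln^{(k+1)}x=\ln(\ln^{(k)}x)$. As usual $o(1)$ denotes a sequence tending to $0$ as $n\to\infty$. *)

(* Defs.v *)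
From HB Require Import structures.
From mathcomp Require Import all_boot all_order all_algebra.
From mathcomp Require Import generic_quotient ring.
From mathcomp Require Import all_classical all_reals all_analysis.

Set Implicit Arguments.
Unset Strict Implicit.
Unset Printing Implicit Defensive.

Import Order.TTheory GRing.Theory Num.Theory.
Import numFieldNormedType.Exports.

Local Open Scope classical_set_scope.
Local Open Scope ring_scope.
Local Open Scope quotient_scope.

Reserved Notation "{[ x , y ]}" (at level 0, x, y at level 99,
  format "{[ x ,  y ]}").

(** * Spans and dimension in a possibly infinite-dimensional space *)

Section LinearAlgebra.
Context {K : fieldType} {V : lmodType K}.
Implicit Types A : set V.

Definition lin_span A : set V :=
  [set x | exists n (a : 'I_n -> K) (v : 'I_n -> V),
    (forall i, A (v i)) /\ x = \sum_(i < n) a i *: v i].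

Definition lin_indep (n : nat) (v : 'I_n -> V) : Prop :=
  forall a : 'I_n -> K, \sum_(i < n) a i *: v i = 0 -> forall i, a i = 0.

(** For a subspace A: A has a basis with d elements. *)
Definition has_dim A (d : nat) : Prop := exists v : 'I_d -> V,
  [/\ forall i, A (v i), lin_indep v & A `<=` lin_span (range v)].

Definition subspace A : Prop :=
  A 0 /\ forall (a : K) x y, A x -> A y -> A (a *: x + y).

End LinearAlgebra.

(** The dimension of a finite-dimensional subspace (0 if there is no finite
    basis). *)
Definition dimension (K : fieldType) (V : lmodType K) (A : set V) : nat :=
  xget 0%N [set d | has_dim A d].

(** * Lie algebras and Poisson algebras *)

HB.mixin Record Lmodule_isLie (K : fieldType) L of GRing.Lmodule K L := {
  lieb : L -> L -> L;
  lieb_linearl : forall a x y z,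
    lieb (a *: x + y) z = a *: lieb x z + lieb y z;
  lieb_linearr : forall a x y z,
    lieb x (a *: y + z) = a *: lieb x y + lieb x z;
  liebb : forall x, lieb x x = 0;
  jacobi : forall x y z,
    lieb x (lieb y z) + lieb y (lieb z x) + lieb z (lieb x y) = 0
}.

#[short(type="lieAlgType")]
HB.structure Definition LieAlgebra (K : fieldType) :=
  { L of GRing.Lmodule K L & Lmodule_isLie K L }.

Notation "{[ x , y ]}" := (lieb x y) : ring_scope.

(** A [comAlgType] is nonzero (1 != 0). The zero algebra, which is thus not
    considered, satisfies every identity. *)
HB.mixin Record isPoisson (K : fieldType) A
    of GRing.ComAlgebra K A & LieAlgebra K A := {
  leibniz : forall x y z : A, {[x * y, z]} = x * {[y, z]} + y * {[x, z]}
}.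

#[short(type="poissonAlgType")]
HB.structure Definition PoissonAlgebra (K : fieldType) :=
  { A of GRing.ComAlgebra K A & LieAlgebra K A & isPoisson K A }.

Record poisson_hom (K : fieldType) (A B : poissonAlgType K) (f : A -> B) :
    Prop := PoissonHom {
  phomP : forall (a : K) x y, f (a *: x + y) = a *: f x + f y;
  phom1 : f 1 = 1;
  phomM : forall x y, f (x * y) = f x * f y;
  phom_lieb : forall x y, f {[x, y]} = {[f x, f y]}
}.

(** * Polynilpotent Lie algebras *)

Section Polynilpotent.
Context {K : fieldType} {L : lieAlgType K}.

Definition lie_ideal (I : set L) : Prop :=
  subspace I /\ forall x y, I y -> I {[x, y]}.

(** [lcs J k] is the term gamma_(k+1) of the lower central series of J. *)
Fixpoint lcs (J : set L) (k : nat) : set L :=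
  if k is k'.+1 then
    lin_span [set z | exists x y, [/\ lcs J k' x, J y & z = {[x, y]}]]
  else J.

(** J / I is nilpotent of class at most s, i.e. gamma_(s+1)(J / I) = 0, which
    says that gamma_(s+1)(J) lies in I. *)
Definition quot_nilpotent (J I : set L) (s : nat) : Prop := lcs J s `<=` I.

End Polynilpotent.

(** L belongs to N_(s q) ... N_(s 2) N_(s 1); only the values s 1, ..., s q
    matter. *)
Definition lie_polynilpotent (K : fieldType) (q : nat) (s : nat -> nat)
    (L : lieAlgType K) : Prop :=
  exists J : nat -> set L,
    [/\ J 1%N = [set: L],
        J q.+1 = [set 0],
        forall i, (1 <= i <= q.+1)%N -> lie_ideal (J i),
        forall i, (1 <= i <= q)%N -> J i.+1 `<=` J i &
        forall i, (1 <= i <= q)%N -> quot_nilpotent (J i) (J i.+1) (s i)].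

(** The variety P N_(s q) ... N_(s 1), as a class of Poisson algebras. *)
Definition PN (K : fieldType) (q : nat) (s : nat -> nat)
    (A : poissonAlgType K) : Prop := lie_polynilpotent q s A.
Arguments PN K q s A : clear implicits.

(** * The free Lie algebra on X_0, X_1, ...

    Terms modulo the least congruence containing the axioms of Lie
    K-algebras. *)

Inductive lie_term (K : Type) : Type :=
  | LVar of nat
  | LZero
  | LAdd of lie_term K & lie_term K
  | LScale of K & lie_term K
  | LBr of lie_term K & lie_term K.
Arguments LVar {K}.
Arguments LZero {K}.

HB.instance Definition _ (K : Type) := gen_eqMixin (lie_term K).
HB.instance Definition _ (K : Type) := gen_choiceMixin (lie_term K).

Section FreeLie.
Variable K : fieldType.
Local Notation T := (lie_term K).

Inductive lie_eq : T -> T -> Prop :=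
  | le_refl x : lie_eq x x
  | le_sym x y : lie_eq x y -> lie_eq y x
  | le_trans x y z : lie_eq x y -> lie_eq y z -> lie_eq x z
  | le_add x x' y y' : lie_eq x x' -> lie_eq y y' ->
      lie_eq (LAdd x y) (LAdd x' y')
  | le_scale a x x' : lie_eq x x' -> lie_eq (LScale a x) (LScale a x')
  | le_br x x' y y' : lie_eq x x' -> lie_eq y y' ->
      lie_eq (LBr x y) (LBr x' y')
  | le_addA x y z : lie_eq (LAdd x (LAdd y z)) (LAdd (LAdd x y) z)
  | le_addC x y : lie_eq (LAdd x y) (LAdd y x)
  | le_add0 x : lie_eq (LAdd LZero x) x
  | le_addN x : lie_eq (LAdd (LScale (-1) x) x) LZero
  | le_scaleA a b x : lie_eq (LScale a (LScale b x)) (LScale (a * b) x)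
  | le_scale1 x : lie_eq (LScale 1 x) x
  | le_scaleDr a x y :
      lie_eq (LScale a (LAdd x y)) (LAdd (LScale a x) (LScale a y))
  | le_scaleDl a b x :
      lie_eq (LScale (a + b) x) (LAdd (LScale a x) (LScale b x))
  | le_brl a x y z :
      lie_eq (LBr (LAdd (LScale a x) y) z) (LAdd (LScale a (LBr x z)) (LBr y z))
  | le_brr a x y z :
      lie_eq (LBr x (LAdd (LScale a y) z)) (LAdd (LScale a (LBr x y)) (LBr x z))
  | le_brxx x : lie_eq (LBr x x) LZero
  | le_jacobi x y z :
      lie_eq (LAdd (LAdd (LBr x (LBr y z)) (LBr y (LBr z x)))
                   (LBr z (LBr x y))) LZero.

Definition lie_eqb (x y : T) : bool := `[< lie_eq x y >].

Fact lie_eqb_refl : reflexive lie_eqb.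
Proof. by move=> x; apply/asboolP; exact: le_refl. Qed.
Fact lie_eqb_sym : symmetric lie_eqb.
Proof. by move=> x y; apply/asboolP/asboolP; exact: le_sym. Qed.
Fact lie_eqb_trans : transitive lie_eqb.
Proof.
move=> y x z /asboolP xy /asboolP yz; apply/asboolP; exact: le_trans xy yz.
Qed.

Canonical lie_equiv := EquivRel lie_eqb lie_eqb_refl lie_eqb_sym lie_eqb_trans.

Definition freeLie := {eq_quot lie_equiv}.
HB.instance Definition _ := Choice.on freeLie.
HB.instance Definition _ := EqQuotient.on freeLie.

Definition fl_cl (t : T) : freeLie := \pi t.
Local Notation cl := fl_cl.

Lemma fl_ind (P : freeLie -> Prop) : (forall t, P (cl t)) -> forall x, P x.
Proof. by move=> Pt; elim/quotW. Qed.

Lemma lie_piP x y : lie_eq x y -> cl x = cl y.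
Proof. by move=> xy; apply/eqmodP/asboolP. Qed.

Lemma lie_repr x : lie_eq (repr (cl x)) x.
Proof.
by have /eqmodP/asboolP : cl (repr (cl x)) = cl x by rewrite /fl_cl reprK.
Qed.

Definition fl_var i : freeLie := cl (LVar i).
Definition fl_zero : freeLie := cl LZero.
Definition fl_add (x y : freeLie) : freeLie :=
  locked (cl (LAdd (repr x) (repr y))).
Definition fl_scale a (x : freeLie) : freeLie :=
  locked (cl (LScale a (repr x))).
Definition fl_opp (x : freeLie) : freeLie := fl_scale (-1) x.
Definition fl_br (x y : freeLie) : freeLie :=
  locked (cl (LBr (repr x) (repr y))).

Lemma fl_addE x y : fl_add (cl x) (cl y) = cl (LAdd x y).
Proof. by rewrite /fl_add -lock; apply/lie_piP/le_add; exact: lie_repr. Qed.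
Lemma fl_scaleE a x : fl_scale a (cl x) = cl (LScale a x).
Proof. by rewrite /fl_scale -lock; apply/lie_piP/le_scale; exact: lie_repr. Qed.
Lemma fl_brE x y : fl_br (cl x) (cl y) = cl (LBr x y).
Proof. by rewrite /fl_br -lock; apply/lie_piP/le_br; exact: lie_repr. Qed.
Let flE := (fl_addE, fl_scaleE, fl_brE).

Fact fl_addA : associative fl_add.
Proof.
by elim/fl_ind=> x; elim/fl_ind=> y; elim/fl_ind=> z; rewrite !flE;
  exact/lie_piP/le_addA.
Qed.
Fact fl_addC : commutative fl_add.
Proof.
by elim/fl_ind=> x; elim/fl_ind=> y; rewrite !flE; exact/lie_piP/le_addC.
Qed.
Fact fl_add0 : left_id fl_zero fl_add.
Proof. by elim/fl_ind=> x; rewrite !flE; exact/lie_piP/le_add0. Qed.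
Fact fl_addN : left_inverse fl_zero fl_opp fl_add.
Proof. by elim/fl_ind=> x; rewrite /fl_opp !flE; exact/lie_piP/le_addN. Qed.

HB.instance Definition _ :=
  GRing.isZmodule.Build freeLie fl_addA fl_addC fl_add0 fl_addN.

Fact fl_scaleA a b x : fl_scale a (fl_scale b x) = fl_scale (a * b) x.
Proof. by elim/fl_ind: x => x; rewrite !flE; exact/lie_piP/le_scaleA. Qed.
Fact fl_scale1 : left_id 1 fl_scale.
Proof. by elim/fl_ind=> x; rewrite !flE; exact/lie_piP/le_scale1. Qed.
Fact fl_scaleDr : right_distributive fl_scale +%R.
Proof.
move=> a; elim/fl_ind=> x; elim/fl_ind=> y.
by rewrite /GRing.add /= !flE; exact/lie_piP/le_scaleDr.
Qed.
Fact fl_scaleDl x : {morph fl_scale^~ x : a b / a + b}.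
Proof.
move=> a b; elim/fl_ind: x => x.
by rewrite [in RHS]/GRing.add /= !flE; exact/lie_piP/le_scaleDl.
Qed.

HB.instance Definition _ := GRing.Zmodule_isLmodule.Build K freeLie
  fl_scaleA fl_scale1 fl_scaleDr fl_scaleDl.

Fact fl_brl a x y z : fl_br (a *: x + y) z = a *: fl_br x z + fl_br y z.
Proof.
elim/fl_ind: x => x; elim/fl_ind: y => y; elim/fl_ind: z => z.
by rewrite /GRing.add /GRing.scale /= !flE; exact/lie_piP/le_brl.
Qed.
Fact fl_brr a x y z : fl_br x (a *: y + z) = a *: fl_br x y + fl_br x z.
Proof.
elim/fl_ind: x => x; elim/fl_ind: y => y; elim/fl_ind: z => z.
by rewrite /GRing.add /GRing.scale /= !flE; exact/lie_piP/le_brr.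
Qed.
Fact fl_brxx x : fl_br x x = 0.
Proof. by elim/fl_ind: x => x; rewrite !flE; exact/lie_piP/le_brxx. Qed.
Fact fl_jacobi x y z :
  fl_br x (fl_br y z) + fl_br y (fl_br z x) + fl_br z (fl_br x y) = 0.
Proof.
elim/fl_ind: x => x; elim/fl_ind: y => y; elim/fl_ind: z => z.
by rewrite /GRing.add /= !flE; exact/lie_piP/le_jacobi.
Qed.

HB.instance Definition _ :=
  Lmodule_isLie.Build K freeLie fl_brl fl_brr fl_brxx fl_jacobi.
End FreeLie.

(** * The symmetric algebra of a vector space

    Terms modulo the least congruence containing the axioms of commutative
    K-algebras (scalars being given by [SConst]) and the linearity of the
    canonical map [SGen] from V. *)

Inductive sym_term (K V : Type) : Type :=
  | SConst of K
  | SGen of V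
  | SAdd of sym_term K V & sym_term K V
  | SMul of sym_term K V & sym_term K V.
Arguments SConst {K V}.
Arguments SGen {K V}.

HB.instance Definition _ (K V : Type) := gen_eqMixin (sym_term K V).
HB.instance Definition _ (K V : Type) := gen_choiceMixin (sym_term K V).

Section SymAlg.
Variables (K : fieldType) (V : lmodType K).
Local Notation T := (sym_term K V).

Inductive sym_eq : T -> T -> Prop :=
  | se_refl x : sym_eq x x
  | se_sym x y : sym_eq x y -> sym_eq y x
  | se_trans x y z : sym_eq x y -> sym_eq y z -> sym_eq x z
  | se_add x x' y y' : sym_eq x x' -> sym_eq y y' ->
      sym_eq (SAdd x y) (SAdd x' y')
  | se_mul x x' y y' : sym_eq x x' -> sym_eq y y' ->
      sym_eq (SMul x y) (SMul x' y')
  | se_addA x y z : sym_eq (SAdd x (SAdd y z)) (SAdd (SAdd x y) z)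
  | se_addC x y : sym_eq (SAdd x y) (SAdd y x)
  | se_add0 x : sym_eq (SAdd (SConst 0) x) x
  | se_addN x : sym_eq (SAdd (SMul (SConst (-1)) x) x) (SConst 0)
  | se_mulA x y z : sym_eq (SMul x (SMul y z)) (SMul (SMul x y) z)
  | se_mulC x y : sym_eq (SMul x y) (SMul y x)
  | se_mul1 x : sym_eq (SMul (SConst 1) x) x
  | se_mulDl x y z : sym_eq (SMul (SAdd x y) z) (SAdd (SMul x z) (SMul y z))
  | se_constD a b : sym_eq (SConst (a + b)) (SAdd (SConst a) (SConst b))
  | se_constM a b : sym_eq (SConst (a * b)) (SMul (SConst a) (SConst b))
  | se_gen a u v :
      sym_eq (SGen (a *: u + v)) (SAdd (SMul (SConst a) (SGen u)) (SGen v)).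

Definition sym_eqb (x y : T) : bool := `[< sym_eq x y >].

Fact sym_eqb_refl : reflexive sym_eqb.
Proof. by move=> x; apply/asboolP; exact: se_refl. Qed.
Fact sym_eqb_sym : symmetric sym_eqb.
Proof. by move=> x y; apply/asboolP/asboolP; exact: se_sym. Qed.
Fact sym_eqb_trans : transitive sym_eqb.
Proof.
move=> y x z /asboolP xy /asboolP yz; apply/asboolP; exact: se_trans xy yz.
Qed.

Canonical sym_equiv := EquivRel sym_eqb sym_eqb_refl sym_eqb_sym sym_eqb_trans.

Definition symAlg := {eq_quot sym_equiv}.
HB.instance Definition _ := Choice.on symAlg.
HB.instance Definition _ := EqQuotient.on symAlg.

Definition sa_cl (t : T) : symAlg := \pi t.
Local Notation cl := sa_cl.

Lemma sa_cl_ind (P : symAlg -> Prop) : (forall t, P (cl t)) -> forall x, P x.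
Proof. by move=> Pt; elim/quotW. Qed.

Lemma sym_piP x y : sym_eq x y -> cl x = cl y.
Proof. by move=> xy; apply/eqmodP/asboolP. Qed.

Lemma sym_repr x : sym_eq (repr (cl x)) x.
Proof.
by have /eqmodP/asboolP : cl (repr (cl x)) = cl x by rewrite /sa_cl reprK.
Qed.

Definition sa_const a : symAlg := cl (SConst a).
Definition sa_gen v : symAlg := cl (SGen v).
Definition sa_add (x y : symAlg) : symAlg :=
  locked (cl (SAdd (repr x) (repr y))).
Definition sa_mul (x y : symAlg) : symAlg :=
  locked (cl (SMul (repr x) (repr y))).
Definition sa_scale a (x : symAlg) : symAlg := sa_mul (sa_const a) x.
Definition sa_opp (x : symAlg) : symAlg := sa_scale (-1) x.

Lemma sa_addE x y : sa_add (cl x) (cl y) = cl (SAdd x y).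
Proof. by rewrite /sa_add -lock; apply/sym_piP/se_add; exact: sym_repr. Qed.
Lemma sa_mulE x y : sa_mul (cl x) (cl y) = cl (SMul x y).
Proof. by rewrite /sa_mul -lock; apply/sym_piP/se_mul; exact: sym_repr. Qed.
Let saE := (sa_addE, sa_mulE).

Fact sa_addA : associative sa_add.
Proof.
by elim/sa_cl_ind=> x; elim/sa_cl_ind=> y; elim/sa_cl_ind=> z; rewrite !saE;
  exact/sym_piP/se_addA.
Qed.
Fact sa_addC : commutative sa_add.
Proof.
by elim/sa_cl_ind=> x; elim/sa_cl_ind=> y; rewrite !saE; exact/sym_piP/se_addC.
Qed.
Fact sa_add0 : left_id (sa_const 0) sa_add.
Proof. by elim/sa_cl_ind=> x; rewrite !saE; exact/sym_piP/se_add0. Qed.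
Fact sa_addN : left_inverse (sa_const 0) sa_opp sa_add.
Proof.
by elim/sa_cl_ind=> x; rewrite /sa_opp /sa_scale !saE; exact/sym_piP/se_addN.
Qed.

HB.instance Definition _ :=
  GRing.isZmodule.Build symAlg sa_addA sa_addC sa_add0 sa_addN.

Fact sa_mulA : associative sa_mul.
Proof.
by elim/sa_cl_ind=> x; elim/sa_cl_ind=> y; elim/sa_cl_ind=> z; rewrite !saE;
  exact/sym_piP/se_mulA.
Qed.
Fact sa_mulC : commutative sa_mul.
Proof.
by elim/sa_cl_ind=> x; elim/sa_cl_ind=> y; rewrite !saE; exact/sym_piP/se_mulC.
Qed.
Fact sa_mul1 : left_id (sa_const 1) sa_mul.
Proof. by elim/sa_cl_ind=> x; rewrite !saE; exact/sym_piP/se_mul1. Qed.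
Fact sa_mulDl : left_distributive sa_mul +%R.
Proof.
elim/sa_cl_ind=> x; elim/sa_cl_ind=> y; elim/sa_cl_ind=> z.
by rewrite /GRing.add /= !saE; exact/sym_piP/se_mulDl.
Qed.

Fixpoint sa_aug_term (t : T) : K :=
  match t with
  | SConst a => a
  | SGen _ => 0
  | SAdd x y => sa_aug_term x + sa_aug_term y
  | SMul x y => sa_aug_term x * sa_aug_term y
  end.
Lemma sa_aug_eq x y : sym_eq x y -> sa_aug_term x = sa_aug_term y.
Proof.
elim=> {x y} //=; try by move=> *; ring.
- by move=> x y z _ -> _ ->.
- by move=> x x' y y' _ -> _ ->.
- by move=> x x' y y' _ -> _ ->.
Qed.
Fact sa_1neq0 : sa_const 1 != 0.
Proof. by apply/eqP => /eqmodP/asboolP/sa_aug_eq /eqP; rewrite oner_eq0. Qed.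

HB.instance Definition _ := GRing.Zmodule_isComNzRing.Build symAlg
  sa_mulA sa_mulC sa_mul1 sa_mulDl sa_1neq0.

Lemma sa_constD a b : sa_const (a + b) = sa_const a + sa_const b.
Proof. by rewrite [in RHS]/GRing.add /= saE; exact/sym_piP/se_constD. Qed.
Lemma sa_constM a b : sa_const (a * b) = sa_const a * sa_const b.
Proof. by rewrite [in RHS]/GRing.mul /= saE; exact/sym_piP/se_constM. Qed.

Fact sa_scaleA a b x : sa_scale a (sa_scale b x) = sa_scale (a * b) x.
Proof. by rewrite /sa_scale sa_constM; exact: mulrA. Qed.
Fact sa_scale1 : left_id 1 sa_scale.
Proof. by move=> x; exact: sa_mul1. Qed.
Fact sa_scaleDr : right_distributive sa_scale +%R.
Proof. by move=> a x y; exact: mulrDr. Qed.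
Fact sa_scaleDl x : {morph sa_scale^~ x : a b / a + b}.
Proof. by move=> a b; rewrite /sa_scale sa_constD; exact: mulrDl. Qed.

HB.instance Definition _ := GRing.Zmodule_isLmodule.Build K symAlg
  sa_scaleA sa_scale1 sa_scaleDr sa_scaleDl.

Fact sa_scaleAl (a : K) (x y : symAlg) : a *: (x * y) = (a *: x) * y.
Proof. exact: sa_mulA. Qed.
HB.instance Definition _ :=
  GRing.Lmodule_isLalgebra.Build K symAlg sa_scaleAl.
HB.instance Definition _ := GRing.Lalgebra_isComAlgebra.Build K symAlg.

Lemma sa_scaleE a (x : symAlg) : a *: x = sa_const a * x.
Proof. by []. Qed.

Lemma sa_gen_linear a u v : sa_gen (a *: u + v) = a *: sa_gen u + sa_gen v.
Proof.
rewrite sa_scaleE [in RHS]/GRing.add [in RHS]/GRing.mul /= !saE.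
exact/sym_piP/se_gen.
Qed.
Lemma sa_ind (P : symAlg -> Prop) :
  (forall a, P (sa_const a)) -> (forall v, P (sa_gen v)) ->
  (forall x y, P x -> P y -> P (x + y)) ->
  (forall x y, P x -> P y -> P (x * y)) -> forall x, P x.
Proof.
move=> Pc Pg PD PM; elim/sa_cl_ind; elim=> [a|v|x Px y Py|x Px y Py].
- exact: Pc.
- exact: Pg.
- by rewrite -sa_addE; exact: PD.
- by rewrite -sa_mulE; exact: PM.
Qed.

(** The derivation of S(V) extending a linear map d from V to S(V). *)

Fixpoint sder_term (d : V -> symAlg) (t : T) : symAlg :=
  match t with
  | SConst _ => 0
  | SGen v => d v
  | SAdd x y => sder_term d x + sder_term d y
  | SMul x y => cl x * sder_term d y + cl y * sder_term d x
  end.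

Definition sder (d : V -> symAlg) (x : symAlg) : symAlg := sder_term d (repr x).

Section Der.
Variable d : V -> symAlg.
Hypothesis dlin : forall a u v, d (a *: u + v) = a *: d u + d v.

Lemma sder_eq x y : sym_eq x y -> sder_term d x = sder_term d y.
Proof.
have pA (x0 y0 : T) : cl (SAdd x0 y0) = cl x0 + cl y0 by rewrite -sa_addE.
have pM (x0 y0 : T) : cl (SMul x0 y0) = cl x0 * cl y0 by rewrite -sa_mulE.
have p1 : cl (SConst 1) = 1 by [].
have pN : cl (SConst (-1)) = -1.
  by rewrite -[RHS]mulr1 mulNr mul1r -(scaleN1r (1 : symAlg)) sa_scaleE mulr1.
elim=> {x y} //=.
- by move=> x y z _ -> _ ->.
- by move=> x x' y y' _ -> _ ->.
- by move=> x x' y y' /sym_piP -> -> /sym_piP -> ->.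
- by move=> x y z; rewrite addrA.
- by move=> x y; rewrite addrC.
- by move=> x; rewrite add0r.
- by move=> x; rewrite pN mulr0 addr0 mulN1r addNr.
- by move=> x y z; rewrite !pM; ring.
- by move=> x y; rewrite addrC.
- by move=> x; rewrite p1 mulr0 addr0 mul1r.
- by move=> x y z; rewrite !pA; ring.
- by move=> a b; rewrite addr0.
- by move=> a b; rewrite !mulr0 addr0.
- by move=> a u v; rewrite dlin mulr0 addr0.
Qed.

Lemma sderE x : sder d (cl x) = sder_term d x.
Proof. exact/sder_eq/sym_repr. Qed.

Lemma sder_const a : sder d (sa_const a) = 0.
Proof. exact: sderE. Qed.
Lemma sder_gen v : sder d (sa_gen v) = d v.
Proof. exact: sderE. Qed.
Lemma sderD x y : sder d (x + y) = sder d x + sder d y.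
Proof.
elim/sa_cl_ind: x => x; elim/sa_cl_ind: y => y.
by rewrite {1}/GRing.add /= saE !sderE.
Qed.
Lemma sderM x y : sder d (x * y) = x * sder d y + y * sder d x.
Proof.
elim/sa_cl_ind: x => x; elim/sa_cl_ind: y => y.
by rewrite {1}/GRing.mul /= saE !sderE.
Qed.
Lemma sderZ a x : sder d (a *: x) = a *: sder d x.
Proof. by rewrite sa_scaleE sderM sder_const mulr0 addr0. Qed.

End Der.
End SymAlg.

(** * The Poisson algebra S(L) *)

Section SymPoisson.
Variables (K : fieldType) (L : lieAlgType K).
Local Notation S := (symAlg L).
Implicit Types (f g h : S) (u v : L).

(** The derivation {-, v} of S(L), for v in L. *)
Definition sad v f : S := sder (fun u => sa_gen {[u, v]}) f.

(** {f, -} is the derivation of S(L) extending v |-> {f, v}. *)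
Definition spb f g : S := sder (fun v => sad v f) g.

Let gen_lin a u v : sa_gen (a *: u + v) = a *: sa_gen u + sa_gen v :> S.
Proof. exact: sa_gen_linear. Qed.

Let sad_lin0 v a u u' :
  sa_gen {[a *: u + u', v]} = a *: sa_gen {[u, v]} + sa_gen {[u', v]} :> S.
Proof. by rewrite lieb_linearl gen_lin. Qed.

Let sad_linr a v v' f : sad (a *: v + v') f = a *: sad v f + sad v' f.
Proof.
elim/sa_ind: f => [b|u|f g IHf IHg|f g IHf IHg].
- by rewrite /sad !sder_const ?scaler0 ?addr0 //; exact: sad_lin0.
- rewrite /sad !sder_gen; try exact: sad_lin0.
  by rewrite lieb_linearr gen_lin.
- rewrite /sad in IHf IHg *; rewrite !sderD ?IHf ?IHg; try exact: sad_lin0.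
  by rewrite scalerDr addrACA.
- rewrite /sad in IHf IHg *; rewrite !sderM ?IHf ?IHg; try exact: sad_lin0.
  by rewrite !sa_scaleE; ring.
Qed.

Let spb_lin0 f a v v' : sad (a *: v + v') f = a *: sad v f + sad v' f.
Proof. exact: sad_linr. Qed.

Let spb_constr f a : spb f (sa_const L a) = 0.
Proof. by rewrite /spb sder_const //; exact: spb_lin0. Qed.
Let spb_genr f v : spb f (sa_gen v) = sad v f.
Proof. by rewrite /spb sder_gen //; exact: spb_lin0. Qed.
Let spbDr f g h : spb f (g + h) = spb f g + spb f h.
Proof. by rewrite /spb sderD //; exact: spb_lin0. Qed.
Let spbMr f g h : spb f (g * h) = g * spb f h + h * spb f g.
Proof. by rewrite /spb sderM //; exact: spb_lin0. Qed.
Let spbZr a f g : spb f (a *: g) = a *: spb f g.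
Proof. by rewrite /spb sderZ //; exact: spb_lin0. Qed.

Let spb_gen u v : spb (sa_gen u) (sa_gen v) = sa_gen {[u, v]}.
Proof. by rewrite spb_genr /sad sder_gen //; exact: sad_lin0. Qed.

Let spb_constl a g : spb (sa_const L a) g = 0.
Proof.
elim/sa_ind: g => [b|v|f g IHf IHg|f g IHf IHg].
- exact: spb_constr.
- by rewrite spb_genr /sad sder_const //; exact: sad_lin0.
- by rewrite spbDr IHf IHg addr0.
- by rewrite spbMr IHf IHg !mulr0 addr0.
Qed.

Let spbDl f f' g : spb (f + f') g = spb f g + spb f' g.
Proof.
elim/sa_ind: g => [b|v|g h IHf IHg|g h IHf IHg].
- by rewrite !spb_constr addr0.
- by rewrite !spb_genr /sad sderD //; exact: sad_lin0.
- by rewrite !spbDr IHf IHg addrACA.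
- by rewrite !spbMr IHf IHg; ring.
Qed.

Let spbMl f f' g : spb (f * f') g = f * spb f' g + f' * spb f g.
Proof.
elim/sa_ind: g => [b|v|g h IHf IHg|g h IHf IHg].
- by rewrite !spb_constr !mulr0 addr0.
- by rewrite !spb_genr /sad sderM //; exact: sad_lin0.
- by rewrite !spbDr IHf IHg; ring.
- by rewrite !spbMr IHf IHg; ring.
Qed.

Let spbZl a f g : spb (a *: f) g = a *: spb f g.
Proof. by rewrite sa_scaleE spbMl spb_constl mulr0 addr0. Qed.

Let liebN u v : {[u, v]} = - {[v, u]}.
Proof.
have lieDl (x y z : L) : {[x + y, z]} = {[x, z]} + {[y, z]}.
  by rewrite -[x in LHS]scale1r lieb_linearl scale1r.
have lieDr (x y z : L) : {[x, y + z]} = {[x, y]} + {[x, z]}.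
  by rewrite -[y in LHS]scale1r lieb_linearr scale1r.
apply/eqP; rewrite -addr_eq0; have := liebb (u + v).
by rewrite lieDl !lieDr !liebb add0r addr0 => ->.
Qed.

Let sa_gen0 : sa_gen 0 = 0 :> S.
Proof. by have := gen_lin (-1) 0 0; rewrite scaler0 addr0 scaleN1r addNr. Qed.

Let sa_genD u v : sa_gen (u + v) = sa_gen u + sa_gen v :> S.
Proof. by rewrite -[u in LHS]scale1r gen_lin scale1r. Qed.

Let sa_genN v : sa_gen (- v) = - sa_gen v :> S.
Proof.
by rewrite -[RHS]scaleN1r -[- v]addr0 -scaleN1r gen_lin sa_gen0 addr0.
Qed.

Let spbN f g : spb f g = - spb g f.
Proof.
elim/sa_ind: f => [b|u|f f' IHf IHg|f f' IHf IHg].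
- by rewrite spb_constl spb_constr oppr0.
- elim/sa_ind: g => [b|v|g h IHf IHg|g h IHf IHg].
  + by rewrite spb_constl spb_constr oppr0.
  + by rewrite !spb_gen liebN sa_genN.
  + by rewrite spbDl spbDr IHf IHg opprD.
  + by rewrite spbMl spbMr IHf IHg; ring.
- by rewrite spbDl spbDr IHf IHg opprD.
- by rewrite spbMl spbMr IHf IHg; ring.
Qed.

Fact spb_linearl a f g h : spb (a *: f + g) h = a *: spb f h + spb g h.
Proof. by rewrite spbDl spbZl. Qed.
Fact spb_linearr a f g h : spb f (a *: g + h) = a *: spb f g + spb f h.
Proof. by rewrite spbDr spbZr. Qed.

Fact spbxx f : spb f f = 0.
Proof.
elim/sa_ind: f => [b|u|f g IHf IHg|f g IHf IHg].
- exact: spb_constl.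
- by rewrite spb_gen liebb sa_gen0.
- by rewrite spbDl !spbDr IHf IHg add0r addr0 [spb g f]spbN addrN.
- by rewrite spbMl !spbMr IHf IHg [spb g f]spbN; ring.
Qed.

Let J f g h := spb f (spb g h) + spb g (spb h f) + spb h (spb f g).

Let JC f g h : J f g h = J g h f.
Proof. by rewrite /J -addrA addrC. Qed.

Let J_const a g h : J (sa_const L a) g h = 0.
Proof.
have spb0r x : spb x 0 = 0 by exact: (spb_constr x 0).
by rewrite /J !spb_constl !spb_constr ?spb0r !addr0.
Qed.

Let JD f f' g h : J (f + f') g h = J f g h + J f' g h.
Proof. by rewrite /J !spbDl !spbDr; ring. Qed.

Let JM f f' g h : J (f * f') g h = f * J f' g h + f' * J f g h.
Proof.
rewrite /J !spbMl !spbMr !spbDr !spbMr [spb g f]spbN [spb g f']spbN.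
ring.
Qed.

Fact spb_jacobi f g h :
  spb f (spb g h) + spb g (spb h f) + spb h (spb f g) = 0.
Proof.
rewrite -/(J f g h).
have H (g0 h0 : S) : (forall u, J (sa_gen u) g0 h0 = 0) ->
    forall f0, J f0 g0 h0 = 0.
  move=> Hg; elim/sa_ind => [a|u|x y IHx IHy|x y IHx IHy].
  - exact: J_const.
  - exact: Hg.
  - by rewrite JD IHx IHy addr0.
  - by rewrite JM IHx IHy !mulr0 addr0.
apply: (H) => u; rewrite JC; apply: (H) => v; rewrite JC; apply: (H) => w.
by rewrite /J !spb_gen -!sa_genD jacobi sa_gen0.
Qed.

HB.instance Definition _ :=
  Lmodule_isLie.Build K S spb_linearl spb_linearr spbxx spb_jacobi.

Fact spb_leibniz f g h : {[f * g, h]} = f * {[g, h]} + g * {[f, h]}.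
Proof. exact: spbMl. Qed.

HB.instance Definition _ := isPoisson.Build K S spb_leibniz.

End SymPoisson.

Definition freePoisson (K : fieldType) : poissonAlgType K :=
  symAlg (freeLie K).

(** * Multilinear monomials *)

(** Bracket arrangements of the variables X_i. *)
Inductive lie_comm : Type :=
  | CVar of nat
  | CBr of lie_comm & lie_comm.

Fixpoint comm_vars (c : lie_comm) : seq nat :=
  match c with
  | CVar i => [:: i]
  | CBr c1 c2 => comm_vars c1 ++ comm_vars c2
  end.

Section Multilinear.
Variable K : fieldType.

Fixpoint comm_val (c : lie_comm) : freeLie K :=
  match c with
  | CVar i => fl_var K i
  | CBr c1 c2 => {[comm_val c1, comm_val c2]}
  end.

Definition monomial_val (m : seq lie_comm) : freePoisson K :=
  \prod_(c <- m) (sa_gen (comm_val c) : freePoisson K).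

(** Each of X_1, ..., X_n occurs exactly once, and no other variable does. *)
Definition multilinear (n : nat) (m : seq lie_comm) : Prop :=
  perm_eq (flatten (map comm_vars m)) (iota 1 n).

Definition multilinear_part (n : nat) : set (freePoisson K) :=
  lin_span (monomial_val @` [set m | multilinear n m]).

End Multilinear.
Arguments multilinear_part K n : clear implicits.

(** * Relatively free algebras and codimensions *)

Section RelFree.
Variables (K : fieldType) (W : poissonAlgType K -> Prop).
Local Notation F := (freePoisson K).

Definition poisson_identities : set F := [set f |
  forall (A : poissonAlgType K), W A ->
  forall h : F -> A, poisson_hom h -> h f = 0].
Local Notation Id := poisson_identities.

Lemma phom0 (A B : poissonAlgType K) (h : A -> B) : poisson_hom h -> h 0 = 0.
Proof.
move=> hh; have := phomP hh (-1) 0 0.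
by rewrite scaler0 addr0 scaleN1r addNr.
Qed.

Fact Id0 : Id 0.
Proof. by move=> A _ h hh; exact: phom0. Qed.
Fact IdP (a : K) x y : Id x -> Id y -> Id (a *: x + y).
Proof.
move=> Ix Iy A WA h hh.
by rewrite (phomP hh) (Ix _ WA) // (Iy _ WA) // scaler0 addr0.
Qed.
Fact IdMr x y : Id y -> Id (x * y).
Proof. by move=> Iy A WA h hh; rewrite (phomM hh) (Iy _ WA) // mulr0. Qed.
Lemma lieb0r (L : lieAlgType K) (x : L) : {[x, 0]} = 0.
Proof.
by have := lieb_linearr (-1) x 0 0; rewrite scaler0 addr0 scaleN1r addNr.
Qed.
Lemma lieb0l (L : lieAlgType K) (x : L) : {[0, x]} = 0.
Proof.
by have := lieb_linearl (-1) 0 0 x; rewrite scaler0 addr0 scaleN1r addNr.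
Qed.
Fact IdLr x y : Id y -> Id {[x, y]}.
Proof. by move=> Iy A WA h hh; rewrite (phom_lieb hh) (Iy _ WA) // lieb0r. Qed.
Fact IdLl x y : Id x -> Id {[x, y]}.
Proof. by move=> Ix A WA h hh; rewrite (phom_lieb hh) (Ix _ WA) // lieb0l. Qed.
Fact IdD x y : Id x -> Id y -> Id (x + y).
Proof. by move=> Ix Iy; rewrite -[x]scale1r; exact: IdP. Qed.
Fact IdZ a x : Id x -> Id (a *: x).
Proof. by move=> Ix; rewrite -[_ *: _]addr0; exact: (IdP _ _ Id0). Qed.
Fact IdN x : Id x -> Id (- x).
Proof. by rewrite -scaleN1r; exact: IdZ. Qed.

Definition rel_eqb (x y : F) : bool := `[< Id (x - y) >].

Fact rel_eqb_refl : reflexive rel_eqb.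
Proof. by move=> x; apply/asboolP; rewrite subrr; exact: Id0. Qed.
Fact rel_eqb_sym : symmetric rel_eqb.
Proof. by move=> x y; apply/asboolP/asboolP => /IdN; rewrite opprB. Qed.
Fact rel_eqb_trans : transitive rel_eqb.
Proof.
move=> y x z /asboolP xy /asboolP yz; apply/asboolP.
by have := IdD xy yz; rewrite addrA subrK.
Qed.

Canonical rel_equiv := EquivRel rel_eqb rel_eqb_refl rel_eqb_sym rel_eqb_trans.

(** F(W, X) = F(X) / Id(W), with the multiplication and bracket induced by those
    of F(X). It is not declared as a [poissonAlgType] only because it is zero
    when W has no (nonzero) member. *)
Definition relFree := {eq_quot rel_equiv}.
HB.instance Definition _ := Choice.on relFree.
HB.instance Definition _ := EqQuotient.on relFree.

(** The natural epimorphism from F(X) onto F(W, X). *)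
Definition rel_proj (x : F) : relFree := \pi_relFree x.
Local Notation cl := rel_proj.

Lemma rel_projP x y : Id (x - y) -> cl x = cl y.
Proof. by move=> xy; apply/eqmodP/asboolP. Qed.

Lemma rel_repr x : Id (repr (cl x) - x).
Proof.
by have /eqmodP/asboolP : cl (repr (cl x)) = cl x by rewrite /rel_proj reprK.
Qed.

Lemma rel_ind (P : relFree -> Prop) : (forall x, P (cl x)) -> forall x, P x.
Proof. by move=> Px; elim/quotW. Qed.

Definition rf_add (x y : relFree) : relFree := locked (cl (repr x + repr y)).
Definition rf_opp (x : relFree) : relFree := locked (cl (- repr x)).
Definition rf_mul (x y : relFree) : relFree := locked (cl (repr x * repr y)).
Definition rf_scale (a : K) (x : relFree) : relFree :=
  locked (cl (a *: repr x)).
Definition rf_br (x y : relFree) : relFree := locked (cl {[repr x, repr y]}).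

Lemma rf_addE x y : rf_add (cl x) (cl y) = cl (x + y).
Proof.
rewrite /rf_add -lock; apply: rel_projP; rewrite opprD addrACA.
by apply: IdD; exact: rel_repr.
Qed.
Lemma rf_oppE x : rf_opp (cl x) = cl (- x).
Proof.
rewrite /rf_opp -lock; apply: rel_projP; rewrite -opprD.
by apply: IdN; exact: rel_repr.
Qed.
Lemma rf_mulE x y : rf_mul (cl x) (cl y) = cl (x * y).
Proof.
rewrite /rf_mul -lock.
apply: rel_projP; set x' := repr _; set y' := repr _.
have -> : x' * y' - x * y = x' * (y' - y) + y * (x' - x).
  by rewrite !mulrBr [y * x']mulrC [y * x]mulrC addrA subrK.
by apply: IdD; apply: IdMr; exact: rel_repr.
Qed.
Lemma rf_scaleE a x : rf_scale a (cl x) = cl (a *: x).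
Proof.
rewrite /rf_scale -lock; apply: rel_projP; rewrite -scalerBr.
by apply: IdZ; exact: rel_repr.
Qed.
Lemma rf_brE x y : rf_br (cl x) (cl y) = cl {[x, y]}.
Proof.
rewrite /rf_br -lock.
apply: rel_projP; set x' := repr _; set y' := repr _.
have -> : {[x', y']} - {[x, y]} = {[x', y' - y]} + {[x' - x, y]}.
  rewrite [y' - y]addrC -scaleN1r lieb_linearr scaleN1r.
  by rewrite [x' - x]addrC -scaleN1r lieb_linearl scaleN1r addrACA
    [RHS]addrC addrA addrC addrK addrC.
by apply: IdD; [apply: IdLr|apply: IdLl]; exact: rel_repr.
Qed.
Let rfE := (rf_addE, rf_oppE, rf_mulE, rf_scaleE, rf_brE).

Fact rf_addA : associative rf_add.
Proof.
by elim/rel_ind=> x; elim/rel_ind=> y; elim/rel_ind=> z; rewrite !rfE addrA.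
Qed.
Fact rf_addC : commutative rf_add.
Proof. by elim/rel_ind=> x; elim/rel_ind=> y; rewrite !rfE addrC. Qed.
Fact rf_add0 : left_id (cl 0) rf_add.
Proof. by elim/rel_ind=> x; rewrite !rfE add0r. Qed.
Fact rf_addN : left_inverse (cl 0) rf_opp rf_add.
Proof. by elim/rel_ind=> x; rewrite !rfE addNr. Qed.

HB.instance Definition _ :=
  GRing.isZmodule.Build relFree rf_addA rf_addC rf_add0 rf_addN.

Lemma rel_projD x y : cl (x + y) = cl x + cl y.
Proof. by rewrite [RHS]rf_addE. Qed.

Fact rf_mulA : associative rf_mul.
Proof.
by elim/rel_ind=> x; elim/rel_ind=> y; elim/rel_ind=> z; rewrite !rfE mulrA.
Qed.
Fact rf_mulC : commutative rf_mul.
Proof. by elim/rel_ind=> x; elim/rel_ind=> y; rewrite !rfE mulrC. Qed.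
Fact rf_mul1 : left_id (cl 1) rf_mul.
Proof. by elim/rel_ind=> x; rewrite !rfE mul1r. Qed.
Fact rf_mulDl : left_distributive rf_mul +%R.
Proof.
elim/rel_ind=> x; elim/rel_ind=> y; elim/rel_ind=> z.
by rewrite -rel_projD !rfE -rel_projD mulrDl.
Qed.

HB.instance Definition _ := GRing.Zmodule_isComPzRing.Build relFree
  rf_mulA rf_mulC rf_mul1 rf_mulDl.

Fact rf_scaleA a b x : rf_scale a (rf_scale b x) = rf_scale (a * b) x.
Proof. by elim/rel_ind: x => x; rewrite !rfE scalerA. Qed.
Fact rf_scale1 : left_id 1 rf_scale.
Proof. by elim/rel_ind=> x; rewrite !rfE scale1r. Qed.
Fact rf_scaleDr : right_distributive rf_scale +%R.
Proof.
move=> a; elim/rel_ind=> x; elim/rel_ind=> y.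
by rewrite -rel_projD !rfE -rel_projD scalerDr.
Qed.
Fact rf_scaleDl x : {morph rf_scale^~ x : a b / a + b}.
Proof.
by move=> a b; elim/rel_ind: x => x; rewrite !rfE -rel_projD scalerDl.
Qed.

HB.instance Definition _ := GRing.Zmodule_isLmodule.Build K relFree
  rf_scaleA rf_scale1 rf_scaleDr rf_scaleDl.

Lemma rel_projM x y : cl (x * y) = cl x * cl y.
Proof. by rewrite [RHS]rf_mulE. Qed.
Lemma rel_projZ a x : cl (a *: x) = a *: cl x.
Proof. by rewrite [RHS]rf_scaleE. Qed.

Fact rf_brl a x y z : rf_br (a *: x + y) z = a *: rf_br x z + rf_br y z.
Proof.
elim/rel_ind: x => x; elim/rel_ind: y => y; elim/rel_ind: z => z.
by rewrite -rel_projZ -rel_projD !rfE -rel_projZ -rel_projD lieb_linearl.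
Qed.
Fact rf_brr a x y z : rf_br x (a *: y + z) = a *: rf_br x y + rf_br x z.
Proof.
elim/rel_ind: x => x; elim/rel_ind: y => y; elim/rel_ind: z => z.
by rewrite -rel_projZ -rel_projD !rfE -rel_projZ -rel_projD lieb_linearr.
Qed.
Fact rf_brxx x : rf_br x x = 0.
Proof. by elim/rel_ind: x => x; rewrite rfE liebb. Qed.
Fact rf_jacobi x y z :
  rf_br x (rf_br y z) + rf_br y (rf_br z x) + rf_br z (rf_br x y) = 0.
Proof.
elim/rel_ind: x => x; elim/rel_ind: y => y; elim/rel_ind: z => z.
by rewrite !rfE -!rel_projD jacobi.
Qed.

HB.instance Definition _ :=
  Lmodule_isLie.Build K relFree rf_brl rf_brr rf_brxx rf_jacobi.

Lemma rel_proj_br x y : cl {[x, y]} = {[cl x, cl y]}.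
Proof. by rewrite [RHS]rf_brE. Qed.

Lemma rel_proj_surj (x : relFree) : exists f : F, rel_proj f = x.
Proof. by exists (repr x); rewrite /rel_proj reprK. Qed.

Lemma rel_proj_ker (f : F) : rel_proj f = 0 <-> Id f.
Proof.
split; last by move=> If; apply: rel_projP; rewrite subr0.
by move=> /eqmodP/asboolP; rewrite subr0.
Qed.
Definition codim (n : nat) : nat :=
  dimension (rel_proj @` multilinear_part K n).

End RelFree.

(** The k-th iterated logarithm. *)
Definition iter_ln (R : realType) (k : nat) (x : R) : R := iter k (@ln R) x.

(* Main.v *)
From HB Require Import structures.
Require Import Defs.
From mathcomp Require Import all_boot all_order all_algebra.
From mathcomp Require Import generic_quotient ring lra zify.
From mathcomp Require Import all_classical all_reals all_analysis.
From mathcomp Require Import seq fintype bigop finset.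
Import Order.TTheory GRing.Theory Num.Theory.
Import numFieldNormedType.Exports.

(** Put rate n = (ln (s_1/s_2) + ln^(q-1) n) / s_1. The theorem says that the
    codimensions are n! exp(- n (rate n + o(1))), and o n is obtained by solving
    this for the numerator ([rate], [codim_upper_near], [codim_lower_near]).

    Upper bound. The relatively free algebra is a polynilpotent, hence solvable,
    Lie algebra. In a solvable Poisson algebra A the ideal generated by {A'', A},
    with A'' the second derived term, is nilpotent ([solvable_nil]). Hence in a
    product of commutators a bounded number of factors can be arbitrary, and the
    others may be taken modulo [L'', L]. The multilinear components of the spaces
    of such factors are counted by exponential generating functions
    ([bounded], [egf]): sums, products and sorted products of families of spaces
    translate into sums, products and exponentials of bounds. For the first level
    of a polynilpotent Lie algebra the bound is the sum mu of rho^k / k for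
    k <= s_1, as there are (k - 1)! multilinear commutators in k variables; the
    next term of the series is generated by a family bounded by
    rho^(s_1 + 1) exp(mu), from which a power sum and another exponential are
    formed for the second level, and so on ([poly_bound], [bounded_lcsit]). With
    q levels this is a (q - 1)-fold iterated exponential of about
    s_2 rho^(s_1) / s_1. The codimension is at most n! / rho^n times the value at
    rho ([codim_upper]); it is best to take rho as large as possible subject to
    this value being exp(o(n)), which means s_2 rho^(s_1) / s_1 = ln^(q-2) n up to
    a factor close to 1, that is, ln rho = rate n + o(1). The factors modulo
    [L'', L] contribute the exponential of a function of order rho^4 exp(rho),
    which is o(n) for this rho.

    Lower bound. For a forest on a set of nodes there is a Lie algebra with basis
    the vectors e_S, where S is a connected set of nodes, in which {e_A, e_B} is,
    up to sign, e_(A u B) if A and B are disjoint and joined by an edge, and 0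
    otherwise ([tbr], [tree_lie]). It is polynilpotent if the nodes have levels
    1, ..., q such that the nodes of one level in a connected set form a chain of
    length at most s_i ([tlie_polynilpotent]). If commutators c_a and forests t_a
    are such that c_a is nonzero in the algebra of t_b exactly for a = b, then the
    c_a are linearly independent modulo the identities ([codim_lower]). Such dual
    systems are built level by level: a path of s_1 nodes, with (s_1 - 1)!
    commutators; then a path of s_i heads at level i, below which k trees of the
    previous level are hung ([system_step]). For suitable numbers k (about ln n
    trees at level 2, and blocks of ln m lnln m letters in blocks of m letters at
    the higher levels) the number of members is n! exp(- n (rate n + o(1)))
    ([many_trees3], [many_trees_step]). *)

Set Implicit Arguments.
Unset Strict Implicit.
Unset Printing Implicit Defensive.

Local Close Scope classical_set_scope.
Local Open Scope ring_scope.
Local Open Scope quotient_scope.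
Local Notation subspace := Defs.subspace.

(** * Solvable Poisson algebras *)

(** A bracket on a commutative ring, possibly zero: this class is closed under
    quotients by arbitrary Poisson ideals. *)
Record poisson_bracket (A : comPzRingType) (br : A -> A -> A) : Prop :=
  PoissonBracket {
  pbDl : forall x y z, br (x + y) z = br x z + br y z;
  pbDr : forall x y z, br x (y + z) = br x y + br x z;
  pbxx : forall x, br x x = 0;
  pbJ : forall x y z, br x (br y z) + br y (br z x) + br z (br x y) = 0;
  pbM : forall x y z, br (x * y) z = x * br y z + y * br x z }.

(** Additive span. Membership is a finite certificate, so that identities are
    proved on generators by induction. *)
Inductive asum (A : nmodType) (G : A -> Prop) : A -> Prop :=
  | asum0 : asum G 0
  | asumS x y : G x -> asum G y -> asum G (x + y).

Lemma asumP (A : nmodType) (G P : A -> Prop) :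
  P 0 -> (forall x y, P x -> P y -> P (x + y)) -> (forall x, G x -> P x) ->
  forall x, asum G x -> P x.
Proof. by move=> P0 PD PG x; elim=> // {}x y /PG Px _; apply: PD. Qed.

Lemma asum1 (A : nmodType) (G : A -> Prop) x : G x -> asum G x.
Proof. by move=> Gx; rewrite -[x]addr0; apply: asumS => //; apply: asum0. Qed.

Lemma asumD (A : nmodType) (G : A -> Prop) x y :
  asum G x -> asum G y -> asum G (x + y).
Proof.
move=> Gx Gy; elim: Gx => [|u v Gu _ IH]; first by rewrite add0r.
by rewrite -addrA; apply: asumS.
Qed.

Lemma asumN (A : zmodType) (G : A -> Prop) x :
  (forall y, G y -> G (- y)) -> asum G x -> asum G (- x).
Proof.
move=> GN; elim=> [|u v Gu _ IH]; first by rewrite oppr0; apply: asum0.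
by rewrite opprD; apply: asumS => //; apply: GN.
Qed.

Definition nilset (A : pzRingType) (X : A -> Prop) (r : nat) : Prop :=
  forall s : seq A, size s = r -> (forall x, x \in s -> X x) ->
  \prod_(x <- s) x = 0.

(** In a product of r elements a_i x_i of the ideal, the x_i can be collected. *)
Lemma nilset_ideal (A : comPzRingType) (X : A -> Prop) r :
  nilset X r -> nilset (asum (fun z => exists a x, X x /\ z = a * x)) r.
Proof.
move=> nX s sz_s sX.
suff H : forall s' t c, (size s' + size t)%N = r ->
    (forall x, x \in s' -> asum (fun z => exists a x, X x /\ z = a * x) x) ->
    (forall x, x \in t -> X x) ->
    c * \prod_(x <- s') x * \prod_(x <- t) x = 0.
  by have := H s [::] 1; rewrite big_nil mul1r mulr1 /= addn0; apply.
elim=> [|y s' IH] t c /= szE s'X tX; first by rewrite big_nil mulr1 nX ?mulr0.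
rewrite big_cons.
have : asum (fun z => exists a x, X x /\ z = a * x) y by apply/s'X/mem_head.
elim=> [|_ v [a [x [Xx ->]]] _ IHv]; first by rewrite mul0r mulr0 mul0r.
rewrite mulrDl mulrDr mulrDl IHv addr0.
have := IH (x :: t) (c * a); rewrite big_cons /=.
move=> /(_ _ _ _)-IHx; rewrite -[RHS]IHx; first by ring.
- by rewrite addnS -addSn.
- by move=> u us'; apply: s'X; rewrite inE us' orbT.
- by move=> u; rewrite inE => /orP[/eqP->//|/tX].
Qed.

Section Bracket.
Variables (A : comPzRingType) (br : A -> A -> A).
Hypothesis brP : poisson_bracket br.
Local Notation "⟦ x , y ⟧" := (br x y) (at level 0, format "⟦ x ,  y ⟧").

Lemma pb0l x : ⟦0, x⟧ = 0.
Proof. by apply: (addrI ⟦0, x⟧); rewrite -(pbDl brP) !addr0. Qed.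
Lemma pb0r x : ⟦x, 0⟧ = 0.
Proof. by apply: (addrI ⟦x, 0⟧); rewrite -(pbDr brP) !addr0. Qed.
Lemma pbNl x y : ⟦- x, y⟧ = - ⟦x, y⟧.
Proof. by apply/eqP; rewrite -addr_eq0 -(pbDl brP) addNr pb0l. Qed.
Lemma pbNr x y : ⟦x, - y⟧ = - ⟦x, y⟧.
Proof. by apply/eqP; rewrite -addr_eq0 -(pbDr brP) addNr pb0r. Qed.
Lemma pbC x y : ⟦x, y⟧ = - ⟦y, x⟧.
Proof.
apply/eqP; rewrite -addr_eq0; have := pbxx brP (x + y).
by rewrite (pbDl brP) !(pbDr brP) !(pbxx brP) add0r addr0 => ->.
Qed.
Lemma pbMr x y z : ⟦x, y * z⟧ = y * ⟦x, z⟧ + z * ⟦x, y⟧.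
Proof. by rewrite pbC (pbM brP) 2!(pbC _ x); ring. Qed.
(** The Jacobi identity: the bracket with z is a derivation of the bracket. *)
Lemma pbJl x y z : ⟦⟦x, y⟧, z⟧ = ⟦⟦x, z⟧, y⟧ + ⟦x, ⟦y, z⟧⟧.
Proof.
have := pbJ brP x y z; rewrite (pbC y ⟦z, x⟧) (pbC z x) (pbC z ⟦x, y⟧) pbNl opprK.
by move/eqP; rewrite subr_eq0 addrC => /eqP->.
Qed.

Let brE := (pbDl brP, pbDr brP, pbM brP, pbMr, pbNl, pbNr).

(** The derived series of the Lie algebra (A, br). *)
Fixpoint der k : A -> Prop :=
  if k is k'.+1 then
    asum (fun z => exists x y, [/\ der k' x, der k' y & z = ⟦x, y⟧])
  else fun _ => True.

Lemma der_br k x y : der k x -> der k y -> der k.+1 ⟦x, y⟧.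
Proof. by move=> Dx Dy; apply: asum1; exists x, y. Qed.

Lemma der0 k : der k 0.
Proof. by case: k => //= k; apply: asum0. Qed.

Lemma derD k x y : der k x -> der k y -> der k (x + y).
Proof. by case: k => //= k; apply: asumD. Qed.

Lemma derN k x : der k x -> der k (- x).
Proof.
elim: k x => [//|k IH] x /=; apply: asumN => _ [u [v [Du Dv ->]]].
by exists (- u), v; split => //; [apply: IH|rewrite pbNl].
Qed.

Lemma derB k x y : der k x -> der k y -> der k (x - y).
Proof. by move=> Dx Dy; apply: derD => //; apply: derN. Qed.

Lemma der_idl k x a : der k x -> der k ⟦x, a⟧.
Proof.
elim: k x a => [//|k IH] x a /=.
apply: (asumP (P := fun x => der k.+1 ⟦x, a⟧)).
- by rewrite pb0l; apply: der0.
- by move=> u v Du Dv; rewrite (pbDl brP); apply: derD.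
move=> _ [u [v [Du Dv ->]]]; rewrite pbJl; apply: derD.
  by apply: der_br => //; apply: IH.
by apply: der_br => //; apply: IH.
Qed.

Lemma derW k x : der k.+1 x -> der k x.
Proof.
apply: asumP; [exact: der0|exact: derD|].
by move=> _ [u [v [Du Dv ->]]]; apply: der_idl.
Qed.

Lemma der_le j k x : (j <= k)%N -> der k x -> der j x.
Proof. by move/subnK<-; elim: (k - j)%N => // i IH /derW. Qed.

(** For a Lie ideal W, the elements bracketed into W by the whole algebra form
    a subalgebra, which contains the ideal generated by {W, W}. *)
Lemma der_mulbr k u a b : der k.+1 u -> der k ⟦u * a, b⟧.
Proof.
apply: (asumP (P := fun u => der k ⟦u * a, b⟧)) => [||_ [w [w' [Dw Dw' ->]]]].
- by rewrite mul0r pb0l; apply: der0.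
- by move=> x y Dx Dy; rewrite mulrDl (pbDl brP); apply: derD.
have -> : ⟦⟦w, w'⟧ * a, b⟧ =
    ⟦⟦w, w' * a⟧, b⟧ - ⟦w', ⟦w, a⟧ * b⟧ - ⟦⟦w, a⟧, w' * b⟧.
  by rewrite !brE [⟦⟦w, a⟧, w'⟧]pbC; ring.
have Dwa := der_idl a Dw.
by apply: derB; [apply: derB|]; [do 2!apply: der_idl|apply: der_idl..].
Qed.

End Bracket.

(** Identities below are linear combinations of two known ones; [ring] checks
    the combination once it is given. *)
Lemma lincomb0 (A : comPzRingType) (c x y z : A) :
  x = y - c * z -> y = 0 -> z = 0 -> x = 0.
Proof. by move=> -> -> ->; rewrite mulr0 subrr. Qed.

Section NilpotentSteps.
Variables (A : comPzRingType) (br : A -> A -> A).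
Hypothesis brP : poisson_bracket br.
Local Notation "⟦ x , y ⟧" := (br x y) (at level 0, format "⟦ x ,  y ⟧").
Local Notation der := (der br).
Let brE := (pbDl brP, pbDr brP, pbM brP, pbMr brP, pbNl brP, pbNr brP).

(** {U, W} for W = der k and U = {W, W}. *)
Definition dext k :=
  asum (fun z => exists u w, [/\ der k.+1 u, der k w & z = ⟦u, w⟧]).

Definition ideal_br (X : A -> Prop) z := exists x a, X x /\ z = ⟦x, a⟧.

Lemma dext_br k u w : der k.+1 u -> der k w -> dext k ⟦u, w⟧.
Proof. by move=> Du Dw; apply: asum1; exists u, w. Qed.

Lemma dextW k x : dext k x -> der k.+1 x.
Proof.
apply: asumP; [exact: der0|exact: derD|].
by move=> _ [u [w [Du Dw ->]]]; apply: der_idl.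
Qed.

Lemma dext_idl k x a : dext k x -> dext k ⟦x, a⟧.
Proof.
apply: (asumP (P := fun x => dext k ⟦x, a⟧)).
- by rewrite (pb0l brP); apply: asum0.
- by move=> y z Dy Dz; rewrite (pbDl brP); apply: asumD.
move=> _ [u [w [Du Dw ->]]]; rewrite (pbJl brP); apply: asumD; apply: dext_br => //.
  exact: der_idl.
exact: der_idl.
Qed.

(** From here on U = der k.+1 is abelian, and W = der k is the term before it. *)
Section Abelian.
Variable k : nat.
Local Notation W := (der k).
Local Notation U := (der k.+1).
Hypothesis abU : forall x, der k.+2 x -> x = 0.

Let UU u v : U u -> U v -> ⟦u, v⟧ = 0.
Proof. by move=> Uu Uv; apply: abU; apply: der_br. Qed.

Let Uid u a : U u -> U ⟦u, a⟧. Proof. exact: der_idl. Qed.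

(** Both z and {{u a, b}, w} lie in the abelian U, since {u a, b} lies in W by
    [der_mulbr]; this is the expansion of {z, {{u a, b}, w}} = 0. *)
Lemma abelian_rel z u w a b : U z -> U u -> W w ->
  u * ⟦z, ⟦⟦a, b⟧, w⟧⟧ + ⟦z, ⟦a, b⟧⟧ * ⟦u, w⟧ + ⟦z, a⟧ * ⟦⟦u, b⟧, w⟧
    + ⟦u, b⟧ * ⟦z, ⟦a, w⟧⟧ = 0.
Proof.
move=> Uz Uu Ww.
have : ⟦z, ⟦⟦u * a, b⟧, w⟧⟧ = 0.
  by apply: UU => //; apply: der_br => //; apply: der_mulbr.
have Z1 := UU Uz Uu; have Z2 := UU Uz (Uid b Uu).
have Z3 := UU Uz (Uid w Uu); have Z4 := UU Uz (Uid w (Uid b Uu)).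
by rewrite !brE Z1 Z2 Z3 Z4 => <-; ring.
Qed.

Lemma abelian_rel2 z u w a b : U z -> U u -> W w -> W a ->
  ⟦z, ⟦a, b⟧⟧ * ⟦u, w⟧ + ⟦z, a⟧ * ⟦⟦u, b⟧, w⟧ = 0.
Proof.
move=> Uz Uu Ww Wa; rewrite -[RHS](abelian_rel a b Uz Uu Ww).
have -> : ⟦z, ⟦⟦a, b⟧, w⟧⟧ = 0.
  by apply: UU => //; apply: der_br => //; apply: der_idl.
have -> : ⟦z, ⟦a, w⟧⟧ = 0 by apply: UU => //; apply: der_br.
by ring.
Qed.

(** [abelian_rel2] with {a, b} in U, for y = {z, a} and x = {u, b}. *)
Lemma dext_mul y x w : dext k y -> dext k x -> W w -> y * ⟦x, w⟧ = 0.
Proof.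
move=> Dy Dx Ww; move: x Dx; apply: asumP.
- by rewrite (pb0l brP) mulr0.
- by move=> u v Hu Hv; rewrite (pbDl brP) mulrDr Hu Hv addr0.
move=> _ [u [b [Uu Wb ->]]]; move: y Dy; apply: asumP.
- by rewrite mul0r.
- by move=> x y Hx Hy; rewrite mulrDl Hx Hy addr0.
move=> _ [z [a [Uz Wa ->]]]; rewrite -[RHS](abelian_rel2 b Uz Uu Ww Wa).
by rewrite (UU Uz (der_br Wa Wb)); ring.
Qed.

(** [dext_mul] for w = {u a, b}, which lies in W. *)
Lemma dext_rel y x u a b : dext k y -> dext k x -> U u ->
  y * u * ⟦x, ⟦a, b⟧⟧ + y * ⟦x, a⟧ * ⟦u, b⟧ = 0.
Proof.
move=> Dy Dx Uu; rewrite -[RHS](dext_mul Dy Dx (der_mulbr brP a b Uu)).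
have Ux := dextW Dx.
by rewrite !brE (UU Ux Uu) (UU Ux (Uid b Uu)); ring.
Qed.

(** [dext_rel] for a v minus v times [dext_rel] for a: the difference of the two
    relations is a single product. *)
Lemma dext_mul4 y u x a v b : dext k y -> U u -> dext k x -> U v ->
  y * u * ⟦x, a⟧ * ⟦v, b⟧ = 0.
Proof.
move=> Dy Uu Dx Uv.
have R1 := dext_rel (a * v) b Dy Dx Uu; have R2 := dext_rel a b Dy Dx Uu.
have Ux := dextW Dx; move: R1.
rewrite !brE (UU Ux Uv) (UU Ux (Uid b Uv)) => R1.
by apply: (@lincomb0 _ v _ _ _ _ R1 R2); ring.
Qed.

Lemma nil_dext : nilset (ideal_br (dext k)) 4.
Proof.
move=> [|e1 [|e2 [|e3 [|e4 []]]]] //= _ H; rewrite !big_cons big_nil mulr1 !mulrA.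
have [x1 [a1 [D1 e1E]]] : ideal_br (dext k) e1 by apply: H; rewrite !inE eqxx.
have [x2 [a2 [D2 e2E]]] : ideal_br (dext k) e2 by apply: H; rewrite !inE eqxx orbT.
have [x3 [a3 [D3 ->]]] : ideal_br (dext k) e3 by apply: H; rewrite !inE eqxx !orbT.
have [x4 [a4 [D4 ->]]] : ideal_br (dext k) e4 by apply: H; rewrite !inE eqxx !orbT.
apply: dext_mul4 => //; rewrite ?e1E ?e2E; last exact: dextW.
  exact: dext_idl.
by apply/dextW/dext_idl.
Qed.

(** If {U, W} = 0, then {z, {u a, b}} = 0 for u, z in U, and the replacement of a
    by a v works as in [dext_mul4]. *)
Lemma nil_der_ext : (forall x, dext k x -> x = 0) ->
  nilset (ideal_br U) 3.
Proof.
move=> D0 [|e1 [|e2 [|e3 []]]] //= _ H; rewrite !big_cons big_nil mulr1 !mulrA.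
have [x1 [a1 [D1 ->]]] : ideal_br U e1 by apply: H; rewrite !inE eqxx.
have [x2 [a2 [D2 ->]]] : ideal_br U e2 by apply: H; rewrite !inE eqxx orbT.
have [x3 [a3 [D3 ->]]] : ideal_br U e3 by apply: H; rewrite !inE eqxx !orbT.
have R u z a b : U u -> U z -> u * ⟦z, ⟦a, b⟧⟧ + ⟦z, a⟧ * ⟦u, b⟧ = 0.
  move=> Uu Uz; have := D0 _ (dext_br Uz (der_mulbr brP a b Uu)).
  by rewrite !brE (UU Uz Uu) (UU Uz (Uid b Uu)) => <-; ring.
have R1 := R _ _ (a2 * x3) a3 (Uid a1 D1) D2.
have R2 := R _ _ a2 a3 (Uid a1 D1) D2; move: R1.
rewrite !brE (UU D2 D3) (UU D2 (Uid a3 D3)) => R1.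
by apply: (@lincomb0 _ x3 _ _ _ _ R1 R2); ring.
Qed.

End Abelian.

Definition central (X : A -> Prop) := forall x, X x -> forall a, ⟦x, a⟧ = 0.

(** A central x in {U, W} satisfies x {a, b} = {x a, b}, which lies in W, so x D
    is contained in W for the derived algebra D. The brackets of three such
    products are central, and bracketing once more yields x1 x2 x3 {{{D, D}, D}, A}
    = 0. As der 2 is contained in {D, D}, the fourth factor is of this form when
    k >= 2. *)
Lemma nil_dext_central k : (2 <= k)%N -> central (dext k) -> nilset (dext k) 4.
Proof.
move=> k2 C [|e1 [|e2 [|e3 [|e4 []]]]] //= _ H.
rewrite !big_cons big_nil mulr1 !mulrA.
have D1 : dext k e1 by apply: H; rewrite !inE eqxx.
have D2 : dext k e2 by apply: H; rewrite !inE eqxx orbT.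
have D3 : dext k e3 by apply: H; rewrite !inE eqxx !orbT.
have D4 : dext k e4 by apply: H; rewrite !inE eqxx !orbT.
have mW x a b : dext k x -> der k (x * ⟦a, b⟧).
  move=> Dx; have := der_mulbr brP a b (dextW Dx).
  by rewrite (pbM brP) (C _ Dx) mulr0 addr0.
have mW' x d : dext k x -> der 1 d -> der k (x * d).
  move=> Dx; move: d; apply: asumP => [|x' y' Hx Hy|_ [u [v [_ _ ->]]]].
  - by rewrite mulr0; apply: der0.
  - by rewrite mulrDr; apply: derD.
  exact: mW.
have E d1 d2 d3 a : der 1 d1 -> der 1 d2 -> der 1 d3 ->
    e1 * e2 * e3 * ⟦⟦⟦d1, d2⟧, d3⟧, a⟧ = 0.
  move=> Hd1 Hd2 Hd3.
  have := C _ (dext_br (der_br (mW' _ _ D1 Hd1) (mW' _ _ D2 Hd2)) (mW' _ _ D3 Hd3)) a.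
  have C' x b : dext k x -> ⟦b, x⟧ = 0 by move=> Dx; rewrite (pbC brP) (C _ Dx) oppr0.
  by rewrite !brE ?(C _ D1, C _ D2, C _ D3, C' _ _ D1, C' _ _ D2, C' _ _ D3)
    !(pb0l brP, pb0r brP) => <-; ring.
have D1k d : der k d -> der 1 d by apply: der_le => //; apply: ltnW.
move: e4 D4 {H}; apply: asumP.
- by rewrite mulr0.
- by move=> x y Hx Hy; rewrite mulrDr Hx Hy addr0.
move=> _ [u [w [Du Dw ->]]]; move: u Du; apply: asumP.
- by rewrite (pb0l brP) mulr0.
- by move=> x y Hx Hy; rewrite (pbDl brP) mulrDr Hx Hy addr0.
move=> _ [x [y [Dx Dy ->]]]; move/(der_le brP k2): Dx; move: x; apply: asumP.
- by rewrite !(pb0l brP) mulr0.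
- by move=> x' y' Hx Hy; rewrite !(pbDl brP) mulrDr Hx Hy addr0.
by move=> _ [d [d' [Dd Dd' ->]]]; apply: E => //; apply: D1k.
Qed.

(** The argument of [nil_dext_central] with U in place of {U, W}. *)
Lemma nil_der_central k : (2 <= k)%N -> central (der k.+1) ->
  nilset (der k.+1) 3.
Proof.
move=> k2 C [|e1 [|e2 [|e3 []]]] //= _ H.
rewrite !big_cons big_nil mulr1 !mulrA.
have D1 : der k.+1 e1 by apply: H; rewrite !inE eqxx.
have D2 : der k.+1 e2 by apply: H; rewrite !inE eqxx orbT.
have D3 : der k.+1 e3 by apply: H; rewrite !inE eqxx !orbT.
have mW x d : der k.+1 x -> der 1 d -> der k (x * d).
  move=> Dx; move: d; apply: asumP => [|x' y' Hx Hy|_ [u [v [_ _ ->]]]].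
  - by rewrite mulr0; apply: der0.
  - by rewrite mulrDr; apply: derD.
  have := der_mulbr brP u v Dx.
  by rewrite (pbM brP) (C _ Dx) mulr0 addr0.
have E d1 d2 a : der 1 d1 -> der 1 d2 -> e1 * e2 * ⟦⟦d1, d2⟧, a⟧ = 0.
  move=> Hd1 Hd2; have := C _ (der_br (mW _ _ D1 Hd1) (mW _ _ D2 Hd2)) a.
  have C' x b : der k.+1 x -> ⟦b, x⟧ = 0 by move=> Dx; rewrite (pbC brP) (C _ Dx) oppr0.
  by rewrite !brE ?(C _ D1, C _ D2, C' _ _ D1, C' _ _ D2)
    !(pb0l brP, pb0r brP) => <-; ring.
move: e3 D3 {H}; apply: asumP.
- by rewrite mulr0.
- by move=> x y Hx Hy; rewrite mulrDr Hx Hy addr0.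
move=> _ [x [y [Dx Dy ->]]]; move/(der_le brP k2): Dx; move: x; apply: asumP.
- by rewrite !(pb0l brP) mulr0.
- by move=> x' y' Hx Hy; rewrite !(pbDl brP) mulrDr Hx Hy addr0.
by move=> _ [d [d' [Dd Dd' ->]]]; apply: E.
Qed.

End NilpotentSteps.

(** The case k = 1: the second derived term U is abelian. The argument of
    [nil_dext_central] does not apply, as der 1 is not contained in {D, D}. *)
Section Metabelian.
Variables (A : comPzRingType) (br : A -> A -> A).
Hypothesis brP : poisson_bracket br.
Local Notation "⟦ x , y ⟧" := (br x y) (at level 0, format "⟦ x ,  y ⟧").
Let brE := (pbDl brP, pbDr brP, pbM brP, pbMr brP, pbNl brP, pbNr brP).
Local Notation D := (der br 1).
Local Notation U := (der br 2).
Hypothesis abU : forall x, der br 3 x -> x = 0.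

Let UU u v : U u -> U v -> ⟦u, v⟧ = 0.
Proof. by move=> Uu Uv; apply: abU; apply: der_br. Qed.
Let Dbr a b : D ⟦a, b⟧. Proof. exact: der_br. Qed.
Let Ubr a b : D a -> D b -> U ⟦a, b⟧. Proof. exact: der_br. Qed.

Section Central.
Hypothesis C : central br (dext br 1).

Let C0 z d a : U z -> D d -> ⟦⟦z, d⟧, a⟧ = 0.
Proof. by move=> Uz Dd; apply: C; apply: dext_br. Qed.

Let E1 u b d : U u -> D d -> ⟦⟦u, b⟧, d⟧ = ⟦u, ⟦b, d⟧⟧.
Proof. by move=> Uu Dd; rewrite (pbJl brP) C0 // add0r. Qed.

Let E2 z u a b d : U z -> U u -> D d ->
  ⟦z, ⟦a, b⟧⟧ * ⟦u, d⟧ + ⟦z, a⟧ * ⟦u, ⟦b, d⟧⟧ + ⟦u, b⟧ * ⟦z, ⟦a, d⟧⟧ = 0.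
Proof.
move=> Uz Uu Dd; rewrite -(E1 b Uu Dd) -[RHS](abelian_rel brP abU a b Uz Uu Dd).
by rewrite (UU Uz (Ubr (Dbr a b) Dd)); ring.
Qed.

Let E3 z u y d : U z -> U u -> D y -> D d -> ⟦z, y⟧ * ⟦u, d⟧ = - (⟦u, y⟧ * ⟦z, d⟧).
Proof.
move=> Uz Uu Dy Dd; move: y Dy; apply: asumP.
- by rewrite !(pb0r brP) !mul0r oppr0.
- by move=> x y Hx Hy; rewrite !(pbDr brP) !mulrDl Hx Hy opprD.
move=> _ [a [b [_ _ ->]]]; apply/eqP; rewrite -subr_eq0; apply/eqP.
have R1 := E2 a b Uz Uu Dd; have R2 := E2 b a Uu Uz Dd.
apply: (@lincomb0 _ 1 _ _ _ _ R1 R2); rewrite [X in ⟦u, X⟧ * _ + _](pbC brP b a) !brE; ring.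
Qed.

Let S2 z u a b d : U z -> U u -> D b -> D d ->
  ⟦z, ⟦a, b⟧⟧ * ⟦u, d⟧ = - (⟦z, ⟦a, d⟧⟧ * ⟦u, b⟧).
Proof.
move=> Uz Uu Db Dd; have := E2 a b Uz Uu Dd.
rewrite (UU Uu (Ubr Db Dd)) mulr0 addr0 => /eqP.
by rewrite addr_eq0 => /eqP->; rewrite mulrC.
Qed.

(** {{{z, {p f, d}}, e}, g} = 0 because {U, D} is central. *)
Let E5 z p f d e g : U z -> D f -> D d -> D e -> D g ->
  ⟦z, ⟦p, e⟧⟧ * ⟦⟦f, d⟧, g⟧ + ⟦z, ⟦p, g⟧⟧ * ⟦⟦f, d⟧, e⟧ +
  ⟦z, f⟧ * ⟦⟦⟦p, d⟧, e⟧, g⟧ + ⟦⟦f, e⟧, g⟧ * ⟦z, ⟦p, d⟧⟧ = 0.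
Proof.
move=> Uz Df Dd De Dg.
have Ufd := Ubr Df Dd.
have : ⟦⟦⟦z, ⟦p * f, d⟧⟧, e⟧, g⟧ = 0 by rewrite (C0 e Uz (Dbr (p * f) d)) (pb0l brP).
have Z1 a := C0 a Uz (Dbr p d); have Z2 a := C0 a Uz (Dbr p e).
have Z3 a := C0 a Uz Df; have Z4 a := C0 a Ufd De.
have Z := (UU Uz Ufd, Z1, Z2, Z3, Z4,
  E1 p Uz De, E1 p Uz Dg, pb0l brP, pb0r brP, mulr0, mul0r, addr0, add0r).
by rewrite !brE !Z ?brE ?Z => <-; ring.
Qed.

(** The product {{a, b}, c} {{e, f}, d} is antisymmetric in c and d, and satisfies
    the Jacobi identity in its first three arguments. As for a curvature tensor,
    four Jacobi identities yield the symmetry under exchange of pairs, up to the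
    factor 2. *)
Let Rcurv a b c d e f : D a -> D b -> D c -> D d -> D e -> D f ->
  2%:R * (⟦⟦a, b⟧, c⟧ * ⟦⟦e, f⟧, d⟧) = 2%:R * (⟦⟦c, d⟧, a⟧ * ⟦⟦e, f⟧, b⟧).
Proof.
move=> Da Db Dc Dd De Df; have Uw := Ubr De Df; set w := ⟦e, f⟧ in Uw *.
have J x y z t : ⟦⟦x, y⟧, z⟧ * ⟦w, t⟧ + ⟦⟦y, z⟧, x⟧ * ⟦w, t⟧
    + ⟦⟦z, x⟧, y⟧ * ⟦w, t⟧ = 0.
  by rewrite (pbJl brP x y z) (pbC brP ⟦y, z⟧) (pbC brP z x) !brE; ring.
have N x y z t : D x -> D y -> D z -> D t ->
    ⟦⟦x, y⟧, z⟧ * ⟦w, t⟧ = - (⟦⟦x, y⟧, t⟧ * ⟦w, z⟧).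
  by move=> Dx Dy Dz Dt; rewrite (E3 (Ubr Dx Dy)) // mulrC.
have M x y z t : ⟦⟦x, y⟧, z⟧ * ⟦w, t⟧ = - (⟦⟦y, x⟧, z⟧ * ⟦w, t⟧).
  by rewrite (pbC brP x y) !brE; ring.
apply/eqP; rewrite -subr_eq0; apply/eqP.
have -> : 2%:R * (⟦⟦a, b⟧, c⟧ * ⟦w, d⟧) - 2%:R * (⟦⟦c, d⟧, a⟧ * ⟦w, b⟧) =
  (⟦⟦a, b⟧, c⟧ * ⟦w, d⟧ + ⟦⟦b, c⟧, a⟧ * ⟦w, d⟧ + ⟦⟦c, a⟧, b⟧ * ⟦w, d⟧)
  - (⟦⟦a, b⟧, d⟧ * ⟦w, c⟧ + ⟦⟦b, d⟧, a⟧ * ⟦w, c⟧ + ⟦⟦d, a⟧, b⟧ * ⟦w, c⟧)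
  - (⟦⟦a, c⟧, d⟧ * ⟦w, b⟧ + ⟦⟦c, d⟧, a⟧ * ⟦w, b⟧ + ⟦⟦d, a⟧, c⟧ * ⟦w, b⟧)
  + (⟦⟦b, c⟧, d⟧ * ⟦w, a⟧ + ⟦⟦c, d⟧, b⟧ * ⟦w, a⟧ + ⟦⟦d, b⟧, c⟧ * ⟦w, a⟧).
  rewrite (N a b d c) // (N b d a c) // (N d a b c) //.
  rewrite (M a c) (N c a d b) // (N c d b a) // (N d a c b) // (N b c d a) //.
  rewrite (M d b) (N b d c a) // (N b c a d) // (N c a b d) //.
  ring.
by rewrite !J; ring.
Qed.

(** The pair symmetry moves (a b), (c d) and (e f) cyclically; each exchange of
    two factors changes the sign, and after three of them 2 R = - 2 R. *)
Let Rcurv4 a b c d e f : D a -> D b -> D c -> D d -> D e -> D f ->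
  4%:R * (⟦⟦a, b⟧, c⟧ * ⟦⟦e, f⟧, d⟧) = 0.
Proof.
move=> Da Db Dc Dd De Df.
have S a' b' c' d' e' f' : D a' -> D b' -> D c' -> D d' -> D e' -> D f' ->
    ⟦⟦a', b'⟧, c'⟧ * ⟦⟦e', f'⟧, d'⟧ = - (⟦⟦e', f'⟧, c'⟧ * ⟦⟦a', b'⟧, d'⟧).
  by move=> *; apply: E3 => //; apply: Ubr.
have -> : 4%:R * (⟦⟦a, b⟧, c⟧ * ⟦⟦e, f⟧, d⟧) =
    2%:R * (⟦⟦a, b⟧, c⟧ * ⟦⟦e, f⟧, d⟧) + 2%:R * (⟦⟦a, b⟧, c⟧ * ⟦⟦e, f⟧, d⟧) by ring.
rewrite {1}(Rcurv Da Db Dc Dd De Df) (S c d a b e f) // mulrN.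
rewrite (Rcurv De Df Da Db Dc Dd) (S a b e f c d) // mulrN opprK.
by rewrite (Rcurv Dc Dd De Df Da Db) (S e f c d a b) // mulrN addNr.
Qed.

(** Two instances of [E5] multiplied by brackets with U; the terms in e and g
    cancel by [S2]. *)
Let Yswap f e g y d x z p : D f -> D e -> D g -> D y -> D d -> U x -> U z ->
  ⟦⟦f, e⟧, g⟧ * ⟦x, y⟧ * ⟦z, ⟦p, d⟧⟧ + ⟦⟦y, e⟧, g⟧ * ⟦x, f⟧ * ⟦z, ⟦p, d⟧⟧ = 0.
Proof.
move=> Df De Dg Dy Dd Ux Uz.
have H f' : D f' -> ⟦⟦f', e⟧, g⟧ * ⟦z, ⟦p, d⟧⟧ = - (⟦z, f'⟧ * ⟦⟦⟦p, d⟧, e⟧, g⟧).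
  move=> Df'; apply/eqP; rewrite -addr_eq0; apply/eqP.
  rewrite -[RHS](E5 p Uz Df' Dd De Dg) (S2 p Uz (Ubr Df' Dd) De Dg); ring.
rewrite mulrAC H // [X in _ + X]mulrAC H // !mulNr mulrAC (E3 Uz Ux Df Dy); ring.
Qed.

(** By [Yswap] and [E3] the first factor becomes totally antisymmetric, so that
    the Jacobi identity triples it. *)
Let Y3 f e t g d x z p : D f -> D e -> D t -> D g -> D d -> U x -> U z ->
  3%:R * (⟦⟦f, e⟧, t⟧ * ⟦x, g⟧ * ⟦z, ⟦p, d⟧⟧) = 0.
Proof.
move=> Df De Dt Dg Dd Ux Uz; set S := ⟦z, ⟦p, d⟧⟧.
have H f' e' t' : D f' -> D e' -> D t' ->
    ⟦⟦f', e'⟧, t'⟧ * ⟦x, g⟧ * S = - (⟦⟦t', e'⟧, f'⟧ * ⟦x, g⟧ * S).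
  move=> Df' De' Dt'; have := Yswap p Df' De' Dg Dt' Dd Ux Uz.
  rewrite (E3 (Ubr Df' De') Ux Dg Dt') (E3 (Ubr Dt' De') Ux Dg Df') -/S => /eqP.
  rewrite addr_eq0 => /eqP E; apply/eqP; rewrite -addr_eq0.
  by move/eqP: E; rewrite -addr_eq0 => /eqP E; rewrite -oppr_eq0 -E; apply/eqP; ring.
have J : ⟦⟦f, e⟧, t⟧ + ⟦⟦e, t⟧, f⟧ + ⟦⟦t, f⟧, e⟧ = 0.
  by rewrite (pbJl brP f e t) (pbC brP ⟦e, t⟧) (pbC brP t f) !brE; ring.
have H1 : ⟦⟦e, t⟧, f⟧ * ⟦x, g⟧ * S = ⟦⟦f, e⟧, t⟧ * ⟦x, g⟧ * S.
  by rewrite (pbC brP e t) !brE !mulNr -H.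
have H2 : ⟦⟦t, f⟧, e⟧ * ⟦x, g⟧ * S = ⟦⟦f, e⟧, t⟧ * ⟦x, g⟧ * S.
  by rewrite H // (pbC brP e f) !brE !mulNr opprK.
transitivity ((⟦⟦f, e⟧, t⟧ + ⟦⟦e, t⟧, f⟧ + ⟦⟦t, f⟧, e⟧) * ⟦x, g⟧ * S).
  by rewrite !mulrDl H1 H2; ring.
by rewrite J !mul0r.
Qed.

(** 3 and 4 are coprime, so that this holds in every characteristic. *)
Let mul3 u t x g z p d : U u -> D t -> U x -> D g -> U z -> D d ->
  ⟦u, t⟧ * ⟦x, g⟧ * ⟦z, ⟦p, d⟧⟧ = 0.
Proof.
move=> Uu Dt Ux Dg Uz Dd; move: u Uu; apply: asumP.
- by rewrite (pb0l brP) !mul0r.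
- by move=> v w Hv Hw; rewrite (pbDl brP) !mulrDl Hv Hw addr0.
move=> _ [f [e [Df De ->]]]; move: x Ux; apply: asumP.
- by rewrite (pb0l brP) mulr0 mul0r.
- by move=> v w Hv Hw; rewrite (pbDl brP) mulrDr mulrDl Hv Hw addr0.
move=> _ [a [b [Da Db ->]]].
have H3 := Y3 p Df De Dt Dg Dd (Ubr Da Db) Uz.
have H4 := Rcurv4 Df De Dt Dg Da Db.
set X := ⟦⟦f, e⟧, t⟧ * _ * _ in H3 *.
have -> : X = 4%:R * (⟦⟦f, e⟧, t⟧ * ⟦⟦a, b⟧, g⟧) * ⟦z, ⟦p, d⟧⟧ - 3%:R * X.
  by rewrite /X; ring.
by rewrite H3 H4 mul0r subrr.
Qed.

(** [E2] multiplied by two factors in {U, D}: [mul3] kills two of its three terms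
    and leaves the product of four. *)
Lemma nil_dext1 : nilset (dext br 1) 4.
Proof.
move=> [|e1 [|e2 [|e3 [|e4 []]]]] //= _ H.
rewrite !big_cons big_nil mulr1 !mulrA.
have D1 : dext br 1 e1 by apply: H; rewrite !inE eqxx.
have D2 : dext br 1 e2 by apply: H; rewrite !inE eqxx orbT.
have D3 : dext br 1 e3 by apply: H; rewrite !inE eqxx !orbT.
have D4 : dext br 1 e4 by apply: H; rewrite !inE eqxx !orbT.
move: {H} e1 D1; apply: asumP => [|v w Hv Hw|]; first by rewrite !mul0r.
  by rewrite !mulrDl Hv Hw addr0.
move=> _ [u1 [d1 [U1 D1 ->]]].
move: e2 D2; apply: asumP => [|v w Hv Hw|]; first by rewrite mulr0 !mul0r.
  by rewrite mulrDr !mulrDl Hv Hw addr0.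
move=> _ [u2 [d2 [U2 D2 ->]]].
move: e4 D4; apply: asumP => [|v w Hv Hw|]; first by rewrite mulr0.
  by rewrite mulrDr Hv Hw addr0.
move=> _ [u [d [Uu Dd ->]]].
move: e3 D3; apply: asumP => [|v w Hv Hw|]; first by rewrite mulr0 mul0r.
  by rewrite mulrDr mulrDl Hv Hw addr0.
move=> _ [z [d3 [Uz D3 ->]]].
move: d3 D3; apply: asumP => [|v w Hv Hw|]; first by rewrite (pb0r brP) mulr0 mul0r.
  by rewrite (pbDr brP) mulrDr mulrDl Hv Hw addr0.
move=> _ [a [b [_ _ ->]]].
have M1 := mul3 b U1 D1 U2 D2 Uu Dd; have M2 := mul3 a U1 D1 U2 D2 Uz Dd.
rewrite -mulrA; set P := _ * ⟦u2, d2⟧ in M1 M2 *.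
transitivity (P * (⟦z, ⟦a, b⟧⟧ * ⟦u, d⟧ + ⟦z, a⟧ * ⟦u, ⟦b, d⟧⟧ + ⟦u, b⟧ * ⟦z, ⟦a, d⟧⟧)
  - ⟦z, a⟧ * (P * ⟦u, ⟦b, d⟧⟧) - ⟦u, b⟧ * (P * ⟦z, ⟦a, d⟧⟧)); first by ring.
by rewrite M1 M2 (E2 a b Uz Uu Dd) !mulr0 !subr0.
Qed.
End Central.

Lemma nil_der_ext1 : (forall x, dext br 1 x -> x = 0) -> nilset (ideal_br br U) 2.
Proof.
move=> D0 [|e1 [|e2 []]] //= _ H; rewrite !big_cons big_nil mulr1.
have [x1 [a [U1 ->]]] : ideal_br br U e1 by apply: H; rewrite !inE eqxx.
have [x2 [b [U2 ->]]] : ideal_br br U e2 by apply: H; rewrite !inE eqxx orbT.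
have := D0 _ (dext_br U1 (Dbr (a * x2) b)).
have := D0 _ (dext_br U1 (Dbr a b)); have := D0 _ (dext_br U1 (Dbr x2 b)).
rewrite !brE (UU U1 U2) => -> ->; rewrite !mulr0 !add0r !addr0 => <-; ring.
Qed.
End Metabelian.

(** Quotient by a Poisson ideal. *)
Section PoissonQuotient.
Variables (A : comPzRingType) (br : A -> A -> A).
Hypothesis brP : poisson_bracket br.
Local Notation "⟦ x , y ⟧" := (br x y) (at level 0, format "⟦ x ,  y ⟧").
Variable I : A -> Prop.
Hypothesis I0 : I 0.
Hypothesis ID : forall x y, I x -> I y -> I (x + y).
Hypothesis IM : forall a x, I x -> I (a * x).
Hypothesis Ibr : forall x a, I x -> I ⟦x, a⟧.

Let IN x : I x -> I (- x). Proof. by rewrite -mulN1r; apply: IM. Qed.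
Let Ibr' a x : I x -> I ⟦a, x⟧. Proof. by rewrite (pbC brP) => /(Ibr a)/IN. Qed.

Definition pq_eqb (x y : A) : bool := `[< I (x - y) >].
Fact pq_refl : reflexive pq_eqb.
Proof. by move=> x; apply/asboolP; rewrite subrr. Qed.
Fact pq_sym : symmetric pq_eqb.
Proof. by move=> x y; apply/asboolP/asboolP => /IN; rewrite opprB. Qed.
Fact pq_trans : transitive pq_eqb.
Proof.
move=> y x z /asboolP xy /asboolP yz; apply/asboolP.
by have := ID xy yz; rewrite addrA subrK.
Qed.
Canonical pq_equiv := EquivRel pq_eqb pq_refl pq_sym pq_trans.

Definition pquot := {eq_quot pq_equiv}.
HB.instance Definition _ := Choice.on pquot.
HB.instance Definition _ := EqQuotient.on pquot.
Definition pq (x : A) : pquot := \pi_pquot x.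

Lemma pq_eq x y : I (x - y) -> pq x = pq y.
Proof. by move=> xy; apply/eqmodP/asboolP. Qed.
Lemma pq_repr x : I (repr (pq x) - x).
Proof. by have /eqmodP/asboolP : pq (repr (pq x)) = pq x by rewrite /pq reprK. Qed.
Lemma pq_ind (P : pquot -> Prop) : (forall x, P (pq x)) -> forall x, P x.
Proof. by move=> Px; elim/quotW. Qed.

Definition pq_add (x y : pquot) : pquot := locked (pq (repr x + repr y)).
Definition pq_opp (x : pquot) : pquot := locked (pq (- repr x)).
Definition pq_mul (x y : pquot) : pquot := locked (pq (repr x * repr y)).
Definition pq_br (x y : pquot) : pquot := locked (pq ⟦repr x, repr y⟧).

Lemma pq_addE x y : pq_add (pq x) (pq y) = pq (x + y).
Proof.
rewrite /pq_add -lock; apply: pq_eq; rewrite opprD addrACA.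
by apply: ID; apply: pq_repr.
Qed.
Lemma pq_oppE x : pq_opp (pq x) = pq (- x).
Proof. by rewrite /pq_opp -lock; apply: pq_eq; rewrite -opprD; apply/IN/pq_repr. Qed.
Lemma pq_mulE x y : pq_mul (pq x) (pq y) = pq (x * y).
Proof.
rewrite /pq_mul -lock; apply: pq_eq; set x' := repr _; set y' := repr _.
have -> : x' * y' - x * y = x' * (y' - y) + y * (x' - x) by ring.
by apply: ID; apply: IM; apply: pq_repr.
Qed.
Lemma pq_brE x y : pq_br (pq x) (pq y) = pq ⟦x, y⟧.
Proof.
rewrite /pq_br -lock; apply: pq_eq; set x' := repr _; set y' := repr _.
have -> : ⟦x', y'⟧ - ⟦x, y⟧ = ⟦x', y' - y⟧ + ⟦x' - x, y⟧.
  by rewrite !(pbDl brP, pbDr brP, pbNl brP, pbNr brP); ring.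
by apply: ID; [apply: Ibr'|apply: Ibr]; apply: pq_repr.
Qed.
Let pqE := (pq_addE, pq_oppE, pq_mulE, pq_brE).

Fact pq_addA : associative pq_add.
Proof. by elim/pq_ind=> x; elim/pq_ind=> y; elim/pq_ind=> z; rewrite !pqE addrA. Qed.
Fact pq_addC : commutative pq_add.
Proof. by elim/pq_ind=> x; elim/pq_ind=> y; rewrite !pqE addrC. Qed.
Fact pq_add0 : left_id (pq 0) pq_add.
Proof. by elim/pq_ind=> x; rewrite !pqE add0r. Qed.
Fact pq_addN : left_inverse (pq 0) pq_opp pq_add.
Proof. by elim/pq_ind=> x; rewrite !pqE addNr. Qed.
HB.instance Definition _ :=
  GRing.isZmodule.Build pquot pq_addA pq_addC pq_add0 pq_addN.

Lemma pqD x y : pq (x + y) = pq x + pq y. Proof. by rewrite [RHS]pq_addE. Qed.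

Fact pq_mulA : associative pq_mul.
Proof. by elim/pq_ind=> x; elim/pq_ind=> y; elim/pq_ind=> z; rewrite !pqE mulrA. Qed.
Fact pq_mulC : commutative pq_mul.
Proof. by elim/pq_ind=> x; elim/pq_ind=> y; rewrite !pqE mulrC. Qed.
Fact pq_mul1 : left_id (pq 1) pq_mul.
Proof. by elim/pq_ind=> x; rewrite !pqE mul1r. Qed.
Fact pq_mulDl : left_distributive pq_mul +%R.
Proof.
elim/pq_ind=> x; elim/pq_ind=> y; elim/pq_ind=> z.
by rewrite -pqD !pqE -pqD mulrDl.
Qed.
HB.instance Definition _ := GRing.Zmodule_isComPzRing.Build pquot
  pq_mulA pq_mulC pq_mul1 pq_mulDl.

Lemma pqM x y : pq (x * y) = pq x * pq y. Proof. by rewrite [RHS]pq_mulE. Qed.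

Lemma pq_poisson : poisson_bracket pq_br.
Proof.
split.
- elim/pq_ind=> x; elim/pq_ind=> y; elim/pq_ind=> z.
  by rewrite -pqD !pqE -pqD (pbDl brP).
- elim/pq_ind=> x; elim/pq_ind=> y; elim/pq_ind=> z.
  by rewrite -pqD !pqE -pqD (pbDr brP).
- by elim/pq_ind=> x; rewrite pqE (pbxx brP).
- elim/pq_ind=> x; elim/pq_ind=> y; elim/pq_ind=> z.
  by rewrite !pqE -!pqD (pbJ brP).
- elim/pq_ind=> x; elim/pq_ind=> y; elim/pq_ind=> z.
  by rewrite -pqM !pqE -!pqM -pqD (pbM brP).
Qed.

Lemma pq_surj y : exists x, pq x = y.
Proof. by exists (repr y); rewrite /pq reprK. Qed.

Lemma pq_ker x : pq x = 0 -> I x.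
Proof. by move=> /eqmodP/asboolP; rewrite subr0. Qed.

End PoissonQuotient.

(** Nilpotent ideals can be divided out: if r-fold products vanish modulo the
    ideal generated by X, then r0 r-fold products are products of r0 elements of
    this ideal. The derived terms of the quotient are images of those of A. *)
Lemma nil_quotient (A : comPzRingType) (br : A -> A -> A) (X : A -> Prop) r0 :
    poisson_bracket br -> (forall x a, X x -> X (br x a)) -> nilset X r0 ->
  exists (B : comPzRingType) (brB : B -> B -> B) (f : A -> B),
  [/\ poisson_bracket brB,
      (forall k y, der brB k y -> exists2 x, der br k x & y = f x),
      (forall k y, dext brB k y -> exists2 x, dext br k x & y = f x),
      (forall x y, f (br x y) = brB (f x) (f y)) /\
      (forall x, X x -> f x = 0) &
      forall r, nilset (ideal_br brB (der brB 2)) r ->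
        nilset (ideal_br br (der br 2)) (r0 * r)].
Proof.
move=> brP Xbr nX; pose I := asum (fun z => exists a x, X x /\ z = a * x).
have I0 : I 0 by apply: asum0.
have ID x y : I x -> I y -> I (x + y) by apply: asumD.
have IM a x : I x -> I (a * x).
  apply: (asumP (P := fun x => I (a * x))) => [|u v Hu Hv|_ [b [y [Xy ->]]]].
  - by rewrite mulr0.
  - by rewrite mulrDr; apply: ID.
  by apply: asum1; exists (a * b), y; rewrite mulrA.
have Ibr x a : I x -> I (br x a).
  apply: (asumP (P := fun x => I (br x a))) => [|u v Hu Hv|_ [b [y [Xy ->]]]].
  - by rewrite (pb0l brP).
  - by rewrite (pbDl brP); apply: ID.
  rewrite (pbM brP) mulrC addrC; apply: ID; apply: asum1.
    by exists (br b a), y; rewrite mulrC.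
  by exists b, (br y a); split; [apply: Xbr|rewrite mulrC].
pose f := pq I0 ID IM; pose brB := @pq_br A br I I0 ID IM.
have fD x y : f (x + y) = f x + f y by apply: pqD.
have fM x y : f (x * y) = f x * f y by apply: pqM.
have fbr x y : f (br x y) = brB (f x) (f y) by rewrite /brB pq_brE.
have lift k y : der brB k y -> exists2 x, der br k x & y = f x.
  elim: k y => [|k IH] y.
    by have [x <-] := pq_surj y; exists x.
  elim=> [|_ v [u [u' [/IH[x Dx ->] /IH[x' Dx' ->] ->]]] _ [x1 Dx1 ->]].
    by exists 0; [apply: der0|].
  exists (br x x' + x1); last by rewrite fD fbr.
  by apply: derD => //; apply: der_br.
exists _, brB, f; split => //.
- exact: pq_poisson.
- move=> k y.
  elim=> [|_ v [u [u' [/lift[x Dx ->] /lift[x' Dx' ->] ->]]] _ [x1 Dx1 ->]].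
    by exists 0; [apply: asum0|].
  exists (br x x' + x1); last by rewrite fD fbr.
  by apply: asumD => //; apply: dext_br.
- split=> // x Xx; apply: pq_eq; rewrite subr0; apply: asum1.
  by exists 1, x; rewrite mul1r.
move=> r nB.
have push k x : der br k x -> der brB k (f x).
  elim: k x => [//|k IH] x.
  elim=> [|_ v [u [u' [Hu Hu' ->]]] _ Hv]; first exact: der0.
  by rewrite fD fbr; apply: derD => //; apply: der_br; apply: IH.
have nI s : size s = r -> (forall x, x \in s -> ideal_br br (der br 2) x) ->
    I (\prod_(x <- s) x).
  move=> sz sX; apply: pq_ker; rewrite -/f.
  have -> : f (\prod_(x <- s) x) = \prod_(y <- map f s) y.
    by elim: (s) => [|x t IH]; rewrite ?big_nil // /= !big_cons fM IH.
  apply: nB; first by rewrite size_map.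
  move=> y /mapP[x /sX[u [a [Du ->]]] ->]; exists (f u), (f a).
  by rewrite fbr; split=> //; apply: push.
move=> s; have {}nX := nilset_ideal nX.
suff H j : size s = (j * r)%N -> (forall x, x \in s -> ideal_br br (der br 2) x) ->
    exists t, [/\ size t = j, forall x, x \in t -> I x &
      \prod_(x <- s) x = \prod_(x <- t) x].
  by move=> /H{}H sX; have [t [sz It ->]] := H sX; apply: nX.
elim: j s => [|j IH] s.
  by move/size0nil=> -> _; exists [::].
rewrite mulSn => sz sX.
have szd : size (drop r s) = (j * r)%N by rewrite size_drop sz addKn.
have [t [szt tI tE]] := IH _ szd (fun x xs => sX _ (mem_drop xs)).
exists (\prod_(x <- take r s) x :: t); split => /=.
- by rewrite szt.
- move=> x; rewrite inE => /orP[/eqP->|]; last exact: tI.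
  apply: nI; last by move=> y ys; apply: sX; apply: mem_take ys.
  by rewrite size_takel // sz leq_addr.
by rewrite big_cons -tE -{1}(cat_take_drop r s) big_cat.
Qed.

(** Induction on the derived length m + 1. Let U = der m be the last nonzero term
    and W the term before it. Successively, the ideals generated by
    {{U, W}, A}, by {U, W} (central by then), by {U, A} and by U (central by then)
    are nilpotent, and dividing them out lowers the derived length, as long as
    U lies below the second derived term. At the bottom the second derived term U
    is abelian, and the same steps end with {U, A}, which is the claim. *)
Theorem solvable_nil m (A : comPzRingType) (br : A -> A -> A) :
  poisson_bracket br -> (forall x, der br m x -> x = 0) ->
  exists r, nilset (ideal_br br (der br 2)) r.
Proof.
have ideal_brid (B : comPzRingType) brB (Y : B -> Prop) : poisson_bracket brB ->
    (forall x a, Y x -> Y (brB x a)) ->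
    forall x a, ideal_br brB Y x -> ideal_br brB Y (brB x a).
  by move=> _ Yi x a [u [b [Yu ->]]]; exists (brB u b), a; split=> //; apply: Yi.
have base (B : comPzRingType) brB : poisson_bracket brB ->
    (forall x : B, der brB 3 x -> x = 0) ->
    exists r, nilset (ideal_br brB (der brB 2)) r.
  move=> brP D3; have n1 := nil_dext brP D3.
  have c1 := dext_idl brP (k := 1).
  have [C [brC [f [brCP dC eC [fbr fX] H]]]] :=
    nil_quotient brP (ideal_brid _ _ _ brP c1) n1.
  suff [r nr] : exists r, nilset (ideal_br brC (der brC 2)) r.
    by exists (4 * r)%N; apply: H.
  have D3C x : der brC 3 x -> x = 0.
    by move/dC => [y /D3-> ->]; rewrite -(pbxx brP 0) fbr (pbxx brCP).
  have cC : central brC (dext brC 1).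
    move=> x /eC[y Dy ->] a; have [a' _ ->] := dC 0%N a I.
    by rewrite -fbr; apply: fX; exists y, a'.
  have n2 := nil_dext1 brCP D3C cC.
  have [E [brE [g [brEP dE eE [gbr gX] H']]]] :=
    nil_quotient brCP (dext_idl brCP (k := 1)) n2.
  exists (4 * 2)%N; apply: H'; apply: nil_der_ext1 => //.
    by move=> x /dE[y /D3C-> ->]; rewrite -(pbxx brCP 0) gbr (pbxx brEP).
  by move=> x /eE[y Dy ->]; apply: gX.
elim: m A br => [|m IH] A br brP Dm.
  by apply: base => // x _; apply: Dm.
have [m3|m3] := leqP m 2.
  by apply: base => // x Dx; apply: Dm; apply: der_le Dx; rewrite // ltnS.
have [k mE k2] : exists2 k, m = k.+1 & (2 <= k)%N by case: m m3 {IH Dm} => // k; exists k.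
subst m.
have step (B C : comPzRingType) brB brC (f : B -> C) j : poisson_bracket brB ->
    poisson_bracket brC -> (forall x y, f (brB x y) = brC (f x) (f y)) ->
    (forall k y, der brC k y -> exists2 x, der brB k x & y = f x) ->
    (forall x, der brB j x -> x = 0) -> forall x, der brC j x -> x = 0.
  move=> bB bC fbr dC H x /dC[y /H-> ->].
  by rewrite -(pbxx bB 0) fbr (pbxx bC).
have [B [brB [f [brBP dB eB [fbr fX] H]]]] :=
  nil_quotient brP (ideal_brid _ _ _ brP (dext_idl brP (k := k))) (nil_dext brP Dm).
suff [r nr] : exists r, nilset (ideal_br brB (der brB 2)) r.
  by exists (4 * r)%N; apply: H.
have DB := step _ _ _ _ _ _ brP brBP fbr dB Dm.
have cB : central brB (dext brB k).
  move=> x /eB[y Dy ->] a; have [a' _ ->] := dB 0%N a I.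
  by rewrite -fbr; apply: fX; exists y, a'.
have [C [brC [g [brCP dC eC [gbr gX] {}H]]]] :=
  nil_quotient brBP (dext_idl brBP (k := k)) (nil_dext_central brBP k2 cB).
suff [r nr] : exists r, nilset (ideal_br brC (der brC 2)) r.
  by exists (4 * r)%N; apply: H.
have DC := step _ _ _ _ _ _ brBP brCP gbr dC DB.
have zC x : dext brC k x -> x = 0 by move=> /eC[y Dy ->]; apply: gX.
have der_idC x a : der brC k.+1 x -> der brC k.+1 (brC x a) by apply: der_idl.
have [E [brE [h [brEP dE eE [hbr hX] {}H]]]] :=
  nil_quotient brCP (ideal_brid _ _ _ brCP der_idC) (nil_der_ext brCP DC zC).
suff [r nr] : exists r, nilset (ideal_br brE (der brE 2)) r.
  by exists (3 * r)%N; apply: H.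
have cE : central brE (der brE k.+1).
  move=> x /dE[y Dy ->] a; have [a' _ ->] := dE 0%N a I.
  by rewrite -hbr; apply: hX; exists y, a'.
have der_idE x a : der brE k.+1 x -> der brE k.+1 (brE x a) by apply: der_idl.
have [G [brG [l [brGP dG eG [lbr lX] {}H]]]] :=
  nil_quotient brEP der_idE (nil_der_central brEP k2 cE).
have [r nr] : exists r, nilset (ideal_br brG (der brG 2)) r.
  by apply: IH => // x /dG[y Dy ->]; apply: lX.
by exists (3 * r)%N; apply: H.
Qed.

Local Close Scope quotient_scope.
Local Open Scope classical_set_scope.
Local Open Scope ring_scope.

(** * Dimension and evaluation *)

Section Dimension.
Variables (K : fieldType) (V : lmodType K).
Implicit Types A : set V.

Lemma lin_span_range m (w : 'I_m -> V) x : lin_span (range w) x ->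
  exists c : 'I_m -> K, x = \sum_j c j *: w j.
Proof.
move=> [n [a [v [vw ->]]]].
have /choice[j jE] : forall i, exists j, w j = v i by move=> i; have [j _ <-] := vw i; exists j.
exists (fun k => \sum_(i | j i == k) a i).
rewrite [RHS](eq_bigr (fun k => \sum_(i | j i == k) a i *: v i)); last first.
  move=> k _; rewrite scaler_suml; apply: eq_bigr => i /eqP <-.
  by rewrite jE.
by rewrite (partition_big j predT).
Qed.

Lemma lin_indep_le d m (v : 'I_d -> V) (w : 'I_m -> V) :
  lin_indep v -> (forall i, lin_span (range w) (v i)) -> (d <= m)%N.
Proof.
move=> vI vw.
have /choice[c cE] : forall i, exists c : 'I_m -> K, v i = \sum_j c j *: w j.
  by move=> i; apply: lin_span_range.
rewrite leqNgt; apply/negP => dm.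
pose C := \matrix_(i < d, j < m) c i j.
have : kermx C != 0.
  rewrite -mxrank_eq0 mxrank_ker subn_eq0 -ltnNge.
  by apply: leq_ltn_trans (rank_leq_col C) dm.
move=> /eqP; apply; apply/matrixP => k i; rewrite [RHS]mxE.
apply: (vI (fun i => kermx C k i)).
rewrite (eq_bigr (fun i => \sum_j (kermx C k i * C i j) *: w j)); last first.
  move=> i' _; rewrite cE scaler_sumr; apply: eq_bigr => j _.
  by rewrite [C _ _]mxE scalerA.
rewrite exchange_big /= big1 // => j _.
rewrite -scaler_suml; have := congr1 (fun M : 'M[K]_(d, m) => M k j) (mulmx_ker C).
by rewrite [LHS]mxE [RHS]mxE => ->; rewrite scale0r.
Qed.

Lemma dimension_le A m (w : 'I_m -> V) :
  A `<=` lin_span (range w) -> (dimension A <= m)%N.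
Proof.
move=> Aw; rewrite /dimension.
case: (xgetP 0%N [set d | has_dim A d]) => [d _ [v [vA vI _]]|//].
by apply: lin_indep_le vI _ => i; apply/Aw/vA.
Qed.

(** The bound through w makes A finite-dimensional; without it [dimension] could
    take its default value 0. *)
Lemma dimension_ge A N m (v : 'I_N -> V) (w : 'I_m -> V) :
  A `<=` lin_span (range w) -> (forall i, A (v i)) -> lin_indep v ->
  (N <= dimension A)%N.
Proof.
move=> Aw vA vI.
pose P d := `[< exists u : 'I_d -> V, (forall i, A (u i)) /\ lin_indep u >].
have exP : exists d, P d by exists N; apply/asboolP; exists v.
have leP d : P d -> (d <= m)%N.
  by move=> /asboolP[u [uA uI]]; apply: lin_indep_le uI _ => i; apply/Aw/uA.
have [d /asboolP[u [uA uI]] dmax] := ex_maxnP exP leP.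
have dimd : has_dim A d.
  exists u; split=> // x Ax; apply: contrapT => nx.
  suff /dmax : P d.+1 by rewrite ltnn.
  apply/asboolP.
  exists (fun i : 'I_d.+1 => if unlift ord0 i is Some j then u j else x); split.
    by move=> i; case: unliftP.
  move=> a; rewrite big_ord_recl unlift_none.
  rewrite (eq_bigr (fun i => a (lift ord0 i) *: u i)); last by move=> i _; rewrite liftK.
  move=> a0; have a00 : a ord0 = 0.
    apply: contrapT => /eqP an0; apply: nx.
    exists d, (fun i => - (a ord0)^-1 * a (lift ord0 i)), u; split.
      by move=> i; exists i.
    under eq_bigr do rewrite mulNr scaleNr -scalerA.
    rewrite sumrN -scaler_sumr; move/eqP: a0; rewrite addrC addr_eq0 => /eqP ->.
    by rewrite scalerN opprK scalerA mulVf // scale1r.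
  move: a0; rewrite a00 scale0r add0r => /uI H i.
  by case: (unliftP ord0 i) => [j ->|->].
rewrite /dimension; case: (xgetP 0%N [set d | has_dim A d]) => [d' _ [v' [_ _ Av']]|/(_ d)//].
by apply: lin_indep_le vI _ => i; apply/Av'/vA.
Qed.

End Dimension.

(** Free Lie algebra, symmetric algebra and bracket are quotients of term
    algebras; a choice of values e of the variables is extended term by term. *)
Section Universal.
Variables (K : fieldType) (A : poissonAlgType K) (e : nat -> A).

Lemma lieDl (L : lieAlgType K) (x y z : L) : {[x + y, z]} = {[x, z]} + {[y, z]}.
Proof. by rewrite -[x in LHS]scale1r lieb_linearl scale1r. Qed.
Lemma lieDr (L : lieAlgType K) (x y z : L) : {[x, y + z]} = {[x, y]} + {[x, z]}.
Proof. by rewrite -[y in LHS]scale1r lieb_linearr scale1r. Qed.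
Lemma lieZl (L : lieAlgType K) a (x z : L) : {[a *: x, z]} = a *: {[x, z]}.
Proof. by rewrite -[_ *: x]addr0 lieb_linearl lieb0l addr0. Qed.
Lemma lieC (L : lieAlgType K) (x y : L) : {[x, y]} = - {[y, x]}.
Proof.
apply/eqP; rewrite -addr_eq0; have := liebb (x + y).
by rewrite lieDl !lieDr !liebb add0r addr0 => ->.
Qed.

Fixpoint lie_ev (t : lie_term K) : A :=
  match t with
  | LVar i => e i
  | LZero => 0
  | LAdd x y => lie_ev x + lie_ev y
  | LScale a x => a *: lie_ev x
  | LBr x y => {[lie_ev x, lie_ev y]}
  end.

Lemma lie_ev_eq x y : lie_eq x y -> lie_ev x = lie_ev y.
Proof.
elim=> {x y} //=.
- by move=> x y z _ -> _ ->.
- by move=> x x' y y' _ -> _ ->.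
- by move=> a x x' _ ->.
- by move=> x x' y y' _ -> _ ->.
- by move=> x y z; rewrite addrA.
- by move=> x y; rewrite addrC.
- by move=> x; rewrite add0r.
- by move=> x; rewrite scaleN1r addNr.
- by move=> a b x; rewrite scalerA.
- by move=> x; rewrite scale1r.
- by move=> a x y; rewrite scalerDr.
- by move=> a b x; rewrite scalerDl.
- by move=> a x y z; rewrite lieb_linearl.
- by move=> a x y z; rewrite lieb_linearr.
- by move=> x; rewrite liebb.
- by move=> x y z; rewrite jacobi.
Qed.

Definition flie_ev (x : freeLie K) : A := lie_ev (repr x).

Lemma flie_evE t : flie_ev (fl_cl t) = lie_ev t.
Proof. exact/lie_ev_eq/lie_repr. Qed.
Lemma flie_ev_var i : flie_ev (fl_var K i) = e i.
Proof. exact: flie_evE. Qed.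
Lemma flie_evP a x y : flie_ev (a *: x + y) = a *: flie_ev x + flie_ev y.
Proof.
elim/fl_ind: x => x; elim/fl_ind: y => y.
by rewrite {1}/GRing.add {1}/GRing.scale /= fl_scaleE fl_addE !flie_evE.
Qed.
Lemma flie_ev_br x y : flie_ev {[x, y]} = {[flie_ev x, flie_ev y]}.
Proof.
elim/fl_ind: x => x; elim/fl_ind: y => y.
by rewrite {1}/lieb /= fl_brE !flie_evE.
Qed.

Fixpoint sym_ev (t : sym_term K (freeLie K)) : A :=
  match t with
  | SConst a => a%:A
  | SGen v => flie_ev v
  | SAdd x y => sym_ev x + sym_ev y
  | SMul x y => sym_ev x * sym_ev y
  end.

Lemma sym_ev_eq x y : sym_eq x y -> sym_ev x = sym_ev y.
Proof.
elim=> {x y} //=.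
- by move=> x y z _ -> _ ->.
- by move=> x x' y y' _ -> _ ->.
- by move=> x x' y y' _ -> _ ->.
- by move=> x y z; rewrite addrA.
- by move=> x y; rewrite addrC.
- by move=> x; rewrite scale0r add0r.
- by move=> x; rewrite -scalerAl mul1r scaleN1r addNr scale0r.
- by move=> x y z; rewrite mulrA.
- by move=> x y; rewrite mulrC.
- by move=> x; rewrite scale1r mul1r.
- by move=> x y z; rewrite mulrDl.
- by move=> a b; rewrite scalerDl.
- by move=> a b; rewrite -scalerAl mul1r scalerA.
- by move=> a u v; rewrite flie_evP -scalerAl mul1r.
Qed.

Definition free_ev (x : freePoisson K) : A := sym_ev (repr x).

Lemma free_evE t : free_ev (sa_cl t) = sym_ev t.
Proof. exact/sym_ev_eq/sym_repr. Qed.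
Lemma free_ev_gen v : free_ev (sa_gen v) = flie_ev v.
Proof. exact: free_evE. Qed.
Lemma free_ev_const a : free_ev (sa_const _ a) = a%:A.
Proof. exact: free_evE. Qed.
Lemma free_evD x y : free_ev (x + y) = free_ev x + free_ev y.
Proof.
elim/sa_cl_ind: x => x; elim/sa_cl_ind: y => y.
by rewrite {1}/GRing.add /= sa_addE !free_evE.
Qed.
Lemma free_evM x y : free_ev (x * y) = free_ev x * free_ev y.
Proof.
elim/sa_cl_ind: x => x; elim/sa_cl_ind: y => y.
by rewrite {1}/GRing.mul /= sa_mulE !free_evE.
Qed.
Lemma free_evZ a x : free_ev (a *: x) = a *: free_ev x.
Proof. by rewrite sa_scaleE free_evM free_ev_const -scalerAl mul1r. Qed.

(** The bracket of F(X) extends that of L(X). *)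
Lemma sa_gen_br u v :
  {[sa_gen u : freePoisson K, sa_gen v : freePoisson K]} = sa_gen {[u, v]}.
Proof.
have gl (w : freeLie K) a u0 u' : (sa_gen {[a *: u0 + u', w]} : freePoisson K)
    = a *: sa_gen {[u0, w]} + sa_gen {[u', w]}.
  by rewrite lieb_linearl sa_gen_linear.
have sE w : sad w (sa_gen u) = sa_gen {[u, w]}.
  by rewrite /sad sder_gen //; exact: gl.
rewrite [LHS]/(spb (sa_gen u) (sa_gen v)) /spb sder_gen ?sE // => a x y.
by rewrite !sE lieb_linearr sa_gen_linear.
Qed.

Lemma lie1l (B : poissonAlgType K) (y : B) : {[1, y]} = 0.
Proof.
have := leibniz (1 : B) 1 y; rewrite !mul1r => /eqP.
by rewrite -subr_eq0 opprD addrA subrr add0r oppr_eq0 => /eqP.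
Qed.

Lemma leibnizr (B : poissonAlgType K) (x y z : B) :
  {[x, y * z]} = y * {[x, z]} + z * {[x, y]}.
Proof. by rewrite lieC leibniz [{[y, x]}]lieC [{[z, x]}]lieC !mulrN opprD !opprK. Qed.

Lemma free_ev_br x y : free_ev {[x, y]} = {[free_ev x, free_ev y]}.
Proof.
have cE a : sa_const _ a = a *: (1 : freePoisson K).
  by rewrite sa_scaleE mulr1.
have cl a z : {[sa_const _ a : freePoisson K, z]} = 0.
  by rewrite cE lieZl lie1l scaler0.
have cl' a (z : A) : {[a%:A, z]} = 0 by rewrite lieZl lie1l scaler0.
have fe0 : free_ev 0 = 0 by rewrite (free_ev_const 0) scale0r.
elim/sa_ind: x => [a|u|x x' IH IH'|x x' IH IH'].
- by rewrite cl free_ev_const cl'.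
- elim/sa_ind: y => [a|v|y y' IH IH'|y y' IH IH'].
  + by rewrite lieC cl oppr0 free_ev_const [RHS]lieC cl' oppr0.
  + by rewrite sa_gen_br !free_ev_gen flie_ev_br.
  + by rewrite lieDr !free_evD IH IH' lieDr.
  + by rewrite leibnizr free_evD !free_evM IH IH' leibnizr.
- by rewrite lieDl !free_evD IH IH' lieDl.
- by rewrite leibniz free_evD !free_evM IH IH' leibniz.
Qed.

Lemma free_ev_hom : poisson_hom free_ev.
Proof.
split.
- by move=> a x y; rewrite free_evD free_evZ.
- by rewrite (free_ev_const 1) scale1r.
- exact: free_evM.
- exact: free_ev_br.
Qed.

End Universal.

(** * Exponential generating functions *)

Section Norm.
Variable R : realType.
Implicit Types (h : nat -> nat) (rho : R).

(** Truncated, so that no convergence is involved; h k will be a bound for the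
    dimension of a multilinear component in k variables. *)
Definition egf N rho h : R := \sum_(k < N.+1) (h k)%:R * rho ^+ k / k`!%:R.

(** Binomial convolution: the variables are distributed among two factors. *)
Definition conv h1 h2 k := (\sum_(j < k.+1) 'C(k, j) * (h1 j * h2 (k - j)))%N.

Lemma egf_ge0 N rho h : 0 <= rho -> 0 <= egf N rho h.
Proof. by move=> r0; apply: sumr_ge0 => k _; rewrite !mulr_ge0 ?exprn_ge0 ?invr_ge0. Qed.

Lemma ler_sum_widen (F : nat -> R) m n : (m <= n)%N -> (forall i, 0 <= F i) ->
  \sum_(0 <= i < m) F i <= \sum_(0 <= i < n) F i.
Proof.
by move=> mn F0; rewrite [leRHS](@big_cat_nat _ _ _ m) //= lerDl sumr_ge0.
Qed.

Lemma egf_conv N rho h1 h2 : 0 <= rho ->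
  egf N rho (conv h1 h2) <= egf N rho h1 * egf N rho h2.
Proof.
move=> r0; pose f h k := (h k)%:R * rho ^+ k / k`!%:R : R.
have f0 h k : 0 <= f h k by rewrite !mulr_ge0 ?exprn_ge0 ?invr_ge0.
have fE k : f (conv h1 h2) k = \sum_(0 <= j < k.+1) f h1 j * f h2 (k - j)%N.
  rewrite big_mkord /f /conv natr_sum !mulr_suml; apply: eq_bigr => -[j /=].
  rewrite ltnS => jk _.
  have -> : rho ^+ k = rho ^+ j * rho ^+ (k - j) by rewrite -exprD subnKC.
  rewrite -(bin_fact jk) !natrM.
  have n1 : (j`!%:R : R) != 0 by rewrite pnatr_eq0 -lt0n fact_gt0.
  have n2 : ((k - j)`!%:R : R) != 0 by rewrite pnatr_eq0 -lt0n fact_gt0.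
  have n3 : ('C(k, j)%:R : R) != 0 by rewrite pnatr_eq0 -lt0n bin_gt0.
  by field; rewrite n1 n2 n3.
have eE h : egf N rho h = \sum_(0 <= k < N.+1) f h k by rewrite big_mkord.
have cE (a b : nat -> R) M : \sum_(0 <= k < M.+1) \sum_(0 <= j < k.+1) a j * b (k - j)%N =
    \sum_(0 <= j < M.+1) a j * \sum_(0 <= i < (M - j).+1) b i.
  elim: M => [|M IH]; first by rewrite !big_nat1.
  rewrite big_nat_recr //= IH [RHS]big_nat_recr //= subnn big_nat1.
  rewrite [X in _ + X]big_nat_recr //= subnn addrA; congr (_ + _).
  rewrite -big_split /=; apply: eq_big_nat => j /andP[_ jN].
  by rewrite subSn // [in RHS]big_nat_recr //= mulrDr.
rewrite !eE (eq_big_nat _ _ (fun k _ => fE k)) cE mulr_suml.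
apply: ler_sum => j _; apply: ler_wpM2l => //.
by apply: ler_sum_widen => //; rewrite ltnS leq_subr.
Qed.

Lemma egf_add N rho h1 h2 :
  egf N rho (fun k => h1 k + h2 k)%N = egf N rho h1 + egf N rho h2.
Proof.
by rewrite /egf -big_split; apply: eq_bigr => k _; rewrite natrD !mulrDl.
Qed.

(** The number of structures on r labels that consist of an unordered set of
    blocks, a block of size k being of one of h k kinds: with k + 1 elements in
    the block of the last element, C(r, k) choices for the others. The table
    [exps h r] lists the values at r, r - 1, ..., 0. *)
Fixpoint exps h r : seq nat :=
  if r is r'.+1 then
    (\sum_(k < r) 'C(r', k) * (h k.+1 * nth 0 (exps h r') k))%N :: exps h r'
  else [:: 1%N].
Definition expn_ h r := head 0%N (exps h r).

Lemma nth_exps h r k : (k <= r)%N -> nth 0%N (exps h r) k = expn_ h (r - k).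
Proof.
elim: r k => [|r IH] [|k] //=; rewrite ltnS => kr.
by rewrite subSS IH.
Qed.

Lemma expn_S h r :
  expn_ h r.+1 = (\sum_(k < r.+1) 'C(r, k) * (h k.+1 * expn_ h (r - k)))%N.
Proof.
by rewrite /expn_ /=; apply: eq_bigr => k _; rewrite nth_exps // -ltnS.
Qed.

(** The exponential formula. Truncations P of the series of h and Q of its
    exponential satisfy Q' = P' Q up to the order needed, which is the recursion
    of [expn_], and Q(1) is at most exp(P(1)) by nonnegativity. *)
Lemma egf_exp N rho h : 0 <= rho -> egf N rho (expn_ h) <= expR (egf N rho h).
Proof.
move=> r0; pose f h k := (h k)%:R * rho ^+ k / k`!%:R : R.
have f0 h' k : 0 <= f h' k by rewrite !mulr_ge0 ?exprn_ge0 ?invr_ge0.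
have rec r : r.+1%:R * f (expn_ h) r.+1 =
    \sum_(k < r.+1) k.+1%:R * f h k.+1 * f (expn_ h) (r - k)%N.
  rewrite {1}/f expn_S natr_sum !mulr_suml mulr_sumr; apply: eq_bigr => -[k /=].
  rewrite ltnS => kr _; rewrite /f.
  have -> : rho ^+ r.+1 = rho ^+ k.+1 * rho ^+ (r - k) by rewrite -exprD addSn subnKC.
  rewrite factS [(k.+1)`!]factS -(bin_fact kr) !natrM.
  have n1 : (k`!%:R : R) != 0 by rewrite pnatr_eq0 -lt0n fact_gt0.
  have n2 : ((r - k)`!%:R : R) != 0 by rewrite pnatr_eq0 -lt0n fact_gt0.
  have n3 : ('C(r, k)%:R : R) != 0 by rewrite pnatr_eq0 -lt0n bin_gt0.
  have n4 : (k.+1%:R : R) != 0 by rewrite pnatr_eq0.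
  have n5 : (r.+1%:R : R) != 0 by rewrite pnatr_eq0.
  set a := k.+1%:R in n4 *; set b := r.+1%:R in n5 *.
  clearbody a b; by field; rewrite n1 n2 n3 n4 n5.
(* P = sum_(1 <= k <= N) (f h k) X^k, Q j = sum_(i <= j) P^i / i! *)
pose P : {poly R} := \poly_(i < N.+1) (if i == 0%N then 0 else f h i).
pose Q j : {poly R} := \sum_(i < j.+1) (i`!%:R)^-1 *: P ^+ i.
have P0 : P`_0 = 0 by rewrite coef_poly.
have PE k : (0 < k <= N)%N -> P`_k = f h k.
  by move=> /andP[k0 kN]; rewrite coef_poly ltnS kN; case: k k0 {kN}.
have Pge k : 0 <= P`_k by rewrite coef_poly; case: ifP => // _; case: ifP.
have Pcoef i k : (k < i)%N -> (P ^+ i)`_k = 0.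
  elim: i k => // i IH k; rewrite ltnS => ki; rewrite exprS coefM.
  apply: big1 => -[[|l] /= lk] _; first by rewrite P0 mul0r.
  by rewrite IH ?mulr0 //; lia.
have Qd j : (Q j.+1)^`() = P^`() * Q j.
  rewrite /Q big_ord_recl expr0 derivD derivZ derivC scaler0 add0r.
  rewrite raddf_sum /= mulr_sumr; apply: eq_bigr => i _.
  rewrite derivZ deriv_exp /bump /= add1n -scalerAr -[_ *+ i.+1]scaler_nat scalerA.
  congr (_ *: _); rewrite factS natrM invfM mulrAC mulVf ?mul1r //.
have Qle j i : (i < j)%N -> (Q j)`_i = (Q j.-1)`_i.
  case: j => // j ij; rewrite /Q big_ord_recr /= coefD coefZ Pcoef // mulr0 addr0.
  by case: j ij => [|j] //=.
have Qge j i : 0 <= (Q j)`_i.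
  rewrite coef_sum; apply: sumr_ge0 => l _; rewrite coefZ mulr_ge0 ?invr_ge0 //.
  elim: (val l) i => [|l' IH] i; first by rewrite expr0 coef1.
  by rewrite exprS coefM; apply: sumr_ge0 => ? _; rewrite mulr_ge0.
have fQ r : (r <= N)%N -> f (expn_ h) r <= (Q N)`_r.
  elim/ltn_ind: r => -[|r] IH rN.
    rewrite {1}/f /expn_ /= fact0 divr1 mulr1.
    rewrite coef_sum big_ord_recl expr0 coefZ coef1 fact0 invr1 mulr1 lerDl.
    by apply: sumr_ge0 => l _; rewrite coefZ Pcoef // mulr0.
  rewrite -(@ler_pM2l _ r.+1%:R) ?ltr0n // rec mulr_natl -coef_deriv.
  have QdN := Qd N.-1; rewrite prednK in QdN; last by lia.
  rewrite QdN coefM; apply: ler_sum => -[k /=]; rewrite ltnS => kr _.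
  rewrite coef_deriv PE /=; last by lia.
  rewrite mulr_natl ler_wpM2l ?mulrn_wge0 // -Qle; last by lia.
  by apply: IH; lia.
have coefs1 (p : {poly R}) m : (forall i, 0 <= p`_i) -> \sum_(r < m) p`_r <= p.[1].
  move=> p0; rewrite (horner_coef_wide 1 (leq_maxr m (size p))).
  rewrite [leRHS](eq_bigr (fun i : 'I__ => p`_i)); last by move=> i _; rewrite expr1n mulr1.
  rewrite -(big_mkord xpredT (fun i => p`_i)) -(big_mkord xpredT (fun i => p`_i)).
  by apply: ler_sum_widen => //; apply: leq_maxl.
have P1 : P.[1] <= egf N rho h.
  rewrite (horner_coef_wide 1 (size_poly _ _)); apply: ler_sum => k _.
  rewrite expr1n mulr1 coef_poly ltn_ord; case: ifP => // _; exact: f0.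
have P10 : 0 <= P.[1].
  rewrite (horner_coef_wide 1 (size_poly _ _)); apply: sumr_ge0 => k _.
  by rewrite expr1n mulr1.
apply: (@le_trans _ _ (expR P.[1])); last by rewrite ler_expR.
apply: (@le_trans _ _ (\sum_(r < N.+1) (Q N)`_r)).
  by apply: ler_sum => r _; apply: fQ; rewrite -ltnS.
apply: le_trans (coefs1 _ _ (Qge N)) _; rewrite horner_sum.
have -> : \sum_(i < N.+1) ((i`!%:R)^-1 *: P ^+ i).[1] = series (exp_coeff P.[1]) N.+1.
  rewrite /series /= big_mkord; apply: eq_bigr => i _.
  by rewrite hornerZ horner_exp /exp_coeff /= mulrC.
apply: nondecreasing_cvgn_le; last exact: is_cvg_series_exp_coeff.
by apply: nondecreasing_series => i _ _; rewrite /exp_coeff /= divr_ge0 ?exprn_ge0.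
Qed.
End Norm.

Local Close Scope classical_set_scope.
Local Notation "A ⊆ B" := (forall x, A x -> B x) (at level 70, only parsing).

Lemma disjUl (T : finType) (A B C : {set T}) :
  [disjoint A :|: B & C] = [disjoint A & C] && [disjoint B & C].
Proof. by rewrite -!setI_eq0 setIUl setU_eq0. Qed.
Lemma disjUr (T : finType) (A B C : {set T}) :
  [disjoint C & A :|: B] = [disjoint C & A] && [disjoint C & B].
Proof. by rewrite -!setI_eq0 setIUr setU_eq0. Qed.

(** * Families of multilinear components *)

Section Span.
Variables (K : fieldType) (V : lmodType K).
Implicit Types (G P : set V).

(** The inductive form of [lin_span]. *)
Inductive lspan G : V -> Prop :=
  | lspan0 : lspan G 0
  | lspanS a x y : G x -> lspan G y -> lspan G (a *: x + y).

Lemma lspan1 G x : G x -> lspan G x.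
Proof. by move=> Gx; rewrite -[x]addr0 -[x]scale1r; apply: lspanS => //; apply: lspan0. Qed.

Lemma lspan_subspace G : subspace (lspan G).
Proof.
split; first exact: lspan0.
move=> a x y Gx Gy; elim: Gx => [|b u v Gu _ IH]; first by rewrite scaler0 add0r.
by rewrite scalerDr -addrA scalerA; apply: lspanS.
Qed.

Lemma subspaceD P x y : subspace P -> P x -> P y -> P (x + y).
Proof. by move=> [_ PD] Px Py; rewrite -[x]scale1r; apply: PD. Qed.
Lemma subspaceZ P a x : subspace P -> P x -> P (a *: x).
Proof. by move=> [P0 PD] Px; rewrite -[_ *: x]addr0; apply: PD. Qed.
Lemma subspaceN P x : subspace P -> P x -> P (- x).
Proof. by move=> sP Px; rewrite -scaleN1r; apply: subspaceZ. Qed.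
Lemma subspaceB P x y : subspace P -> P x -> P y -> P (x - y).
Proof. by move=> sP Px Py; apply: subspaceD => //; apply: subspaceN. Qed.

Lemma lspan_min G P : subspace P -> G ⊆ P -> lspan G ⊆ P.
Proof. by move=> [P0 PD] GP x; elim=> // a u v /GP Pu _; apply: PD. Qed.

Lemma lspan_mono G P : G ⊆ P -> lspan G ⊆ lspan P.
Proof. by move=> GP; apply: lspan_min; [exact: lspan_subspace|move=> x /GP; apply: lspan1]. Qed.

Lemma lspan_lin_span G x : lspan G x -> lin_span G x.
Proof.
elim=> [|a u v Gu _ [m [c [w [Gw ->]]]]].
  by exists 0%N, (fun=> 0), (fun=> 0); rewrite big_ord0; split=> // i; case: i.
exists m.+1, (fun i => oapp c a (unlift ord0 i)), (fun i => oapp w u (unlift ord0 i)); split.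
  by move=> i; case: unliftP => [j|] _ //=; apply: Gw.
rewrite big_ord_recl unlift_none /=; congr (_ + _).
by apply: eq_bigr => i _; rewrite liftK.
Qed.

Lemma lin_span_lspan G x : lin_span G x -> lspan G x.
Proof.
move=> [m [c [w [Gw ->]]]]; elim/big_rec: _ => [|i y _ Gy]; first exact: lspan0.
exact: lspanS.
Qed.

Definition bilin (op : V -> V -> V) :=
  (forall a x y z, op (a *: x + y) z = a *: op x z + op y z) /\
  (forall a x y z, op z (a *: x + y) = a *: op z x + op z y).

Lemma bilin0l op x : bilin op -> op 0 x = 0.
Proof. by move=> [ol _]; have := ol (-1) 0 0 x; rewrite scaler0 addr0 scaleN1r addNr. Qed.
Lemma bilin0r op x : bilin op -> op x 0 = 0.
Proof. by move=> [_ ol]; have := ol (-1) 0 0 x; rewrite scaler0 addr0 scaleN1r addNr. Qed.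

Lemma subspace_opl op P y : bilin op -> subspace P -> subspace (fun x => P (op x y)).
Proof.
move=> bo [P0 PD]; split; first by rewrite /= bilin0l.
by move=> a u v Pu Pv /=; rewrite bo.1; apply: PD.
Qed.
Lemma subspace_opr op P x : bilin op -> subspace P -> subspace (fun y => P (op x y)).
Proof.
move=> bo [P0 PD]; split; first by rewrite /= bilin0r.
by move=> a u v Pu Pv /=; rewrite bo.2; apply: PD.
Qed.

Lemma lspan_op op G H P : bilin op -> subspace P ->
  (forall x y, G x -> H y -> P (op x y)) ->
  forall x y, lspan G x -> lspan H y -> P (op x y).
Proof.
move=> bo sP GHP x y Gx Hy; move: x Gx; apply: lspan_min.
  exact: (subspace_opl _ bo sP).
move=> x Gx /=; move: y Hy; apply: lspan_min; first exact: (subspace_opr _ bo sP).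
by move=> y Hy /=; apply: GHP.
Qed.

Definition dimle P (k : nat) :=
  exists s : seq V, (size s <= k)%N /\ P ⊆ lspan (fun x => x \in s).

Lemma dimle_le P Q j k : (j <= k)%N -> P ⊆ Q -> dimle Q j -> dimle P k.
Proof.
move=> jk PQ [s [sz Qs]]; exists s; split; first exact: leq_trans sz jk.
by move=> x /PQ/Qs.
Qed.

Lemma dimle_lspan G k : dimle G k -> dimle (lspan G) k.
Proof.
move=> [s [sz Gs]]; exists s; split=> //; apply: lspan_min => //.
exact: lspan_subspace.
Qed.

Lemma dimle0 P : P ⊆ (fun x => x = 0) -> dimle P 0.
Proof. by move=> P0; exists [::]; split=> // x /P0 ->; apply: lspan0. Qed.

End Span.

Section Families.
Variables (K : fieldType) (V : lmodType K) (n : nat).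

(** The multilinear components of a subspace, one for each set of variables. *)
Definition fam := {set 'I_n} -> set V.
Implicit Types (M N : fam) (S : {set 'I_n}).

Definition fle M N := forall S x, M S x -> N S x.
Definition fsub M := forall S, subspace (M S).
Definition fpos M := forall x, M set0 x -> x = 0.

Definition fadd M N : fam := fun S => lspan (fun z => M S z \/ N S z).
Definition fop (op : V -> V -> V) M N : fam := fun S =>
  lspan (fun z => exists S1 S2 x y,
    [/\ S = S1 :|: S2, [disjoint S1 & S2], M S1 x, N S2 y & z = op x y]).

Lemma fop_sub op M N : fsub (fop op M N).
Proof. by move=> S; apply: lspan_subspace. Qed.
Lemma fadd_sub M N : fsub (fadd M N).
Proof. by move=> S; apply: lspan_subspace. Qed.

Lemma fop1 op M N S1 S2 x y : [disjoint S1 & S2] -> M S1 x -> N S2 y ->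
  fop op M N (S1 :|: S2) (op x y).
Proof. by move=> dS Mx Ny; apply: lspan1; exists S1, S2, x, y. Qed.

Lemma faddl M N : fle M (fadd M N).
Proof. by move=> S x Mx; apply: lspan1; left. Qed.
Lemma faddr M N : fle N (fadd M N).
Proof. by move=> S x Mx; apply: lspan1; right. Qed.

Lemma fop_min op M N P : fsub P ->
  (forall S1 S2 x y, [disjoint S1 & S2] -> M S1 x -> N S2 y -> P (S1 :|: S2) (op x y)) ->
  fle (fop op M N) P.
Proof.
move=> sP H S; apply: lspan_min => // _ [S1 [S2 [x [y [-> dS Mx Ny ->]]]]].
exact: H.
Qed.

Lemma fadd_min M N P : fsub P -> fle M P -> fle N P -> fle (fadd M N) P.
Proof. by move=> sP MP NP S; apply: lspan_min => // x [/MP|/NP]. Qed.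

Lemma fle_trans N M P : fle M N -> fle N P -> fle M P.
Proof. by move=> MN NP S x /MN /NP. Qed.

Lemma fle_refl M : fle M M. Proof. by []. Qed.

Lemma fop_mono op M M' N N' : fle M M' -> fle N N' -> fle (fop op M N) (fop op M' N').
Proof.
move=> MM NN; apply: fop_min => [|S1 S2 x y dS /MM Mx /NN Ny]; first exact: fop_sub.
exact: fop1.
Qed.

Lemma fop_addl op M M' N P : bilin op -> fsub P ->
  fle (fop op M N) P -> fle (fop op M' N) P -> fle (fop op (fadd M M') N) P.
Proof.
move=> bo sP MP MP'; apply: fop_min => // S1 S2 x y dS Mx Ny.
move: x Mx; apply: (lspan_min (P := (fun x => P (S1 :|: S2) (op x y)))).
  exact: (subspace_opl _ bo (sP _)).
by move=> x [Mx|Mx] /=; [apply: MP|apply: MP']; apply: fop1.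
Qed.

Lemma fop_addr op M N N' P : bilin op -> fsub P ->
  fle (fop op M N) P -> fle (fop op M N') P -> fle (fop op M (fadd N N')) P.
Proof.
move=> bo sP MP MP'; apply: fop_min => // S1 S2 x y dS Mx Ny.
move: y Ny; apply: (lspan_min (P := (fun y => P (S1 :|: S2) (op x y)))).
  exact: (subspace_opr _ bo (sP _)).
by move=> y [Ny|Ny] /=; [apply: MP|apply: MP']; apply: fop1.
Qed.

(** ** Sorted products *)

(** op (.. (op b m_1) ..) m_t with b in B on S0 and blocks m_i in M ordered by
    the last elements of their supports, whose union is the second set. *)
Inductive srt_gen (op : V -> V -> V) (B M : fam) (S0 : {set 'I_n}) :
    {set 'I_n} -> V -> Prop :=
  | srt0 b : B S0 b -> srt_gen op B M S0 set0 b
  | srtS S1 S2 t m (i : 'I_n) : srt_gen op B M S0 S1 t -> M S2 m ->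
      [disjoint S0 :|: S1 & S2] -> i \in S2 ->
      (forall j, j \in S1 :|: S2 -> (j <= i)%N) ->
      srt_gen op B M S0 (S1 :|: S2) (op t m).

Definition srt op B M S0 : fam := fun S => lspan (srt_gen op B M S0 S).

(** Ordering the blocks divides the number of products by the factorial of the
    number of blocks: this is where an exponential enters the bounds. *)
Definition fexp op B M : fam := fun S =>
  lspan (fun z => exists S0 S1, [/\ S = S0 :|: S1, [disjoint S0 & S1] & srt op B M S0 S1 z]).

Lemma srt_sub op B M S0 : fsub (srt op B M S0).
Proof. by move=> S; apply: lspan_subspace. Qed.
Lemma fexp_sub op B M : fsub (fexp op B M).
Proof. by move=> S; apply: lspan_subspace. Qed.

Lemma srt_fexp op B M S0 S1 z : [disjoint S0 & S1] -> srt op B M S0 S1 z ->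
  fexp op B M (S0 :|: S1) z.
Proof. by move=> dS Hz; apply: lspan1; exists S0, S1. Qed.

Lemma fexp_base op B M : fle B (fexp op B M).
Proof.
move=> S x Bx; rewrite -(setU0 S); apply: srt_fexp; first by rewrite -setI_eq0 setI0.
exact/lspan1/srt0.
Qed.

(** ** Counting *)

Lemma sum_subsets S (f : nat -> nat) :
  (\sum_(A in powerset S) f #|A| = \sum_(k < #|S|.+1) 'C(#|S|, k) * f k)%N.
Proof.
rewrite (partition_big (fun A : {set 'I_n} => inord #|A| : 'I_#|S|.+1) xpredT) //=.
apply: eq_bigr => k _.
transitivity (\sum_(A : {set 'I_n} | (A \subset S) && (#|A| == k)) f k)%N.
  apply: eq_big => [A|A].
    rewrite powersetE; case AS: (A \subset S) => //=.
    have lt : (#|A| < #|S|.+1)%N by rewrite ltnS subset_leq_card.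
    by rewrite -val_eqE /= inordK.
  rewrite powersetE => /andP[AS /eqP <-]; rewrite inordK //.
  by rewrite ltnS subset_leq_card.
rewrite sum_nat_const; congr (_ * _)%N; rewrite -[RHS]cards_draws.
by apply: eq_card => A; rewrite inE.
Qed.

Section Bounded.
Variable R : realType.

(** The dimensions of the components of M are coefficients of an exponential
    generating function bounded by B. *)
Definition bounded (M : fam) (B : R -> R) := exists h : nat -> nat,
  (forall S, dimle (M S) (h #|S|)) /\
  (forall (rho : R) (m : nat), 0 <= rho -> egf m rho h <= B rho).

Lemma bounded_le M M' B B' : fle M M' -> (forall rho, 0 <= rho -> B rho <= B' rho) ->
  bounded M' B -> bounded M B'.
Proof.
move=> MM BB [h [hM hB]]; exists h; split=> [S|rho m r0].
  by apply: dimle_le (hM S) => //; apply: MM.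
by apply: le_trans (BB _ r0); apply: hB.
Qed.

Lemma bounded_add M M' B B' : bounded M B -> bounded M' B' ->
  bounded (fadd M M') (fun rho => B rho + B' rho).
Proof.
move=> [h [hM hB]] [h' [hM' hB']]; exists (fun k => h k + h' k)%N; split.
  move=> S; have [s [sz Ms]] := hM S; have [s' [sz' Ms']] := hM' S.
  apply: dimle_lspan; exists (s ++ s'); split; first by rewrite size_cat leq_add.
  by move=> x [/Ms|/Ms']; apply: lspan_mono => y /= ys; rewrite mem_cat ys ?orbT.
by move=> rho m r0; rewrite egf_add lerD ?hB ?hB'.
Qed.

Lemma size_flatten_le (T T' : Type) (s : seq T) (F : T -> seq T') (f : T -> nat) :
  (forall x, size (F x) <= f x)%N ->
  (size (flatten (map F s)) <= \sum_(x <- s) f x)%N.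
Proof.
move=> Ff; elim: s => [|x s IH] /=; first by rewrite big_nil.
by rewrite size_cat big_cons leq_add.
Qed.

Lemma bounded_op op M M' B B' : bilin op -> bounded M B -> bounded M' B' ->
  bounded (fop op M M') (fun rho => B rho * B' rho).
Proof.
move=> bo [h [hM hB]] [h' [hM' hB']]; exists (conv h h'); split; last first.
  move=> rho m r0; apply: le_trans (egf_conv _ _ _ r0) _.
  by apply: ler_pM; rewrite ?egf_ge0 ?hB ?hB'.
have /choice[s sP] := hM; have /choice[s' sP'] := hM'.
move=> S; apply: dimle_lspan.
exists (flatten [seq [seq op x y | x <- s A, y <- s' (S :\: A)] | A <- enum (powerset S)]).
split.
  apply: (@leq_trans (\sum_(A <- enum (powerset S)) h #|A| * h' #|S :\: A|)%N).
    apply: size_flatten_le => A; rewrite size_allpairs leq_mul //.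
      by case: (sP A).
    by case: (sP' (S :\: A)).
  rewrite big_enum /= /conv -(sum_subsets S (fun j => h j * h' (#|S| - j))%N).
  by apply: leq_sum => A; rewrite powersetE => AS; rewrite cardsD (setIidPr AS).
move=> _ [S1 [S2 [x [y [SE dS Mx My ->]]]]].
have S2E : S :\: S1 = S2.
  by rewrite SE setDUl setDv set0U; apply/setDidPl; rewrite disjoint_sym.
have {}Mx := (sP S1).2 _ Mx; have {}My := (sP' S2).2 _ My.
move: x y Mx My; apply: (lspan_op (P := lspan _) bo); first exact: lspan_subspace.
move=> x y /= xs ys; apply: lspan1 => /=; apply/flattenP.
exists [seq op x y | x <- s S1, y <- s' (S :\: S1)].
  by apply/mapP; exists S1 => //; rewrite mem_enum powersetE SE subsetUl.
by apply/allpairsP; exists (x, y); rewrite S2E.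
Qed.

(** The last block contains the greatest element i of S1; its other elements are
    arbitrary. *)
Lemma dimle_srt op B M (b h : nat -> nat) S0 S1 : bilin op ->
  (forall S, dimle (B S) (b #|S|)) -> (forall S, dimle (M S) (h #|S|)) ->
  dimle (srt op B M S0 S1) (b #|S0| * expn_ h #|S1|).
Proof.
move=> bo Bb /choice[s' sP']; have [d] := ubnP #|S1|; elim: d S1 => // d IHm S1; rewrite ltnS => leS.
have {IHm}IH (A : {set 'I_n}) : (#|A| < #|S1|)%N -> dimle (srt op B M S0 A) (b #|S0| * expn_ h #|A|).
  by move=> ltA; apply: IHm; apply: leq_trans leS.
have [->|S1n0] := eqVneq S1 set0.
  rewrite cards0 muln1; apply: dimle_lspan; apply: dimle_le (Bb S0) => // x.
  move E: set0 => T H; case: H E => // S2 S3 t m' i _ _ _ iS _ E.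
  by have := in_set0 i; rewrite E inE iS orbT.
have [i0 i0S] := set0Pn _ S1n0.
pose i := [arg max_(j > i0 in S1) (j : nat)].
have [iS imax] : i \in S1 /\ forall j, j \in S1 -> (j <= i)%N.
  by rewrite /i; case: arg_maxnP.
have IHx (A : {set 'I_n}) : exists s, A \subset S1 :\ i ->
    (size s <= b #|S0| * expn_ h #|S1 :\ i :\: A|)%N /\
    srt op B M S0 (S1 :\ i :\: A) ⊆ lspan (fun x => x \in s).
  case AS : (A \subset S1 :\ i); last by exists [::].
  have /IH[s Hs] : (#|S1 :\ i :\: A| < #|S1|)%N.
    apply: proper_card; apply/properP; split.
      by apply: subset_trans (subsetDl _ _) (subsetDl _ _).
    by exists i => //; rewrite !inE eqxx andbF.
  by exists s.
have /choice[s sP] := IHx.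
apply: dimle_lspan.
exists (flatten [seq [seq op x y | x <- s A, y <- s' (i |: A)]
  | A <- enum (powerset (S1 :\ i))]); split.
  rewrite size_flatten /shape -map_comp sumnE big_map big_enum /=.
  have -> : #|S1| = #|S1 :\ i|.+1 by rewrite (cardsD1 i S1) iS.
  rewrite expn_S big_distrr /=.
  rewrite (eq_bigr (fun k : 'I_ #|S1 :\ i|.+1 => 'C(#|S1 :\ i|, k) *
     (b #|S0| * (h k.+1 * expn_ h (#|S1 :\ i| - k))))%N); last by move=> k _; rewrite mulnCA.
  rewrite -(sum_subsets (S1 :\ i) (fun k => b #|S0| * (h k.+1 * expn_ h (#|S1 :\ i| - k)))%N).
  apply: leq_sum => A; rewrite powersetE => AS; rewrite size_allpairs.
  have [sz _] := sP _ AS; have [sz' _] := sP' (i |: A).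
  rewrite [leqRHS]mulnCA [leqRHS]mulnC; apply: leq_mul.
    by rewrite cardsD (setIidPr AS) in sz.
  have iA : i \notin A by apply/negP => /(subsetP AS); rewrite !inE eqxx.
  by rewrite cardsU1 iA in sz'.
move=> x; move E: S1 => T H; case: H E => [b' _ S10|]; first by rewrite S10 eqxx in S1n0.
move=> S2 S3 t m i' Ht Mm dS i'S3 i'max S1E.
have iE : i' = i.
  apply/val_inj/eqP; rewrite eqn_leq.
  have -> : (i' <= i)%N by apply: imax; rewrite S1E inE i'S3 orbT.
  by apply: i'max; rewrite -S1E.
rewrite iE in i'S3.
have dS23 : [disjoint S2 & S3] by move: dS; rewrite disjUl => /andP[].
have iS2 : i \notin S2 by apply/negP => iS2; move: (disjointFr dS23 iS2); rewrite i'S3.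
pose A := S3 :\ i.
have AS : A \subset S1 :\ i by rewrite S1E setSD // subsetUr.
have AE : i |: A = S3 by rewrite setD1K.
have S2E : S1 :\ i :\: A = S2.
  apply/setP => j; rewrite /A S1E !inE; case: (eqVneq j i) => [->|ji] /=.
    by rewrite (negbTE iS2).
  case jS3: (j \in S3) => /=; last by rewrite orbF.
  by apply/esym/negbTE/negP => /(disjointFr dS23); rewrite jS3.
have [_ Hs] := sP _ AS; rewrite S2E in Hs.
have {}Ht := Hs _ (lspan1 Ht).
have [_ /(_ _ Mm) {}Mm] := sP' S3.
move: t m Ht Mm; apply: (lspan_op (P := lspan _) bo); first exact: lspan_subspace.
move=> t m /= ts ms; apply: lspan1 => /=; apply/flattenP.
exists [seq op x y | x <- s A, y <- s' (i |: A)].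
  by apply/mapP; exists A => //; rewrite mem_enum powersetE -S1E.
by apply/allpairsP; exists (t, m); rewrite AE.
Qed.

Lemma bounded_exp op B M bB bM : bilin op -> bounded B bB -> bounded M bM ->
  bounded (fexp op B M) (fun rho => bB rho * expR (bM rho)).
Proof.
move=> bo [b [hb bE]] [h [hh hE]]; exists (conv b (expn_ h)); split; last first.
  move=> rho m r0; apply: le_trans (egf_conv _ _ _ r0) _.
  apply: ler_pM; rewrite ?egf_ge0 ?bE //.
  by apply: le_trans (egf_exp _ _ r0) _; rewrite ler_expR hE.
move=> S; apply: dimle_lspan.
have /choice[s sP] : forall A : {set 'I_n}, exists s, (size s <= b #|A| * expn_ h #|S :\: A|)%N /\
    srt op B M A (S :\: A) ⊆ lspan (fun x => x \in s).
  by move=> A; apply: dimle_srt.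
exists (flatten [seq s A | A <- enum (powerset S)]); split.
  rewrite size_flatten /shape -map_comp sumnE big_map big_enum /=.
  rewrite /conv -(sum_subsets S (fun j => b j * expn_ h (#|S| - j))%N).
  apply: leq_sum => A; rewrite powersetE => AS.
  by have [sz _] := sP A; rewrite cardsD (setIidPr AS) in sz.
move=> x [S0 [S1 [SE dS Hx]]].
have S1E : S :\: S0 = S1.
  by rewrite SE setDUl setDv set0U; apply/setDidPl; rewrite disjoint_sym.
have [_ /(_ x)] := sP S0; rewrite S1E => /(_ Hx).
apply: lspan_mono => y ys /=; apply/flattenP; exists (s S0) => //.
by apply/mapP; exists S0 => //; rewrite mem_enum powersetE SE subsetUl.
Qed.

End Bounded.
End Families.

Arguments fle_refl {K V n M}.
Arguments fle_trans {K V n N M P} _ _.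
Arguments fop_mono {K V n op M M' N N'} _ _.
Arguments faddl {K V n} M N.
Arguments faddr {K V n} M N.

(** * Upper bounds for polynilpotent Lie algebras *)

Ltac set_eq := apply/setP => ?; rewrite !inE; repeat case: (_ \in _) => //=.

Section LieFamilies.
Variables (K : fieldType) (L : lieAlgType K) (n : nat).
Local Notation fam := (fam L n).
Local Notation br := (@lieb K L).
Local Notation fbr := (fop br).
Implicit Types (A B C J M G : fam) (S : {set 'I_n}).

Lemma bilin_lieb : bilin br.
Proof. by split=> *; rewrite ?lieb_linearl ?lieb_linearr. Qed.
Local Notation bb := bilin_lieb.
#[local] Hint Resolve bilin_lieb : core.

Lemma lieNl (x y : L) : {[- x, y]} = - {[x, y]}.
Proof. by rewrite -scaleN1r lieZl scaleN1r. Qed.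

Lemma lieJ (x y z : L) : {[x, {[y, z]}]} = {[{[x, y]}, z]} - {[{[x, z]}, y]}.
Proof.
have := jacobi x y z; rewrite [{[y, {[z, x]}]}]lieC [{[z, {[x, y]}]}]lieC.
rewrite [{[z, x]}]lieC lieNl opprK => /eqP.
by rewrite -addrA addr_eq0 opprD opprK addrC => /eqP.
Qed.

Lemma lieJl (x y z : L) : {[{[x, y]}, z]} = {[{[x, z]}, y]} + {[x, {[y, z]}]}.
Proof. by rewrite lieJ addrC subrK. Qed.

Lemma fbrC A B : fle (fbr A B) (fbr B A).
Proof.
apply: fop_min => [|S1 S2 x y dS Ax By]; first exact: fop_sub.
rewrite setUC lieC; apply: subspaceN; first exact: fop_sub.
by apply: fop1; rewrite 1?disjoint_sym.
Qed.

Arguments fbrC {A B}.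

Lemma fbr_jacobi A B C P : fsub P -> fle (fbr (fbr A B) C) P ->
  fle (fbr (fbr A C) B) P -> fle (fbr A (fbr B C)) P.
Proof.
move=> sP PB PC; apply: fop_min => // S1 S2 a y dS Aa.
apply: (lspan_min (P := (fun y => P (S1 :|: S2) {[a, y]}))).
  exact: (subspace_opr _ bb (sP _)).
move=> {y} _ [T1 [T2 [b [c [S2E dT Bb Cc ->]]]]]; subst S2.
move: dS; rewrite disjUr => /andP[d1 d2].
rewrite lieJ; apply: subspaceB => //.
  rewrite setUA; apply: PB; apply: fop1 => //; last exact: fop1.
  by rewrite disjUl d2.
have -> : S1 :|: (T1 :|: T2) = S1 :|: T2 :|: T1 by set_eq.
apply: PC; apply: fop1 => //; last exact: fop1.
by rewrite disjUl d1 disjoint_sym.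
Qed.

Fixpoint lcsf J k : fam := if k is k'.+1 then fbr (lcsf J k') J else J.

Lemma lcsf_sub J k : fsub J -> fsub (lcsf J k).
Proof. by case: k => //= k _; apply: fop_sub. Qed.

Lemma lcsf_add J k l : fsub J -> fle (fbr (lcsf J k) (lcsf J l)) (lcsf J (k + l).+1).
Proof.
move=> sJ; elim: l k => [|l IH] k /=; first by rewrite addn0.
apply: fbr_jacobi; first exact: fop_sub.
  by apply: fop_mono => //; rewrite addnS; apply: IH.
by rewrite addnS -addSn; apply: (IH k.+1).
Qed.
Arguments lcsf_add {J} k l _.


(** A family of components of a multigraded Lie subalgebra. *)
Record subalg J : Prop := Subalg {
  salg_sub : fsub J; salg_br : fle (fbr J J) J; salg_pos : fpos J }.

Lemma lcsf_le J k : subalg J -> fle (lcsf J k) J.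
Proof.
move=> [sJ bJ pJ]; elim: k => //= k IH.
by apply: fle_trans bJ; apply: fop_mono.
Qed.
Arguments lcsf_le {J k} _.


Lemma lcsf_anti J k : subalg J -> fle (lcsf J k.+1) (lcsf J k).
Proof.
move=> aJ; elim: k => [|k IH] /=; first exact: salg_br.
by apply: fop_mono.
Qed.
Arguments lcsf_anti {J k} _.


Lemma lcsf_subalg J k : subalg J -> subalg (lcsf J k).
Proof.
move=> aJ; split; first by apply/lcsf_sub/salg_sub.
  apply: fle_trans (lcsf_anti aJ); apply: fop_mono => //; exact: lcsf_le.
by move=> x /(lcsf_le aJ); apply: salg_pos.
Qed.

(** The term gam = gamma_(s+1)(J) is generated, as a Lie algebra, by the brackets
    [..[b0, m1], ..., mt] with b0 in a generating set B0 modulo [gam, J] and with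
    m1, ..., mt in M, where J = M + gam. Modulo [gam, gam] the m's can be sorted,
    because the bracket of two of them lies in J. *)
Section Generators.
Variables (J M B0 : fam) (s : nat).
Hypothesis aJ : subalg J.
Local Notation gam := (lcsf J s).
Local Notation gg := (fbr gam gam).
Hypotheses (JM : fle J (fadd M gam)) (MJ : fle M J).
Hypotheses (Bg : fle B0 gam) (gB : fle gam (fadd B0 (fbr gam J))).

Let sgg : fsub gg. Proof. exact: fop_sub. Qed.
Let gJ : fle (fbr gam J) gam. Proof. exact: lcsf_anti. Qed.

Let ggJ : fle (fbr gg J) gg.
Proof.
apply: fle_trans fbrC _; apply: fbr_jacobi => //.
  apply: fop_mono => //; exact: fle_trans fbrC gJ.
apply: fop_mono => //; exact: fle_trans fbrC gJ.
Qed.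

Lemma srt_gen_gam S0 S1 t : srt_gen br B0 M S0 S1 t -> gam (S0 :|: S1) t.
Proof.
elim=> [b /Bg|S2 S3 t' m i _ IH Mm dS iS3 imax]; first by rewrite setU0.
by rewrite setUA; apply: gJ; apply: fop1 => //; apply: MJ.
Qed.

Let target S0 S z := lspan (fun z => srt br B0 M S0 S z \/ gg (S0 :|: S) z) z.

Let target_sub S0 S : subspace (target S0 S).
Proof. exact: lspan_subspace. Qed.

(** Insertion sort: the bracket [m', m] of two blocks lies in J, hence is a
    combination of blocks (fewer letters remain to be sorted) and of elements of
    gam, which contribute to [gam, gam]. *)
Lemma srt_insert S0 S1 S2 t m : [disjoint S0 :|: S1 & S2] ->
  srt br B0 M S0 S1 t -> M S2 m -> target S0 (S1 :|: S2) {[t, m]}.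
Proof.
have [d] := ubnP #|S1|; elim: d S1 S2 t m => // d IH S1 S2 t m; rewrite ltnS => leS dS Tt Mm.
move: t Tt; apply: (lspan_min (P := fun t => target S0 (S1 :|: S2) {[t, m]})).
  exact: (subspace_opl _ bb (target_sub _ _)).
move=> t Ht.
have [S20|[i0 i0S]] := set_0Vmem S2.
  by rewrite S20 in Mm *; rewrite (salg_pos aJ (MJ Mm)) (bilin0r _ bb); apply: lspan0.
pose i2 := [arg max_(j > i0 in S2) (j : nat)].
have [i2S i2max] : i2 \in S2 /\ forall j, j \in S2 -> (j <= i2)%N.
  by rewrite /i2; case: arg_maxnP.
case: (boolP [forall j in S1, (j <= i2)%N]) => [/forall_inP le2|].
  apply/lspan1; left; apply/lspan1/(srtS (i := i2)) => // j.
  by rewrite inE => /orP[/le2|/i2max].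
rewrite negb_forall_in => /exists_inP[j jS1]; rewrite -ltnNge => lt2.
move: jS1 dS leS; case: Ht => [b _|R S3 t' m' i3 Ht' Mm' dR i3S i3max]; first by rewrite in_set0.
move=> jR dS leS.
have lt3 : (i2 < i3)%N by apply: leq_trans lt2 _; apply: i3max.
have iR : i3 \notin R.
  by apply/negP => iR; move: dR; rewrite disjUl => /andP[_ /disjointFr /(_ iR)]; rewrite i3S.
have ltR : (#|R| < d)%N.
  apply: leq_trans leS; apply: proper_card; apply/properP; split; first exact: subsetUl.
  by exists i3; rewrite ?inE ?i3S ?orbT.
move: dS dR; rewrite !(disjUl, disjUr) => /andP[d02 /andP[dR2 d32]] /andP[d03 dR3].
have Tt' : srt br B0 M S0 R t' by apply: lspan1.
rewrite lieJl; apply: subspaceD => //.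
  have -> : R :|: S3 :|: S2 = R :|: S2 :|: S3 by set_eq.
  have : target S0 (R :|: S2) {[t', m]} by apply: IH; rewrite // disjUl d02.
  apply: (lspan_min (P := fun z => target S0 (R :|: S2 :|: S3) {[z, m']})).
    exact: (subspace_opl _ bb (target_sub _ _)).
  move=> z [Hz|Hz].
    apply/lspan1; left; move: z Hz.
    apply: (lspan_min (P := fun z => srt br B0 M S0 (R :|: S2 :|: S3) {[z, m']})).
      exact: (subspace_opl _ bb (srt_sub _ _ _ _ _)).
    move=> z Hz; apply/lspan1/(srtS (i := i3)) => //.
      by rewrite !disjUl d03 dR3 disjoint_sym.
    move=> l; rewrite !inE => /orP[/orP[lR|lS]|lS].
    - by apply: i3max; rewrite inE lR.
    - by apply: leq_trans (i2max _ lS) (ltnW _).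
    by apply: i3max; rewrite inE lS orbT.
  apply/lspan1; right; rewrite setUA; apply: ggJ; apply: fop1 => //; last exact: MJ.
  by rewrite !disjUl d03 dR3 disjoint_sym.
have : fadd M gam (S3 :|: S2) {[m', m]}.
  by apply/JM/(salg_br aJ); apply: fop1; rewrite //; apply: MJ.
rewrite -setUA; apply: (lspan_min (P := fun z => target S0 (R :|: (S3 :|: S2)) {[t', z]})).
  exact: (subspace_opr _ bb (target_sub _ _)).
move=> z [Mz|gz].
  by apply: IH => //; rewrite !(disjUl, disjUr) d03 d02 dR3.
apply/lspan1; right; rewrite setUA; apply: fop1 => //.
  by rewrite !(disjUl, disjUr) d03 d02 dR3.
exact: srt_gen_gam.
Qed.

Lemma fexp_gam : fle (fexp br B0 M) gam.
Proof.
move=> S; apply: lspan_min; first by apply: lcsf_sub; apply: salg_sub.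
move=> z [S0 [S1 [-> dS]]]; apply: lspan_min; first by apply: lcsf_sub; apply: salg_sub.
by move=> {}z; apply: srt_gen_gam.
Qed.

Lemma gam_gens : fle gam (fadd (fexp br B0 M) gg).
Proof.
move=> S; have [d] := ubnP #|S|; elim: d S => // d IH S; rewrite ltnS => leS.
have sQ : fsub (fadd (fexp br B0 M) gg) by apply: fadd_sub.
move=> x /gB; apply: lspan_min => {x}//.
move=> x [Bx|]; first by apply/faddl/fexp_base.
apply: lspan_min => {x}// _ [S1 [S2 [g [j [SE dS gg1 Jj ->]]]]]; subst S.
have [S20|[i0 i0S]] := set_0Vmem S2.
  by rewrite S20 in Jj *; rewrite (salg_pos aJ Jj) (bilin0r _ bb); apply: lspan0.
have lt1 : (#|S1| < d)%N.
  apply: leq_trans leS; apply: proper_card; apply/properP; split; first exact: subsetUl.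
  by exists i0; rewrite ?inE ?i0S ?orbT // (disjointFl dS).
have := IH _ lt1 _ gg1.
apply: (lspan_min (P := fun g => fadd (fexp br B0 M) gg (S1 :|: S2) {[g, j]})).
  exact: (subspace_opl _ bb (sQ _)).
move=> {gg1}g [Eg|ggg]; last by apply: faddr; apply: ggJ; apply: fop1.
have : fadd M gam S2 j by apply: JM.
apply: (lspan_min (P := fun j => fadd (fexp br B0 M) gg (S1 :|: S2) {[g, j]})).
  exact: (subspace_opr _ bb (sQ _)).
move=> {Jj}j [Mj|gj]; last by apply: faddr; apply: fop1 => //; apply: fexp_gam.
move: g Eg; apply: (lspan_min (P := fun g => fadd (fexp br B0 M) gg (S1 :|: S2) {[g, j]})).
  exact: (subspace_opl _ bb (sQ _)).
move=> g [T0 [T1 [S1E dT Hg]]]; subst S1.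
have := srt_insert dS Hg Mj; rewrite -setUA; apply: lspan_min => // z [Hz|ggz].
  apply/faddl/srt_fexp => //.
  by move: dS; rewrite !(disjUl, disjUr) dT => /andP[].
exact: faddr.
Qed.
End Generators.
Arguments fexp_gam {J M B0 s} _ _ _.
Arguments gam_gens {J M B0 s} _ _ _ _ _.

(** Left-normed powers of the generators G span J modulo gamma_(s+1)(J). *)
Fixpoint fpow G k : fam := if k is k'.+1 then fbr (fpow G k') G else G.
Fixpoint fpsum G s : fam := if s is s'.+1 then fadd (fpsum G s') (fpow G s') else
  fun _ z => z = 0.

Lemma fpow_lcsf J G k : fle G J -> fle (fpow G k) (lcsf J k).
Proof. by move=> GJ; elim: k => //= k IH; apply: fop_mono. Qed.
Arguments fpow_lcsf {J G k} _.


Lemma lcsf_fpow J G k : subalg J -> fle G J -> fle J (fadd G (fbr J J)) ->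
  fle (lcsf J k) (fadd (fpow G k) (lcsf J k.+1)).
Proof.
move=> aJ GJ JG; elim: k => [//|k IH].
have sQ : fsub (fadd (fpow G k.+1) (lcsf J k.+2)) by apply: fadd_sub.
apply: fle_trans (fop_mono IH fle_refl) _.
apply: fop_addl => //; last exact: faddr.
apply: fle_trans (fop_mono fle_refl JG) _.
apply: fop_addr => //; first exact: faddl.
apply: fle_trans (faddr _ _).
apply: fle_trans (fop_mono (fpow_lcsf (k := k) GJ) (fle_refl (M := lcsf J 1))) _.
by have := lcsf_add k 1 (salg_sub aJ); rewrite addn1.
Qed.
Arguments lcsf_fpow {J G k} _ _ _.


Lemma fpsum_lcsf J G s : subalg J -> fle G J -> fle J (fadd G (fbr J J)) ->
  fle J (fadd (fpsum G s) (lcsf J s)).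
Proof.
move=> aJ GJ JG; elim: s => [|s IH] /=; first exact: faddr.
apply: fle_trans IH _; have sQ : fsub (fadd (fpsum G s.+1) (lcsf J s.+1)) by apply: fadd_sub.
apply: fadd_min => //.
  by apply: fle_trans (faddl _ _) => /=; apply: faddl.
apply: fle_trans (lcsf_fpow (k := s) aJ GJ JG) _; apply: fadd_min => //.
  by apply: fle_trans (faddl _ _) => /=; apply: faddr.
exact: faddr.
Qed.
Arguments fpsum_lcsf {J G s} _ _ _.


Lemma fpsum_le J G s : subalg J -> fle G J -> fle (fpsum G s) J.
Proof.
move=> aJ GJ; have sJ := salg_sub aJ; elim: s => [|s IH] /=.
  by move=> S x ->; have [] := sJ S.
apply: fadd_min => //; exact: fle_trans (fpow_lcsf GJ) (lcsf_le aJ).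
Qed.
Arguments fpsum_le {J G s} _ _.


Section LieBounds.
Variable R : realType.

Lemma bounded_fpow G (g : R -> R) k : bounded G g -> bounded (fpow G k) (fun r => g r ^+ k.+1).
Proof.
move=> bG; elim: k => [|k IH] /=.
  by apply: bounded_le bG => // rho _; rewrite expr1.
apply: bounded_le (bounded_op bb IH bG) => // rho _.
by rewrite -exprSr.
Qed.

Lemma bounded_fpsum G (g : R -> R) s : bounded G g ->
  bounded (fpsum G s) (fun r => \sum_(k < s) g r ^+ k.+1).
Proof.
move=> bG; elim: s => [|s IH] /=.
  exists (fun=> 0%N); split; first by move=> S; apply: dimle0.
  by move=> rho m r0; rewrite /egf big1 ?big_ord0 // => k _; rewrite !mul0r.
apply: bounded_le (bounded_add IH (bounded_fpow s bG)) => // rho _.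
by rewrite big_ord_recr.
Qed.

(** gamma_(s_r + 1)(... gamma_(s_1 + 1)(J)) for l = [:: s_1; ...; s_r]. *)
Fixpoint lcsit J (l : seq nat) : fam := if l is s :: l' then lcsit (lcsf J s) l' else J.

(** If J is generated by a family with generating function g, then J modulo
    gamma_(s+1)(J) is bounded by mu, and gamma_(s+1)(J) is generated by a family
    with generating function g^(s+1) exp(mu). *)
Fixpoint poly_bound (l : seq nat) (g : R) : R :=
  if l is s :: l' then
    let mu := \sum_(k < s) g ^+ k.+1 in
    mu + poly_bound l' (g ^+ s.+1 * expR mu)
  else 0.

Lemma bounded_lcsit l J G (g : R -> R) : subalg J -> fle G J ->
  fle J (fadd G (fbr J J)) -> bounded G g ->
  (forall S x, lcsit J l S x -> x = 0) ->
  bounded J (fun rho => poly_bound l (g rho)).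
Proof.
elim: l J G g => [|s l IH] J G g aJ GJ JG bG J0 /=.
  exists (fun=> 0%N); split; first by move=> S; apply: dimle0 => x /J0.
  by move=> rho m r0; rewrite /egf big1 // => k _; rewrite !mul0r.
have JM := fpsum_lcsf (s := s) aJ GJ JG; have MJ := fpsum_le (s := s) aJ GJ.
have Bg := fpow_lcsf (k := s) GJ; have gB := lcsf_fpow (k := s) aJ GJ JG.
have bM := bounded_fpsum s bG.
pose mu rho := \sum_(k < s) g rho ^+ k.+1.
have bE : bounded (fexp br (fpow G s) (fpsum G s)) (fun rho => g rho ^+ s.+1 * expR (mu rho)).
  by apply: bounded_exp => //; apply: bounded_fpow.
have b1 := IH _ _ _ (lcsf_subalg s aJ) (fexp_gam aJ MJ Bg) (gam_gens aJ JM MJ Bg gB) bE J0.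
exact: (bounded_le JM _ (bounded_add bM b1)).
Qed.

End LieBounds.
End LieFamilies.

Arguments fbrC {K L n A B}.
Arguments lcsf_add {K L n J} k l _.
Arguments lcsf_le {K L n J k} _.
Arguments lcsf_anti {K L n J k} _.
Arguments fpow_lcsf {K L n J G k} _.
Arguments lcsf_fpow {K L n J G k} _ _ _.
Arguments fpsum_lcsf {K L n J G s} _ _ _.
Arguments fpsum_le {K L n J G s} _ _.
Arguments fexp_gam {K L n J M B0 s} _ _ _.
Arguments gam_gens {K L n J M B0 s} _ _ _ _ _.

(** * Upper bounds for products of commutators *)

Section Multilinear.
Variables (K : fieldType) (L : lieAlgType K) (n : nat) (x : 'I_n -> L).
Local Notation fam := (fam L n).
Local Notation br := (@lieb K L).
Local Notation fbr := (fop br).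
Local Notation bb := (@bilin_lieb K L).
Implicit Types (S : {set 'I_n}).
#[local] Hint Resolve bilin_lieb : core.

(** Multilinear commutators, with the set of their variables. *)
Inductive lgen : {set 'I_n} -> L -> Prop :=
  | lgen_var i : lgen [set i] (x i)
  | lgen_br S1 S2 a b : lgen S1 a -> lgen S2 b -> [disjoint S1 & S2] ->
      lgen (S1 :|: S2) {[a, b]}.

Definition flie : fam := fun S => lspan (lgen S).
Definition fvar : fam := fun S => lspan (fun z => exists i, S = [set i] /\ z = x i).

Lemma lgen_set0 S z : lgen S z -> S != set0.
Proof.
elim=> [i|S1 S2 a b _ IH _ _ _]; first by apply/set0Pn; exists i; rewrite inE.
by rewrite setU_eq0 (negbTE IH).
Qed.

Lemma flie_subalg : subalg flie.
Proof.
split; first by move=> S; apply: lspan_subspace.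
  apply: fop_min => [S|S1 S2 a b dS]; first exact: lspan_subspace.
  apply: (lspan_op (P := flie _)) => //; first exact: lspan_subspace.
  by move=> {}a {}b Ha Hb; apply/lspan1/lgen_br.
move=> z; apply: (lspan_min (P := fun z => z = 0)).
  by split=> // a u v -> ->; rewrite scaler0 addr0.
by move=> {}z /lgen_set0; rewrite eqxx.
Qed.

Lemma fvar_flie : fle fvar flie.
Proof.
move=> S; apply: lspan_min; first exact: lspan_subspace.
by move=> _ [i [-> ->]]; apply/lspan1/lgen_var.
Qed.

Lemma flie_gens : fle flie (fadd fvar (fbr flie flie)).
Proof.
move=> S; apply: lspan_min; first exact: lspan_subspace.
move=> z; case=> [i|S1 S2 a b Ha Hb dS].
  by apply/faddl/lspan1; exists i.
by apply/faddr/fop1 => //; apply: lspan1.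
Qed.

(** ** Commutators starting with a given variable

    They span the component on S, whose dimension is thus at most (|S| - 1)!. At
    the first level this is sharper than counting all left-normed commutators,
    and it is responsible for the factor 1/s_1 in the result. *)

Inductive left_normed (i : 'I_n) : {set 'I_n} -> L -> Prop :=
  | ln_var : left_normed i [set i] (x i)
  | ln_br S a j : left_normed i S a -> j \notin S -> left_normed i (j |: S) {[a, x j]}.

Lemma left_normed_mem i S a : left_normed i S a -> i \in S.
Proof. by elim=> [|S' a' j _ IH _]; rewrite !inE ?eqxx ?IH ?orbT. Qed.

Lemma left_normed_br i S1 S2 a b : lspan (left_normed i S1) a -> lgen S2 b ->
  [disjoint S1 & S2] -> lspan (left_normed i (S1 :|: S2)) {[a, b]}.
Proof.
move=> Ha Hb; elim: Hb S1 a Ha => [j|T1 T2 b1 b2 _ IH1 _ IH2 dT] S1 a Ha dS.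
  move: a Ha; apply: (lspan_min (P := fun a => lspan _ {[a, x j]})).
    exact: (subspace_opl _ bb (lspan_subspace _)).
  move=> a Ha; apply: lspan1; rewrite setUC; apply: ln_br => //.
  by rewrite disjoint_sym disjoints1 in dS.
move: dS; rewrite disjUr => /andP[d1 d2].
rewrite lieJ; apply: subspaceB; first exact: lspan_subspace.
  rewrite setUA; apply: IH2; first exact: IH1.
  by rewrite disjUl d2.
have -> : S1 :|: (T1 :|: T2) = S1 :|: T2 :|: T1 by set_eq.
apply: IH1; first exact: IH2.
by rewrite disjUl d1 disjoint_sym.
Qed.

Lemma lgen_left_normed i S z : lgen S z -> i \in S -> lspan (left_normed i S) z.
Proof.
elim=> [j|S1 S2 a b Ha IHa Hb IHb dS]; first by rewrite inE => /eqP ->; apply/lspan1/ln_var.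
rewrite inE => /orP[/IHa{}IHa|/IHb{}IHb]; first exact: left_normed_br.
rewrite lieC setUC; apply: subspaceN; first exact: lspan_subspace.
by apply: left_normed_br => //; rewrite disjoint_sym.
Qed.

Lemma dimle_left_normed i S : dimle (left_normed i S) (#|S|.-1)`!.
Proof.
have [d] := ubnP #|S|; elim: d S => // d IH S; rewrite ltnS => leS.
case iS: (i \in S); last first.
  by exists [::]; split=> // z /left_normed_mem; rewrite iS.
have H j : exists s, (j \in S :\ i) -> (size s <= (#|S|.-2)`!)%N /\
    (forall z, left_normed i (S :\ j) z -> lspan (fun z => z \in s) z).
  case jS: (j \in S :\ i); last by exists [::].
  move: jS; rewrite !inE => /andP[ji jS].
  have cS : #|S| = #|S :\ j|.+1 by rewrite (cardsD1 j S) jS.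
  have /IH[s Hs] : (#|S :\ j| < d)%N by rewrite -cS.
  by exists s => _; rewrite cS.
have /choice[s sP] := H.
have cS : #|S| = #|S :\ i|.+1 by rewrite (cardsD1 i S) iS.
exists (if S == [set i] then [:: x i] else
  flatten [seq [seq {[a, x j]} | a <- s j] | j <- enum (S :\ i)]); split.
  case: ifPn => [/eqP->|S1]; first by rewrite cards1.
  rewrite size_flatten /shape -map_comp sumnE big_map big_enum /=.
  apply: (@leq_trans (\sum_(j in S :\ i) (#|S|.-2)`!)).
    by apply: leq_sum => j /sP[sz _]; rewrite size_map.
  rewrite sum_nat_const cS /=.
  have : (0 < #|S :\ i|)%N.
    rewrite card_gt0; apply: contra S1 => /eqP S0.
    by rewrite -(setD1K iS) S0 setU0.
  by case: #|S :\ i| => // m _; rewrite factS.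
move=> z; move E: S => T Hz; case: Hz E => [SE|S' a j Ha jS' SE].
  by rewrite ?SE eqxx; apply: lspan1; rewrite inE.
subst S; rewrite ifN; last first.
  have iS' := left_normed_mem Ha; apply/negP => /eqP S1.
  have : j \in j |: S' by rewrite !inE eqxx.
  by rewrite S1 inE => /eqP ji; rewrite ji iS' in jS'.
have jS : j \in (j |: S') :\ i.
  rewrite !inE eqxx andbT; apply/eqP => ji; subst j.
  by rewrite (left_normed_mem Ha) in jS'.
have [_ Hs] := sP _ jS; have := Hs a; rewrite setU1K // => /(_ Ha).
apply: (lspan_min (P := fun a => lspan _ {[a, x j]})).
  exact: (subspace_opl _ bb (lspan_subspace _)).
move=> {Ha}a Ha; apply: lspan1 => /=; apply/flattenP.
exists [seq {[a, x j]} | a <- s j]; first by apply/mapP; exists j; rewrite ?mem_enum.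
exact: map_f.
Qed.

Lemma dimle_flie S : dimle (flie S) (if S == set0 then 0 else (#|S|.-1)`!).
Proof.
case: eqVneq => [->|/set0Pn[i iS]].
  by apply: dimle0; have [_ _] := flie_subalg.
apply: dimle_lspan; have [s [sz Hs]] := dimle_lspan (dimle_left_normed i S).
by exists s; split=> // z /lgen_left_normed/(_ iS)/Hs.
Qed.

(** ** The first level *)

(** A complement of gamma_(s+1), as the Lie algebra is graded by degree. *)
Definition flie_le s : fam := fun S z => flie S z /\ ((#|S| <= s)%N \/ z = 0).

Lemma fpow_fvar_card k S z : fpow fvar k S z -> #|S| <> k.+1 -> z = 0.
Proof.
have sub0 : subspace (fun z : L => z = 0).
  by split=> // a u v -> ->; rewrite scaler0 addr0.
elim: k S z => [|k IH] S z Hz cS; move: z Hz; apply: lspan_min => // z.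
  by move=> [i [SE _]]; case: cS; rewrite SE cards1.
move=> [S1 [S2 [a [b [SE dS Ha Hb ->]]]]].
move: b Hb; apply: (lspan_min (P := fun b => {[a, b]} = 0)).
  exact: (subspace_opr _ bb sub0).
move=> _ [i [S2E ->]]; rewrite (IH _ _ Ha) ?lieb0l // => cS1; apply: cS.
by rewrite SE cardsU disjoint_setI0 // cards0 subn0 cS1 S2E cards1 addn1.
Qed.

Lemma fpsum_fvar_card s S z : fpsum fvar s S z -> (s < #|S|)%N -> z = 0.
Proof.
have sub0 : subspace (fun z : L => z = 0).
  by split=> // a u v -> ->; rewrite scaler0 addr0.
elim: s z => [//|s IH] z Hz cS; move: z Hz; apply: lspan_min => // z [Hz|Hz].
  by apply: IH => //; apply: ltnW.
by apply: fpow_fvar_card Hz _ => E; rewrite E ltnn in cS.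
Qed.

Lemma flie_le_gens s : fle flie (fadd (flie_le s) (lcsf flie s)).
Proof.
move=> S z Hz; have [cS|cS] := leqP #|S| s.
  by apply: faddl; split=> //; left.
have := fpsum_lcsf (s := s) flie_subalg fvar_flie flie_gens _ _ Hz.
apply: lspan_min; first exact: lspan_subspace.
move=> {Hz}z [/fpsum_fvar_card->//|Hz]; last exact: faddr.
exact: lspan0.
Qed.

Section Bounds.
Variable R : realType.
Implicit Types rho : R.

Lemma bounded_card1 (F : fam) : (forall S, #|S| != 1%N -> F S `<=` [set 0])%classic ->
  (forall S, dimle (F S) 1) -> bounded F (fun rho => rho).
Proof.
move=> F0 F1; exists (fun k => (k == 1)%N : nat); split.
  move=> S; case: eqVneq => [//|/F0 H]; exact: dimle0.
move=> rho m r0; rewrite /egf.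
case: m => [|m]; first by rewrite big_ord_recl big_ord0 /= !mul0r addr0.
rewrite big_ord_recl big_ord_recl big1 /=.
  by rewrite !mul0r expr1 divr1 mul1r add0r addr0.
by move=> i _; rewrite /bump /= !mul0r.
Qed.

Lemma bounded_fvar : bounded fvar (fun rho => rho).
Proof.
apply: bounded_card1 => S.
  by move=> /eqP cS z Hz; exact: (fpow_fvar_card (k := 0) Hz cS).
apply: dimle_lspan; case: (boolP [exists i, S == [set i]]) => [/existsP[i /eqP ->]|].
  by exists [:: x i]; split=> // z [j [/set1_inj <- ->]]; apply: lspan1; rewrite inE.
rewrite negb_exists => /forallP H; exists [::]; split=> // z [i [SE _]].
by move: (H i); rewrite SE eqxx.
Qed.

Lemma bounded_flie_le s : bounded (flie_le s) (fun rho => \sum_(k < s) rho ^+ k.+1 / k.+1%:R).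
Proof.
exists (fun k => if (0 < k <= s)%N then (k.-1)`! else 0%N); split.
  move=> S; case: ifP => cS.
    have := dimle_flie S; rewrite ifN; last by rewrite -card_gt0; case/andP: cS.
    by apply: dimle_le => // z [].
  apply: dimle0 => z [Hz [lS|//]]; move: cS; rewrite lS andbT lt0n => /negbFE.
  rewrite cards_eq0 => /eqP S0; rewrite S0 in Hz; exact: salg_pos flie_subalg _ Hz.
move=> rho m r0; rewrite /egf big_ord_recl /= mul0r mul0r add0r.
pose F k : R := (if (k < s)%N then rho ^+ k.+1 / k.+1%:R else 0).
have F0 k : 0 <= F k.
  by rewrite /F; case: ifP => // _; rewrite divr_ge0 ?exprn_ge0 ?ler0n.
rewrite (eq_bigr (fun k : 'I_m => F k)); last first.
  move=> k _; rewrite /F /bump /= add1n.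
  case: ifP => _; last by rewrite !mul0r.
  rewrite factS natrM.
  have kn0 : (k`!%:R : R) != 0 by rewrite pnatr_eq0 -lt0n fact_gt0.
  have k1n0 : (k.+1%:R : R) != 0 by rewrite pnatr_eq0.
  set a := k.+1%:R in k1n0 *; clearbody a.
  by field; rewrite kn0 k1n0.
rewrite [leRHS](eq_bigr (fun k : 'I_s => F k)); last by move=> k _; rewrite /F ltn_ord.
rewrite -(big_mkord xpredT F) -(big_mkord xpredT F).
have [ms|sm] := leqP m s; first exact: ler_sum_widen.
rewrite [leLHS](@big_cat_nat _ _ _ s) //=; last exact: ltnW.
rewrite gerDl big_nat_cond big1 // => k; rewrite andbT => /andP[sk _].
by rewrite /F ltnNge sk.
Qed.

(** The bound at the first level, from (k - 1)! / k! = 1 / k. *)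
Definition mu1 s rho := \sum_(k < s) rho ^+ k.+1 / k.+1%:R.
Definition lie_bound s l rho :=
  mu1 s rho + poly_bound l (rho ^+ s.+1 * expR (mu1 s rho)).

Lemma bounded_flie s l : (forall S z, lcsit (lcsf flie s) l S z -> z = 0) ->
  bounded flie (lie_bound s l).
Proof.
move=> J0; have aJ := flie_subalg.
have JM := flie_le_gens s; have MJ : fle (flie_le s) flie by move=> S z [].
have GJ := fvar_flie; have JG := flie_gens.
have Bg := fpow_lcsf (k := s) GJ; have gB := lcsf_fpow (k := s) aJ GJ JG.
have bM := bounded_flie_le s.
have bE : bounded (fexp br (fpow fvar s) (flie_le s))
    (fun rho => rho ^+ s.+1 * expR (mu1 s rho)).
  by apply: bounded_exp => //; apply: bounded_fpow bounded_fvar.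
have b1 := bounded_lcsit (lcsf_subalg s aJ) (fexp_gam aJ MJ Bg)
  (gam_gens aJ JM MJ Bg gB) bE J0.
exact: (bounded_le JM _ (bounded_add bM b1)).
Qed.

(** ** Center-by-metabelian Lie algebras

    Modulo [L'', L], the Lie algebra L is spanned by the variables, by the
    metabelian commutators and by the brackets of a metabelian commutator with
    a commutator of two variables. Their generating function is of order
    rho^4 exp(rho), which is o(n) for the rho used later. *)

Definition fder1 := fbr flie flie.
Definition fder2 := fbr fder1 fder1.
(** The multilinear part of [L'', L]. *)
Definition fcen := fbr fder2 flie.
Definition fpair := fpow fvar 1.
Definition fmet := fexp br fpair (fpsum fvar 1).
Definition flight := fadd fvar (fadd fmet (fbr fpair fmet)).

Let aJ := flie_subalg.
Let JM := fpsum_lcsf (s := 1) aJ fvar_flie flie_gens.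
Let MJ := fpsum_le (s := 1) aJ fvar_flie.
Let Bg := fpow_lcsf (k := 1) fvar_flie.
Let gB := lcsf_fpow (k := 1) aJ fvar_flie flie_gens.

Lemma fmet_der1 : fle fmet fder1. Proof. exact: fexp_gam aJ MJ Bg. Qed.
Lemma der1_fmet : fle fder1 (fadd fmet fder2). Proof. exact: gam_gens aJ JM MJ Bg gB. Qed.

Let d1J : fle fder1 flie. Proof. exact: salg_br. Qed.
Let d2d1 : fle fder2 fder1. Proof. exact: fop_mono. Qed.

(** [[b, m1, ..., mt], y] is congruent to [b, y'] modulo [L'', L], where the m's
    have been moved to the second argument. *)
Lemma fmet_pair : fle (fbr fmet fder1) (fadd (fbr fpair fder1) fcen).
Proof.
have sQ : fsub (fadd (fbr fpair fder1) fcen) by apply: fadd_sub.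
apply: fop_min => // S1 S2 t y dS Ht Hy.
move: t Ht; apply: (lspan_min (P := fun t => fadd (fbr fpair fder1) fcen (S1 :|: S2) {[t, y]})).
  exact: (subspace_opl _ bb (sQ _)).
move=> t [T0 [T1 [S1E dT]]]; subst S1.
move: t; apply: (lspan_min (P := fun t => fadd (fbr fpair fder1) fcen (T0 :|: T1 :|: S2) {[t, y]})).
  exact: (subspace_opl _ bb (sQ _)).
move=> t Ht; elim: Ht S2 y dS Hy {dT} => [b Hb|T2 T3 t' m i Ht IH Hm dT iT imax] S2 y dS Hy.
  by apply: faddl; rewrite setU0 in dS *; apply: fop1.
move: dS; rewrite !disjUl => /andP[dS0 /andP[dS2 dS3]].
move: dT; rewrite disjUl => /andP[dT03 dT23].
have Jm := MJ Hm.
have D1t : fder1 (T0 :|: T2) t' := srt_gen_gam aJ MJ Bg Ht.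
rewrite lieJl; apply: subspaceD => //.
  have -> : T0 :|: (T2 :|: T3) :|: S2 = T0 :|: T2 :|: S2 :|: T3 by set_eq.
  apply: faddr; apply: fop1 => //.
    by rewrite !disjUl dT03 dT23 disjoint_sym.
  by apply: fop1 => //; rewrite disjUl dS0.
have -> : T0 :|: (T2 :|: T3) :|: S2 = T0 :|: T2 :|: (T3 :|: S2) by set_eq.
apply: IH; first by rewrite disjUl !disjUr dT03 dT23 dS0.
by apply: fop1 => //; apply: d1J.
Qed.

Lemma flie_light : fle flie (fadd flight fcen).
Proof.
have sQ : fsub (fadd flight fcen) by apply: fadd_sub.
have d2c : fle fder2 (fadd flight fcen).
  apply: fle_trans (fop_mono der1_fmet fle_refl) _; apply: fop_addl => //; last first.
    by apply: fle_trans (fop_mono fle_refl d1J) _; apply: faddr.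
  apply: fle_trans fmet_pair _; apply: fadd_min => //; last exact: faddr.
  apply: fle_trans (fop_mono fle_refl der1_fmet) _; apply: fop_addr => //.
    apply: fle_trans (faddl _ _); apply: fle_trans (faddr _ _); exact: faddr.
  apply: fle_trans fbrC _; apply: fle_trans (faddr _ _).
  apply: fop_mono => //; apply: fle_trans Bg _; exact: lcsf_le.
apply: fle_trans flie_gens _; apply: fadd_min => //.
  by apply: fle_trans (faddl _ _); apply: faddl.
apply: fle_trans der1_fmet _; apply: fadd_min => //.
apply: fle_trans (faddl _ _); apply: fle_trans (faddr _ _); exact: faddl.
Qed.

Lemma flight_flie : fle flight flie.
Proof.
have sJ := salg_sub aJ; apply: fadd_min => //; first exact: fvar_flie.
have EJ : fle fmet flie by apply: fle_trans fmet_der1 d1J.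
apply: fadd_min => //; apply: fle_trans (salg_br aJ); apply: fop_mono => //.
by apply: fle_trans Bg _; apply: lcsf_le.
Qed.

Lemma bounded_flight : bounded flight
  (fun rho => rho + (rho ^+ 2 * expR rho + rho ^+ 2 * (rho ^+ 2 * expR rho))).
Proof.
have bp : bounded fpair (fun rho => rho ^+ 2) by apply: bounded_fpow bounded_fvar.
have bm : bounded fmet (fun rho => rho ^+ 2 * expR rho).
  apply: bounded_le (bounded_exp bb bp (bounded_fpsum 1 bounded_fvar)) => // rho _.
  by rewrite big_ord_recl big_ord0 addr0 expr1.
apply: bounded_add bounded_fvar (bounded_add bm _).
exact: bounded_op.
Qed.

End Bounds.

(** ** Products of commutators

    A product of commutators is a combination of products of elements of [L'', L],
    of which at most r can occur without annihilating the product, with light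
    factors, which commute and are therefore counted by an exponential. *)

Section Products.
Variables (mul : L -> L -> L) (one : L).
Hypotheses (mulb : bilin mul) (mulA : associative mul) (mulC : commutative mul).
Hypothesis mul1 : left_id one mul.

(** mul is a parameter, and not the product of an algebra over K, since the
    relatively free algebra is not declared as one. *)
Inductive pgen : {set 'I_n} -> L -> Prop :=
  | pgen1 : pgen set0 one
  | pgen_mul S1 S2 a b : pgen S1 a -> lgen S2 b -> [disjoint S1 & S2] ->
      pgen (S1 :|: S2) (mul a b).
Definition fprod : fam := fun S => lspan (pgen S).

Definition funit : fam := fun S z => S = set0 /\ z = one.
Definition fsym := fexp mul funit flight.

Fixpoint fheavy j : fam :=
  if j is j'.+1 then fop mul (fheavy j') fcen else funit.
Fixpoint fmixed j : fam :=
  if j is j'.+1 then fadd (fmixed j') (fop mul (fheavy j') fsym) else fun _ z => z = 0.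

Lemma fsym_mul : fle (fop mul fsym flight) fsym.
Proof.
have sZ : fsub fsym by apply: fexp_sub.
suff H S1 S2 t m : srt mul funit flight set0 S1 t -> flight S2 m ->
    [disjoint S1 & S2] -> srt mul funit flight set0 (S1 :|: S2) (mul t m).
  apply: fop_min => // S1 S2 z m dS Hz Hm.
  move: z Hz; apply: (lspan_min (P := fun z => fsym (S1 :|: S2) (mul z m))).
    exact: (subspace_opl _ mulb (sZ _)).
  move=> z [T0 [T1 [S1E dT Hz]]].
  have [T00|T0n] := eqVneq T0 set0; last first.
    have -> : z = 0.
      move: z Hz; apply: (lspan_min (P := fun z => z = 0)).
        by split=> // a u v -> ->; rewrite scaler0 addr0.
      move=> z; elim=> [b [T00]|? ? ? m' ? _ -> _ _ _ _]; first by rewrite T00 eqxx in T0n.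
      by rewrite bilin0l.
    by rewrite bilin0l //; apply: lspan0.
  rewrite T00 in Hz S1E; rewrite set0U in S1E; subst S1.
  rewrite -[T1 :|: S2]set0U; apply: srt_fexp; first by rewrite -setI_eq0 set0I.
  exact: H.
have [d] := ubnP #|S1|; elim: d S1 S2 t m => // d IH S1 S2 t m; rewrite ltnS => leS Tt Mm dS.
move: t Tt; apply: (lspan_min (P := fun t => srt mul funit flight set0 (S1 :|: S2) (mul t m))).
  exact: (subspace_opl _ mulb (srt_sub _ _ _ _ _)).
move=> t Ht.
have [S20|[i0 i0S]] := set_0Vmem S2.
  rewrite S20 in Mm *; rewrite (salg_pos flie_subalg (flight_flie Mm)) bilin0r //.
  exact: lspan0.
pose i2 := [arg max_(j > i0 in S2) (j : nat)].
have [i2S i2max] : i2 \in S2 /\ forall j, j \in S2 -> (j <= i2)%N.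
  by rewrite /i2; case: arg_maxnP.
case: (boolP [forall j in S1, (j <= i2)%N]) => [/forall_inP le2|].
  apply/lspan1/(srtS (i := i2)) => //; first by rewrite set0U.
  by move=> j; rewrite inE => /orP[/le2|/i2max].
rewrite negb_forall_in => /exists_inP[j jS1]; rewrite -ltnNge => lt2.
move: jS1 dS leS; case: Ht => [b _|R0 S3 t' m' i3 Ht' Mm' dR i3S i3max]; first by rewrite in_set0.
move=> jR dS leS.
have lt3 : (i2 < i3)%N by apply: leq_trans lt2 _; apply: i3max.
have iR : i3 \notin R0.
  by apply/negP => iR; move: dR; rewrite set0U => /disjointFr /(_ iR); rewrite i3S.
have ltR : (#|R0| < d)%N.
  apply: leq_trans leS; apply: proper_card; apply/properP; split; first exact: subsetUl.
  by exists i3; rewrite ?inE ?i3S ?orbT.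
move: dS dR; rewrite set0U !(disjUl, disjUr) => /andP[dR2 d32] dR3.
have -> : R0 :|: S3 :|: S2 = R0 :|: S2 :|: S3 by set_eq.
rewrite -mulA [mul m' m]mulC mulA.
have := IH _ _ _ _ ltR (lspan1 Ht') Mm dR2.
apply: (lspan_min (P := fun z => srt mul funit flight set0 (R0 :|: S2 :|: S3) (mul z m'))).
  exact: (subspace_opl _ mulb (srt_sub _ _ _ _ _)).
move=> z Hz; apply/lspan1/(srtS (i := i3)) => //.
  by rewrite set0U !disjUl dR3 disjoint_sym.
move=> l; rewrite !inE => /orP[/orP[lR|lS]|lS].
- by apply: i3max; rewrite inE lR.
- by apply: leq_trans (i2max _ lS) (ltnW _).
by apply: i3max; rewrite inE lS orbT.
Qed.

Lemma fheavy_le j k : (j < k)%N -> fle (fop mul (fheavy j) fsym) (fmixed k).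
Proof.
elim: k => // k IH; rewrite ltnS leq_eqVlt => /orP[/eqP->|/IH H] /=; first exact: faddr.
by apply: fle_trans H _; apply: faddl.
Qed.

Lemma fmixed_sub k : fsub (fmixed k).
Proof.
by case: k => [|k] /= S; [split=> // a u v -> ->; rewrite scaler0 addr0|apply: fadd_sub].
Qed.

Lemma fprod_mixed r : (forall S z, fheavy r S z -> z = 0) -> fle fprod (fmixed r.+1).
Proof.
move=> X0 S; apply: lspan_min; first exact: fmixed_sub.
move=> z; elim=> [|S1 S2 a b _ IH Hb dS].
  apply: (fheavy_le (ltn0Sn r)); rewrite -[one]mul1 -[set0]setU0.
  apply: fop1; [by rewrite -setI_eq0 setI0|by []|].
  by apply: fexp_base.
have {Hb} : fadd flight fcen S2 b by apply/flie_light/lspan1.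
suff H : fle (fop mul (fmixed r.+1) (fadd flight fcen)) (fmixed r.+1).
  by move=> Hb; apply: H; apply: fop1.
have sT := fmixed_sub r.+1.
have swap u v w : mul (mul u v) w = mul (mul u w) v by rewrite -mulA [mul v w]mulC mulA.
apply: fop_min => // {IH dS}S1' S2' u v dS' Hu Hv.
move: {S1 S2 a b} S1' S2' u v dS' Hu Hv.
suff H j : (j < r.+1)%N -> forall S1 S2 u v, [disjoint S1 & S2] ->
   fop mul (fheavy j) fsym S1 u -> fadd flight fcen S2 v -> fmixed r.+1 (S1 :|: S2) (mul u v).
  move=> S1 S2 u v dS Hu Hv.
  have H2 : forall k, (k <= r.+1)%N -> forall u, fmixed k S1 u ->
      fmixed r.+1 (S1 :|: S2) (mul u v).
    elim=> [|k IHk] kr u'.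
      by move=> /= ->; rewrite bilin0l //; have [] := sT (S1 :|: S2).
    apply: (lspan_min (P := fun u => fmixed r.+1 (S1 :|: S2) (mul u v))).
      exact: (subspace_opl _ mulb (sT _)).
    by move=> {}u' [/IHk|Hu']; [apply; apply: ltnW|apply: (H k)].
  exact: (H2 _ (leqnn _)).
move=> jr S1 S2 u v dS Hu Hv.
move: v Hv; apply: (lspan_min (P := fun v => fmixed r.+1 (S1 :|: S2) (mul u v))).
  exact: (subspace_opr _ mulb (sT _)).
move=> v Hv; move: u Hu; apply: (lspan_min (P := fun u => fmixed r.+1 (S1 :|: S2) (mul u v))).
  exact: (subspace_opl _ mulb (sT _)).
move=> _ [T1 [T2 [h [z' [S1E dT Hh Hz' ->]]]]]; subst S1.
move: dS; rewrite disjUl => /andP[d1 d2].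
case: Hv => [Lv|Xv].
  rewrite -mulA -setUA; apply: (fheavy_le jr); apply: fop1 => //.
    by rewrite disjUr dT.
  by apply: fsym_mul; apply: fop1.
rewrite swap; have -> : T1 :|: T2 :|: S2 = T1 :|: S2 :|: T2 by set_eq.
have Hu' : fheavy j.+1 (T1 :|: S2) (mul h v) by apply: fop1.
have dd : [disjoint T1 :|: S2 & T2] by rewrite disjUl dT disjoint_sym.
have [jr'|] := ltnP j.+1 r.+1; first by apply: (fheavy_le jr'); apply: fop1.
rewrite ltnS => rj; have jE : j.+1 = r.+1 by apply/eqP; rewrite eqn_leq jr ltnS.
have : mul h v = 0.
  by case: jE Hh => -> /X0 ->; rewrite bilin0l.
by move=> ->; rewrite bilin0l //; have [] := sT (T1 :|: S2 :|: T2).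
Qed.

Variable R : realType.

Definition light_bound (rho : R) :=
  rho + (rho ^+ 2 * expR rho + rho ^+ 2 * (rho ^+ 2 * expR rho)).

Lemma bounded_funit : bounded funit (fun rho : R => 1).
Proof.
exists (fun k => (k == 0)%N : nat); split.
  move=> S; case: eqVneq => [_|cS].
    by exists [:: one]; split=> // z [_ ->]; apply: lspan1; rewrite inE.
  by apply: dimle0 => z [S0 _]; rewrite S0 cards0 in cS.
move=> rho m r0; rewrite /egf big_ord_recl big1 /=.
  by rewrite expr0 divr1 mul1r addr0.
by move=> i _; rewrite /bump /= !mul0r.
Qed.

Lemma bounded_fprod s l r :
  (forall S z, lcsit (lcsf flie s) l S z -> z = 0) ->
  (forall S z, fheavy r S z -> z = 0) ->
  bounded fprod (fun rho : R =>
    \sum_(j < r.+1) lie_bound s l rho ^+ j * expR (light_bound rho)).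
Proof.
move=> J0 X0.
have bl := bounded_flie R J0.
have bc : bounded fcen (lie_bound (R := R) s l).
  apply: bounded_le bl => //; apply: fle_trans (salg_br flie_subalg).
  apply: fop_mono => //; apply: fle_trans (salg_br flie_subalg).
  by apply: fop_mono; apply: (salg_br flie_subalg).
have bs : bounded fsym (fun rho : R => expR (light_bound rho)).
  apply: bounded_le (bounded_exp mulb bounded_funit (bounded_flight R)) => // rho _.
  by rewrite mul1r.
have bh j : bounded (fheavy j) (fun rho : R => lie_bound s l rho ^+ j).
  elim: j => [|j IH] /=; first by apply: (bounded_le _ _ bounded_funit) => // rho _; rewrite expr0.
  by apply: bounded_le (bounded_op mulb IH bc) => // rho _; rewrite exprSr.
apply: (bounded_le (@fprod_mixed _ X0) (fun rho _ => lexx _)).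
elim: r.+1 => [|k IH] /=.
  exists (fun=> 0%N); split; first by move=> S; apply: dimle0.
  by move=> rho m r0; rewrite /egf big1 ?big_ord0 // => i _; rewrite !mul0r.
apply: bounded_le (bounded_add IH (bounded_op mulb (bh k) bs)) => // rho _.
by rewrite big_ord_recr.
Qed.

End Products.
End Multilinear.

(** * The upper bound for codimensions *)

(** The iterated terms J_2 = gamma_(s 1 + 1)(L), J_3 = gamma_(s 2 + 1)(J_2), ... *)
Fixpoint poly_lcs (K : fieldType) (L : lieAlgType K) (s : nat -> nat) i : set L :=
  if i is i'.+1 then lcs (@poly_lcs K L s i') (s i) else [set: L]%classic.

Arguments poly_lcs {K} L s i.

Lemma lcs_image (K : fieldType) (L L' : lieAlgType K) (f : L -> L') (J : set L) (J' : set L') k :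
  (forall a x y, f (a *: x + y) = a *: f x + f y) ->
  (forall x y, f {[x, y]} = {[f x, f y]}) ->
  (forall x, J x -> J' (f x)) -> forall x, lcs J k x -> lcs J' k (f x).
Proof.
move=> fP fbr JJ; elim: k => // k IH x /lin_span_lspan; rewrite -/lcs => Hx.
apply: lspan_lin_span; elim: Hx => [|a u v [y [z [Hy Hz ->]]] _ IHv].
  by have := fP (-1) 0 0; rewrite scaler0 addr0 scaleN1r addNr => ->; apply: lspan0.
rewrite fP; apply: lspanS => //; exists (f y), (f z).
by split; [apply: IH|apply: JJ|rewrite fbr].
Qed.

Lemma lcs_lift (K : fieldType) (L L' : lieAlgType K) (f : L -> L') (J : set L) (J' : set L') k :
  (forall a x y, f (a *: x + y) = a *: f x + f y) ->
  (forall x y, f {[x, y]} = {[f x, f y]}) ->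
  (forall y, J' y -> exists2 x, J x & y = f x) ->
  forall y, lcs J' k y -> exists2 x, lcs J k x & y = f x.
Proof.
move=> fP fbr JJ; elim: k => // k IH y /lin_span_lspan; rewrite -/lcs.
elim=> [|a u v [y1 [z1 [/IH[y2 Hy2 ->] /JJ[z2 Hz2 ->] ->]]] _ [w Hw ->]].
  exists 0; first by apply/lspan_lin_span/lspan0.
  by have := fP (-1) 0 0; rewrite scaler0 addr0 scaleN1r addNr => ->.
exists (a *: {[y2, z2]} + w); last by rewrite fP fbr.
apply/lspan_lin_span/lspanS; first by exists y2, z2.
exact: lin_span_lspan.
Qed.

Lemma poly_lcs_image (K : fieldType) (L L' : lieAlgType K) (f : L -> L') q s J i :
  (forall a x y, f (a *: x + y) = a *: f x + f y) ->
  (forall x y, f {[x, y]} = {[f x, f y]}) ->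
  J 1%N = [set: L']%classic ->
  (forall i, (1 <= i <= q)%N -> quot_nilpotent (J i) (J i.+1) (s i)) ->
  (i <= q)%N -> forall x, poly_lcs L s i x -> J i.+1 (f x).
Proof.
move=> fP fbr J1 Jq; elim: i => [|i IH] iq x /=; first by rewrite J1.
move=> Hx; have/Jq : (1 <= i.+1 <= q)%N by [].
apply; exact: (lcs_image fP fbr (IH (ltnW iq))) Hx.
Qed.

Section RelFreePN.
Variables (K : fieldType) (q : nat) (s : nat -> nat).
Local Notation W := (PN K q s).
Local Notation Q := (relFree W).
Local Notation pr := (@rel_proj K W).

Lemma prP a x y : pr (a *: x + y) = a *: pr x + pr y.
Proof. by rewrite rel_projD rel_projZ. Qed.

(** F(W, X) is itself polynilpotent as a Lie algebra: its polynilpotent words are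
    images of elements of F(X) that vanish in all members of W. *)
Lemma poly_lcs_relFree x : poly_lcs Q s q x -> x = 0.
Proof.
move=> Hx; suff [y Hy ->] : exists2 y, poly_lcs (freePoisson K) s q y & x = pr y.
  have /rel_proj_ker-> // : poisson_identities W y.
  move=> A [J [J1 J0 _ _ Jq]] h hh.
  have := poly_lcs_image (phomP hh) (phom_lieb hh) J1 Jq (leqnn q) Hy.
  by rewrite J0.
suff H i : forall y, poly_lcs Q s i y -> exists2 z, poly_lcs (freePoisson K) s i z & y = pr z.
  exact: H.
elim: i => [|i IH] {x Hx}x Hx; first by have [y <-] := rel_proj_surj x; exists y.
exact: (@lcs_lift K (freePoisson K) Q pr _ _ _ prP (@rel_proj_br K W) IH x Hx).
Qed.

Definition rbr (x y : Q) : Q := {[x, y]}.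

Lemma rbr_poisson : poisson_bracket rbr.
Proof.
split; rewrite /rbr.
- exact: lieDl.
- exact: lieDr.
- exact: liebb.
- exact: jacobi.
elim/rel_ind=> x; elim/rel_ind=> y; elim/rel_ind=> z.
transitivity (pr {[x * y, z]}); first by rewrite rel_proj_br rel_projM.
by rewrite leibniz rel_projD !rel_projM !rel_proj_br.
Qed.

Lemma derZ k (a : K) (x : Q) : der rbr k x -> der rbr k (a *: x).
Proof.
elim: k x => // k IH x; elim=> [|_ v [y [z [Hy Hz ->]]] _ IHv].
  by rewrite scaler0; apply: der0.
rewrite scalerDr; apply: (derD (br := rbr)) => //; rewrite /rbr -lieZl.
by apply: der_br => //; apply: IH.
Qed.

Lemma der_subspace k : subspace (der rbr k).
Proof.
split; first exact: der0.
by move=> a x y Hx Hy; apply: derD => //; apply: derZ.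
Qed.

Lemma der_lcs m t (J : set Q) : (forall x, der rbr m x -> J x) ->
  forall x, der rbr (m + t) x -> lcs J t x.
Proof.
move=> mJ; elim: t => [|t IH] x; first by rewrite addn0; apply: mJ.
rewrite addnS => Hx; apply: lspan_lin_span.
elim: Hx => [|_ v [y [z [Hy Hz ->]]] _ IHv]; first exact: lspan0.
rewrite -[rbr y z]scale1r; apply: lspanS => //; exists y, z; split=> //.
  exact: IH.
by apply: mJ; apply: (der_le rbr_poisson) Hz; apply: leq_addr.
Qed.

(** Polynilpotent Lie algebras are solvable: the derived series descends at least
    as fast as a lower central series. *)
Lemma der_poly_lcs i : forall x, der rbr (\sum_(j < i) s j.+1) x -> poly_lcs Q s i x.
Proof.
elim: i => [//|i IH] x; rewrite big_ord_recr /=.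
exact: der_lcs.
Qed.

Lemma relFree_nil : exists r, nilset (ideal_br rbr (der rbr 2)) r.
Proof.
apply: (@solvable_nil (\sum_(j < q) s j.+1) _ _ rbr_poisson) => x.
by move=> /der_poly_lcs/poly_lcs_relFree.
Qed.

Definition rmul (x y : Q) : Q := x * y.

Lemma bilin_rmul : bilin rmul.
Proof.
split=> a x y z; elim/rel_ind: x => x; elim/rel_ind: y => y; elim/rel_ind: z => z.
  transitivity (pr ((a *: x + y) * z)); first by rewrite rel_projM prP.
  by rewrite mulrDl -scalerAl prP !rel_projM.
transitivity (pr (z * (a *: x + y))); first by rewrite rel_projM prP.
by rewrite mulrDr -scalerAr prP !rel_projM.
Qed.

Section Component.
Variable n : nat.
Definition rvar (i : 'I_n) : Q := pr (sa_gen (fl_var K i.+1)).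
Local Notation L := (@flie K Q n rvar).

Lemma rel_lcsf J (J' : set Q) k : (forall S z, J S z -> J' z) ->
  forall (S : {set 'I_n}) z, lcsf J k S z -> lcs J' k z.
Proof.
move=> JJ; elim: k => [|k IH] S z; first exact: JJ.
move=> Hz; apply: lspan_lin_span; move: Hz; apply: lspan_mono.
move=> _ [S1 [S2 [x [y [_ _ Hx Hy ->]]]]]; exists x, y.
by split=> //; [apply: IH Hx|apply: JJ Hy].
Qed.

Lemma rel_lcsit i l (J : {set 'I_n} -> set Q) : (i + size l = q)%N ->
  l = [seq s j.+1 | j <- iota i (size l)] ->
  (forall S z, J S z -> poly_lcs Q s i z) ->
  forall S z, lcsit J l S z -> z = 0.
Proof.
elim: l i J => [|s' l IH] i J /= iq lE JP S z.
  have iE : i = q by rewrite -iq addn0.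
  by move=> /JP Hz; apply: poly_lcs_relFree; rewrite -[X in poly_lcs _ _ X]iE.
case: lE => -> lE; apply: (IH i.+1) => //; first by rewrite addSn -addnS.
exact: rel_lcsf.
Qed.

Lemma fder1_der S z : fder1 rvar S z -> der rbr 1 z.
Proof.
apply: lspan_min; first exact: der_subspace.
by move=> _ [S1 [S2 [x [y [_ _ Hx Hy ->]]]]]; apply: der_br.
Qed.

Lemma fder2_der S z : fder2 rvar S z -> der rbr 2 z.
Proof.
apply: lspan_min; first exact: der_subspace.
move=> _ [S1 [S2 [x [y [_ _ Hx Hy ->]]]]]; apply: der_br.
  exact: fder1_der Hx.
exact: fder1_der Hy.
Qed.

Lemma fheavy_prod j S z : fheavy rvar rmul 1 j S z ->
  lspan (fun z => exists t : seq Q, [/\ size t = j,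
    forall x, x \in t -> ideal_br rbr (der rbr 2) x & z = \prod_(x <- t) x]) z.
Proof.
elim: j S z => [|j IH] S z.
  by move=> [_ ->]; apply: lspan1; exists [::]; rewrite big_nil.
apply: lspan_min; first exact: lspan_subspace.
move=> _ [S1 [S2 [u [v [_ _ /IH Hu Hv ->]]]]].
move: u v Hu Hv.
apply: (lspan_op (op := rmul)); [exact: bilin_rmul|exact: lspan_subspace|].
move=> _ _ [t [szt tX ->]] [T1 [T2 [y [a [_ _ Hy _ ->]]]]].
apply: lspan1; exists ({[y, a]} :: t); split=> /=; first by rewrite szt.
  move=> x; rewrite inE => /orP[/eqP->|/tX//]; exists y, a; split=> //.
  exact: fder2_der Hy.
by rewrite big_cons mulrC.
Qed.

Definition comm_set c : {set 'I_n} := [set i : 'I_n | i.+1 \in comm_vars c].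

Lemma lgen_comm c : uniq (comm_vars c) -> {subset comm_vars c <= iota 1 n} ->
  lgen rvar (comm_set c) (pr (sa_gen (comm_val K c))).
Proof.
elim: c => [i|c1 IH1 c2 IH2] /=.
  move=> _ /(_ i); rewrite inE eqxx => /(_ isT); rewrite mem_iota add1n ltnS.
  case: i => // i /= lt_i.
  have -> : comm_set (CVar i.+1) = [set Ordinal lt_i].
    by apply/setP => j; rewrite !inE eqSS -val_eqE.
  exact: (lgen_var rvar (Ordinal lt_i)).
rewrite cat_uniq => /and3P[u1 /hasPn nu u2] sub.
have -> : comm_set (CBr c1 c2) = comm_set c1 :|: comm_set c2.
  by apply/setP => j; rewrite !inE mem_cat.
rewrite -sa_gen_br rel_proj_br; apply: lgen_br.
- by apply: IH1 => // j jc; apply: sub; rewrite mem_cat jc.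
- by apply: IH2 => // j jc; apply: sub; rewrite mem_cat jc orbT.
apply/pred0P => j /=; rewrite !inE; apply/negP => /andP[j1 j2].
by move: (nu _ j2); rewrite j1.
Qed.

Lemma pgen_monomial m : uniq (flatten (map comm_vars m)) ->
  {subset flatten (map comm_vars m) <= iota 1 n} ->
  pgen rvar rmul 1 [set i : 'I_n | i.+1 \in flatten (map comm_vars m)]
    (pr (monomial_val K m)).
Proof.
elim: m => [|c m IH] /=.
  move=> _ _; rewrite /monomial_val big_nil.
  by have -> : [set i : 'I_n | i.+1 \in [::]] = finset.set0; [apply/setP => i; rewrite !inE|exact: pgen1].
rewrite cat_uniq => /and3P[u1 /hasPn nu u2] sub.
have -> : [set i : 'I_n | i.+1 \in comm_vars c ++ flatten (map comm_vars m)] =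
    [set i : 'I_n | i.+1 \in flatten (map comm_vars m)] :|: comm_set c.
  by apply/setP => j; rewrite !inE mem_cat orbC.
rewrite /monomial_val big_cons rel_projM mulrC; apply: (pgen_mul (mul := rmul)).
- by apply: IH => // j jc; apply: sub; rewrite mem_cat jc orbT.
- by apply: lgen_comm => // j jc; apply: sub; rewrite mem_cat jc.
apply/pred0P => j /=; rewrite !inE; apply/negP => /andP[j1 j2].
by move: (nu _ j1); rewrite j2.
Qed.

Lemma multilinear_fprod z : (pr @` multilinear_part K n)%classic z ->
  fprod rvar rmul 1 [set: 'I_n] z.
Proof.
move=> [f /lin_span_lspan Hf <-].
elim: Hf => [|a _ g [m Hm <-] _ IH].
  have -> : pr 0 = 0 by have := prP (-1) 0 0; rewrite scaler0 addr0 scaleN1r addNr.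
  exact: lspan0.
rewrite prP; apply: lspanS => //.
have -> : [set: 'I_n] = [set i : 'I_n | i.+1 \in flatten (map comm_vars m)].
  apply/setP => i; rewrite !inE (perm_mem Hm) mem_iota /= add1n ltnS.
  by rewrite ltn_ord.
apply: pgen_monomial; first by rewrite (perm_uniq Hm) iota_uniq.
by move=> j; rewrite (perm_mem Hm).
Qed.

Lemma dimle_lin_span (A : set Q) k : dimle A k ->
  exists m (w : 'I_m -> Q), (m <= k)%N /\ (A `<=` lin_span (range w))%classic.
Proof.
move=> [v [sz Av]]; exists (size v), (fun i : 'I_(size v) => v`_i); split=> // x /Av Hx.
apply: lspan_lin_span; apply: lspan_mono Hx => z zv.
have lt : (index z v < size v)%N by rewrite index_mem.
by exists (Ordinal lt) => //=; rewrite nth_index.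
Qed.

End Component.

Lemma bounded_relFree (R : realType) : (1 <= q)%N -> exists r, forall n,
  bounded (fprod (rvar (n := n)) rmul 1) (fun rho : R =>
    \sum_(j < r.+1) lie_bound (s 1%N) [seq s j.+1 | j <- iota 1 q.-1] rho ^+ j
      * expR (light_bound rho)).
Proof.
move=> q0; have [r nr] := relFree_nil; exists r => n.
apply: (bounded_fprod bilin_rmul (@mulrA _) (@mulrC _) (@mul1r _)) => S z.
  apply: (rel_lcsit (i := 1)).
  - by rewrite size_map size_iota add1n prednK.
  - by rewrite size_map size_iota.
  by move=> {z}S z; apply: rel_lcsf.
move=> /fheavy_prod; apply: (lspan_min (P := fun z => z = 0)).
  by split=> // a u v -> ->; rewrite scaler0 addr0.
by move=> _ [t [szt tX ->]]; apply: nr.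
Qed.

Lemma multilinear_span (R : realType) n : (1 <= q)%N -> exists m (w : 'I_m -> Q),
  (pr @` multilinear_part K n `<=` lin_span (range w))%classic.
Proof.
move=> q0; have [r /(_ n)[h [hd _]]] := bounded_relFree R q0.
have [m [w [_ Hw]]] := dimle_lin_span (hd [set: 'I_n]).
by exists m, w => z /multilinear_fprod /Hw.
Qed.

(** A coefficient of a series with nonnegative coefficients is bounded by the
    value of the series at rho over rho^n. *)
Theorem codim_upper (R : realType) : (1 <= q)%N -> exists r, forall n (rho : R), 0 < rho ->
  (codim W n)%:R <= n`!%:R / rho ^+ n *
    (\sum_(j < r.+1) lie_bound (s 1%N) [seq s j.+1 | j <- iota 1 q.-1] rho ^+ j
      * expR (light_bound rho)).
Proof.
move=> q0; have [r Hr] := bounded_relFree R q0; exists r => n rho rho0.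
have [h [hd hb]] := Hr n.
have codim_le : (codim W n <= h n)%N.
  have [m [w [mh Hw]]] := dimle_lin_span (hd [set: 'I_n]).
  rewrite cardsT card_ord in mh; apply: leq_trans mh.
  by apply: (dimension_le (w := w)) => z /multilinear_fprod /Hw.
have nf : 0 < (n`!%:R : R) by rewrite ltr0n fact_gt0.
have rn : 0 < rho ^+ n by rewrite exprn_gt0.
rewrite mulrAC ler_pdivlMr // -ler_pdivrMl //.
apply: le_trans (hb rho n (ltW rho0)); rewrite /egf big_ord_recr /= -[leLHS]add0r.
apply: lerD.
  by apply: sumr_ge0 => k _; rewrite !mulr_ge0 ?exprn_ge0 ?invr_ge0 // ltW.
by rewrite mulrC ler_wpM2r ?invr_ge0 // ler_wpM2r ?ler_nat // ltW.
Qed.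

End RelFreePN.

(** * Lie algebras of forests *)

Section TreeAlgebra.
Variables (K : fieldType) (I : finType) (p : I -> option I).
Implicit Types (A B C S : {set I}) (f g h : {set I} -> K).

Definition into i S := if p i is Some m then m \in S else false.

(** The number of edges from B to A minus the number of edges from A to B. *)
Definition edges A B : K :=
  \sum_(i in B) (into i A)%:R - \sum_(i in A) (into i B)%:R.

Lemma edgesC A B : edges A B = - edges B A.
Proof. by rewrite /edges opprB. Qed.

Lemma into_setU i A B : [disjoint A & B] ->
  (into i (A :|: B))%:R = (into i A)%:R + (into i B)%:R :> K.
Proof.
rewrite /into; case: (p i) => [m|] dAB; last by rewrite addr0.
rewrite inE; case mA: (m \in A) => /=; last by rewrite add0r.
by rewrite (disjointFr dAB mA) addr0.
Qed.

Lemma edges_setUl A B C : [disjoint A & B] -> edges (A :|: B) C = edges A C + edges B C.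
Proof.
move=> dAB; rewrite /edges (eq_bigr _ (fun i _ => into_setU i dAB)) big_split /=.
have -> : \sum_(i in A :|: B) (into i C)%:R =
    \sum_(i in A) (into i C)%:R + \sum_(i in B) (into i C)%:R :> K.
  by rewrite -bigU //; apply: eq_bigl => i; rewrite !inE.
by rewrite opprD addrACA.
Qed.

Lemma edges_setUr A B C : [disjoint B & C] -> edges A (B :|: C) = edges A B + edges A C.
Proof. by move=> dBC; rewrite edgesC edges_setUl // opprD -!edgesC. Qed.

Definition split2 S A B : K := ((S == A :|: B) && [disjoint A & B])%:R.
Definition split3 S A B C : K :=
  [&& S == A :|: B :|: C, [disjoint A & B], [disjoint A & C] & [disjoint B & C]]%:R.

(** The bracket of the algebra with basis e_S, S a set of nodes, and
    {e_A, e_B} = edges A B e_(A u B) for disjoint A and B. *)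
Definition tbr f g S := \sum_A \sum_B split2 S A B * (f A * g B) * edges A B.

Lemma split2_split2 S A B C :
  \sum_D split2 S A D * split2 D B C = split3 S A B C.
Proof.
rewrite (bigD1 (B :|: C)) //= [X in _ + X]big1 ?addr0 => [|D DBC].
  rewrite /split2 /split3 eqxx -natrM mulnb disjUr setUA /=.
  by congr (nat_of_bool _)%:R; do !case: [disjoint _ & _]; rewrite ?andbT ?andbF.
by rewrite [split2 D _ _]/split2 (negbTE DBC) mulr0.
Qed.

Lemma tbr_tbr f g h S : tbr f (tbr g h) S =
  \sum_A \sum_B \sum_C split3 S A B C * (f A * g B * h C) * (edges A (B :|: C) * edges B C).
Proof.
rewrite /tbr; apply: eq_bigr => A _.
transitivity (\sum_D \sum_B \sum_C split2 S A D * split2 D B C * (f A * g B * h C) * (edges A (B :|: C) * edges B C)).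
  apply: eq_bigr => D _; rewrite mulr_sumr mulr_sumr mulr_suml; apply: eq_bigr => B _.
  rewrite mulr_sumr mulr_sumr mulr_suml; apply: eq_bigr => C _.
  have [->|DBC] := eqVneq D (B :|: C); first by ring.
  by rewrite [split2 D _ _]/split2 (negbTE DBC) /=; ring.
rewrite exchange_big /=; apply: eq_bigr => B _.
rewrite exchange_big /=; apply: eq_bigr => C _.
by rewrite -!mulr_suml split2_split2.
Qed.

Lemma split3_rot S A B C : split3 S A B C = split3 S B C A.
Proof.
rewrite /split3 (_ : B :|: C :|: A = A :|: B :|: C); last by rewrite [LHS]setUC setUA.
rewrite (disjoint_sym B A) (disjoint_sym C A); congr (nat_of_bool (_ && _))%:R.
by case: [disjoint A & B]; case: [disjoint A & C]; case: [disjoint B & C].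
Qed.

(** The coefficient edges A (B u C) * edges B C is expanded by additivity; the six
    products cancel in pairs, as edges is antisymmetric. *)
Lemma tbr_jacobi f g h S :
  tbr f (tbr g h) S + tbr g (tbr h f) S + tbr h (tbr f g) S = 0.
Proof.
have rot (F : {set I} -> {set I} -> {set I} -> K) :
    \sum_A \sum_B \sum_C F A B C = \sum_C \sum_A \sum_B F A B C.
  rewrite [RHS]exchange_big /=; apply: eq_bigr => A _.
  by rewrite exchange_big.
rewrite !tbr_tbr [X in _ + X + _]rot [X in _ + X]rot [X in _ + X]rot.
rewrite -!big_split /=; apply: big1 => A _; rewrite -!big_split /=; apply: big1 => B _.
rewrite -!big_split /=; apply: big1 => C _.
rewrite -(split3_rot S A B C) -(split3_rot S C A B) [split3 S C A B]split3_rot.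
case ABC: [&& S == A :|: B :|: C, [disjoint A & B], [disjoint A & C] & [disjoint B & C]].
  case/and4P: ABC => _ dAB dAC dBC.
  rewrite !edges_setUr //; last by rewrite disjoint_sym.
  by rewrite (edgesC B A) (edgesC C A) (edgesC C B); ring.
by rewrite /split3 ABC !mul0r !addr0.
Qed.
End TreeAlgebra.

(** Only the basis vectors e_S of connected S are kept: they span a subalgebra,
    and the level of the root of S bounds the levels of its nodes, which makes
    the algebra polynilpotent. *)

(** A forest whose nodes have levels and are grouped into chains; the parent
    of a node lies above it, in the same chain or at a higher level. *)
Record forest (I : finType) := Forest {
  parent : I -> option I;
  level : I -> nat;
  chain : I -> I }.

Section Forest.
Variables (K : fieldType) (I : finType) (t : forest I).
Local Notation p := (parent t).
Local Notation tin := (into p).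
Implicit Types (A B C S : {set I}).

Definition below i j := (level t i < level t j)%N || (chain t i == chain t j).

(** The forest is built from chains with at most s l elements of level l. *)
Definition forest_ok (q : nat) (s : nat -> nat) : Prop :=
  [/\ forall i, (1 <= level t i <= q)%N,
      forall i j, chain t i = chain t j -> level t i = level t j,
      forall i, (#|[set j | chain t j == chain t i]| <= s (level t i))%N &
      forall i m, p i = Some m -> below i m].

Definition subtree S := [exists r in S, [forall i in S,
  below i r && ((i == r) || tin i S)]].

Hypothesis chain_level : forall i j, chain t i = chain t j -> level t i = level t j.
Hypothesis parent_below : forall i m, p i = Some m -> below i m.

Lemma below_trans i j k : below i j -> below j k -> below i k.
Proof.
rewrite /below => /orP[ij|/eqP ij] /orP[jk|/eqP jk].
- by rewrite (ltn_trans ij jk).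
- by rewrite -(chain_level jk) ij.
- by rewrite (chain_level ij) jk.
by rewrite ij jk eqxx orbT.
Qed.

Lemma into_disj i A B : [disjoint A & B] -> tin i A -> tin i B = false.
Proof. by rewrite /into; case: (p i) => // m /disjointFr H /H. Qed.

Lemma intoU i A B : tin i (A :|: B) = tin i A || tin i B.
Proof. by rewrite /into; case: (p i) => // m; rewrite inE. Qed.

Lemma subtree_join A B rA rB : rA \in A -> rB \in B -> [disjoint A & B] ->
  (forall i, i \in A -> below i rA && ((i == rA) || tin i A)) ->
  (forall i, i \in B -> below i rB && ((i == rB) || tin i B)) ->
  tin rB A -> subtree (A :|: B).
Proof.
move=> rAA rBB dAB HA HB pB; apply/exists_inP; exists rA; first by rewrite inE rAA.
apply/forall_inP => i; rewrite inE => /orP[iA|iB].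
  by have /andP[-> /orP[->//|iA']] := HA _ iA; rewrite intoU iA' orbT.
have bB : below rB rA.
  move: (pB); rewrite /into; case pE: (p rB) => [m|//] mA.
  apply: below_trans (parent_below pE) _.
  by have /andP[] := HA _ mA.
have /andP[bi Hi] := HB _ iB.
rewrite (below_trans bi bB) intoU.
by case/orP: Hi => [/eqP->|->]; rewrite ?pB ?orbT.
Qed.

(** A nonzero coefficient needs an edge between A and B, which starts at the root
    of one of them. *)
Lemma subtreeU A B : subtree A -> subtree B -> [disjoint A & B] ->
  edges K p A B != 0 -> subtree (A :|: B).
Proof.
move=> /exists_inP[rA rAA /forall_inP HA] /exists_inP[rB rBB /forall_inP HB] dAB.
have H (X Y : {set I}) r : r \in Y -> [disjoint X & Y] ->
    (forall i, i \in Y -> below i r && ((i == r) || tin i Y)) ->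
    \sum_(i in Y) (tin i X)%:R = (tin r X)%:R :> K.
  move=> rY dXY HY; rewrite (bigD1 r) //= big1 ?addr0 // => i /andP[iY ir].
  have /andP[_] := HY _ iY; rewrite (negbTE ir) /= => iY'.
  by rewrite (into_disj _ iY') // disjoint_sym.
rewrite /edges (H A B rB) // (H B A rA) //; last by rewrite disjoint_sym.
case pB: (tin rB A); first by move=> _; exact: (subtree_join rAA rBB dAB HA HB pB).
case pA: (tin rA B); last by rewrite subrr eqxx.
move=> _; rewrite setUC; rewrite disjoint_sym in dAB.
exact: (subtree_join rBB rAA dAB HB HA pA).
Qed.

Lemma subtree1 i : subtree [set i].
Proof.
apply/exists_inP; exists i; first by rewrite inE.
by apply/forall_inP => j; rewrite inE => /eqP->; rewrite /below !eqxx orbT.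
Qed.

Lemma subtree_n0 S : subtree S -> S != set0.
Proof. by move=> /exists_inP[r rS _]; apply/set0Pn; exists r. Qed.
End Forest.

Section TreeLie.
Variables (K : fieldType) (I : finType) (t : forest I).
Local Notation p := (parent t).
Local Notation tset := {S : {set I} | subtree t S}.

Definition tree_lie := {ffun tset -> K^o}.
HB.instance Definition _ := GRing.Lmodule.on tree_lie.

Definition tcoef (f : tree_lie) (S : {set I}) : K :=
  if insub S is Some S' then f S' else 0.

Lemma tcoefE (f : tree_lie) (S : tset) : tcoef f (val S) = f S.
Proof. by rewrite /tcoef valK. Qed.

Lemma tcoef_out (f : tree_lie) S : ~~ subtree t S -> tcoef f S = 0.
Proof. by move=> nS; rewrite /tcoef insubN. Qed.

Lemma tcoef_inj (f g : tree_lie) : tcoef f =1 tcoef g -> f = g.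
Proof. by move=> fg; apply/ffunP => S; rewrite -!tcoefE fg. Qed.

Lemma tcoefP a (f g : tree_lie) S : tcoef (a *: f + g) S = a * tcoef f S + tcoef g S.
Proof.
rewrite /tcoef; case: insubP => [S' _ _|_]; first by rewrite !ffunE.
by rewrite mulr0 addr0.
Qed.

Lemma tcoefD (f g : tree_lie) S : tcoef (f + g) S = tcoef f S + tcoef g S.
Proof. by rewrite -[f]scale1r tcoefP mul1r scale1r. Qed.

Lemma tcoef0 S : tcoef 0 S = 0.
Proof. by rewrite /tcoef; case: insubP => // S' _ _; rewrite ffunE. Qed.

Definition tlb (f g : tree_lie) : tree_lie :=
  [ffun S : tset => tbr p (tcoef f) (tcoef g) (val S)].

Hypothesis chain_level : forall i j, chain t i = chain t j -> level t i = level t j.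
Hypothesis parent_below : forall i m, p i = Some m -> below t i m.

Lemma tcoef_tlb f g S : tcoef (tlb f g) S = tbr p (tcoef f) (tcoef g) S.
Proof.
rewrite {1}/tcoef; case: insubP => [S' _ <-|nS]; first by rewrite ffunE.
apply/esym; rewrite /tbr big1 // => A _; rewrite big1 // => B _.
rewrite /split2; case: eqP => [SE|_] /=; last by rewrite !mul0r.
case dAB: [disjoint A & B]; last by rewrite !mul0r.
have [HA|HA] := boolP (subtree t A); last by rewrite (tcoef_out _ HA) mul0r mulr0 mul0r.
have [HB|HB] := boolP (subtree t B); last by rewrite (tcoef_out _ HB) mulr0 mulr0 mul0r.
have [->|nE] := eqVneq (edges K p A B) 0; first by rewrite mulr0.
by move: nS; rewrite SE (subtreeU chain_level parent_below HA HB dAB nE).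
Qed.

Lemma tbr_ext (f f' g g' : {set I} -> K) S : f =1 f' -> g =1 g' -> tbr p f g S = tbr p f' g' S.
Proof.
by move=> ff gg; apply: eq_bigr => A _; apply: eq_bigr => B _; rewrite ff gg.
Qed.

Lemma tlb_linearl a (x y z : tree_lie) : tlb (a *: x + y) z = a *: tlb x z + tlb y z.
Proof.
apply: tcoef_inj => S; rewrite tcoefP !tcoef_tlb.
rewrite (tbr_ext _ (tcoefP a x y) (fun=> erefl)) /tbr mulr_sumr -big_split.
apply: eq_bigr => A _; rewrite mulr_sumr -big_split; apply: eq_bigr => B _ /=; ring.
Qed.

Lemma tlb_linearr a (x y z : tree_lie) : tlb x (a *: y + z) = a *: tlb x y + tlb x z.
Proof.
apply: tcoef_inj => S; rewrite tcoefP !tcoef_tlb.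
rewrite (tbr_ext _ (fun=> erefl) (tcoefP a y z)) /tbr mulr_sumr -big_split.
apply: eq_bigr => A _; rewrite mulr_sumr -big_split; apply: eq_bigr => B _ /=; ring.
Qed.

Lemma sum_antisym (T : finType) (F : T -> T -> K) :
  (forall x y, F x y = - F y x) -> (forall x, F x x = 0) -> \sum_x \sum_y F x y = 0.
Proof.
move=> FC F0; pose r (x : T) := enum_rank x : nat.
have E x : \sum_y F x y = \sum_(y | (r x < r y)%N) F x y + \sum_(y | (r y < r x)%N) F x y.
  rewrite (bigID (fun y => (r x < r y)%N)) /=; congr (_ + _).
  rewrite (bigD1 x) ?ltnn //= F0 add0r; apply: eq_bigl => y.
  rewrite -leqNgt ltn_neqAle andbC; congr (_ && _).
  by rewrite -(inj_eq enum_rank_inj) -val_eqE.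
rewrite (eq_bigr _ (fun x _ => E x)) big_split /=.
rewrite [X in _ + X](exchange_big_dep xpredT) //= -big_split big1 // => x _ /=.
rewrite -big_split big1 // => y _ /=; by rewrite [F y x]FC addrN.
Qed.

Lemma tlbxx (x : tree_lie) : tlb x x = 0.
Proof.
apply: tcoef_inj => S; rewrite tcoef0 tcoef_tlb /tbr; apply: sum_antisym => [A B|A].
  rewrite (edgesC K p A B) /split2 setUC disjoint_sym; ring.
by rewrite /edges subrr mulr0.
Qed.

Lemma tlb_jacobi (x y z : tree_lie) :
  tlb x (tlb y z) + tlb y (tlb z x) + tlb z (tlb x y) = 0.
Proof.
apply: tcoef_inj => S; rewrite tcoef0 !tcoefD !tcoef_tlb.
rewrite !(tbr_ext S (fun=> erefl) (tcoef_tlb _ _)).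
exact: tbr_jacobi.
Qed.

End TreeLie.

Section TreeLieAlgebra.
Variables (K : fieldType) (I : finType) (t : forest I).
Variable ok : (forall i j, chain t i = chain t j -> level t i = level t j) *
  (forall i m, parent t i = Some m -> below t i m).
(** The axioms of the forest are arguments of the type, so that the Lie structure
    can be attached to it. *)
Definition tlie of (forall i j, chain t i = chain t j -> level t i = level t j) *
  (forall i m, parent t i = Some m -> below t i m) := tree_lie K t.
Local Notation L := (tlie ok).
HB.instance Definition _ := GRing.Lmodule.on L.
HB.instance Definition _ := Lmodule_isLie.Build K L
  (@tlb_linearl K I t ok.1 ok.2) (@tlb_linearr K I t ok.1 ok.2)
  (@tlbxx K I t ok.1 ok.2) (@tlb_jacobi K I t ok.1 ok.2).

Lemma tcoef_lieb (f g : L) S :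
  tcoef {[f, g]} S = tbr (parent t) (tcoef f) (tcoef g) S.
Proof. exact: tcoef_tlb ok.1 ok.2 f g S. Qed.

Definition tlevel i : set L := fun f =>
  forall S, tcoef f S != 0 -> exists2 x, x \in S & (i <= level t x)%N.

(** Elements of gamma_(k+1)(J_i) have more than k nodes of level i, unless they
    reach a higher level. *)
Definition tcount i k : set L := fun f => forall S, tcoef f S != 0 ->
  (exists2 x, x \in S & (i < level t x)%N) \/
  (k < #|[set x in S | level t x == i]|)%N.

Lemma tlevel_sub i : subspace (tlevel i).
Proof.
split; first by move=> S; rewrite tcoef0 eqxx.
move=> a f g Hf Hg S; rewrite tcoefP => fg.
have [f0|/Hf//] := eqVneq (tcoef f S) 0.
by apply: Hg; rewrite f0 mulr0 add0r in fg.
Qed.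

Lemma tcount_sub i k : subspace (tcount i k).
Proof.
split; first by move=> S; rewrite tcoef0 eqxx.
move=> a f g Hf Hg S; rewrite tcoefP => fg.
have [f0|/Hf//] := eqVneq (tcoef f S) 0.
by apply: Hg; rewrite f0 mulr0 add0r in fg.
Qed.

Lemma tcoef_lieb_neq0 (f g : L) S : tcoef {[f, g]} S != 0 ->
  exists A B, [/\ S = A :|: B, [disjoint A & B], tcoef f A != 0 & tcoef g B != 0].
Proof.
rewrite tcoef_lieb => fg; apply: contrapT => H; move/eqP: fg; apply.
rewrite /tbr big1 // => A _; rewrite big1 // => B _; rewrite /split2.
case: eqP => [SE|_] /=; last by rewrite !mul0r.
case dAB: [disjoint A & B]; last by rewrite !mul0r.
have [->|fA] := eqVneq (tcoef f A) 0; first by rewrite mul0r mulr0 mul0r.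
have [->|gB] := eqVneq (tcoef g B) 0; first by rewrite !mulr0 mul0r.
by case: H; exists A, B.
Qed.

Lemma tlevel_ideal i : lie_ideal (tlevel i).
Proof.
split; first exact: tlevel_sub.
move=> f g Hg S /tcoef_lieb_neq0[A [B [-> _ _ /Hg[x xB lx]]]].
by exists x; rewrite // inE xB orbT.
Qed.

Lemma tcount_lcs i k : (forall f, lcs (tlevel i) k f -> tcount i k f).
Proof.
have J f : tlevel i f -> tcount i 0 f.
  move=> Hf S /Hf[x xS]; rewrite leq_eqVlt => /orP[/eqP ix|ix]; last by left; exists x.
  by right; apply/card_gt0P; exists x; rewrite inE xS ix eqxx.
elim: k => [|k IH] f; first exact: J.
move=> /lin_span_lspan; apply: lspan_min; first exact: tcount_sub.
move=> {f}_ [f [g [/IH Hf /J Hg ->]]] S /tcoef_lieb_neq0[A [B [-> dAB fA gB]]].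
case: (Hf _ fA) => [[x xA lx]|cA]; first by left; exists x; rewrite // inE xA.
case: (Hg _ gB) => [[x xB lx]|cB]; first by left; exists x; rewrite // inE xB orbT.
right; have -> : [set x in A :|: B | level t x == i] =
    [set x in A | level t x == i] :|: [set x in B | level t x == i].
  by apply/setP => x; rewrite !inE andb_orl.
rewrite cardsU disjoint_setI0 ?cards0 ?subn0; last first.
  apply/pred0P => x /=; rewrite !inE; apply/negP => /andP[/andP[xA _] /andP[xB _]].
  by rewrite (disjointFr dAB xA) in xB.
by rewrite -[k.+2]addn1; apply: leq_add.
Qed.

Lemma tcoef_subtree (f : L) S : tcoef f S != 0 -> subtree t S.
Proof. by apply: contraNT => /tcoef_out ->. Qed.

(** J_i is spanned by the trees with root of level at least i. If the root of S
    has level i, then all nodes of S of level i belong to the chain of the root,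
    so that there are at most s_i of them. *)
Theorem tlie_polynilpotent q s : forest_ok t q s -> lie_polynilpotent q s L.
Proof.
move=> [lev_q _ ch_s _]; exists tlevel; split.
- apply/seteqP; split=> // f _ S /tcoef_subtree/subtree_n0/set0Pn[x xS].
  by exists x => //; case/andP: (lev_q x).
- apply/seteqP; split=> f /=; last by move=> ->; have [] := tlevel_sub q.+1.
  move=> Hf; apply: (@tcoef_inj K I t) => S; rewrite tcoef0; apply: contrapT => /eqP /Hf[x _].
  by move=> qx; have /andP[_] := lev_q x; rewrite leqNgt qx.
- by move=> i _; apply: tlevel_ideal.
- by move=> i _ f Hf S /Hf[x xS ix]; exists x => //; apply: ltnW.
move=> i _ f /tcount_lcs Hf S fS; case: (Hf _ fS) => [//|cS].
have /exists_inP[r rS /forall_inP Hr] := tcoef_subtree fS.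
have [lr|lr] := leqP i.+1 (level t r); first by exists r.
have ch x : x \in S -> level t x = i -> chain t x == chain t r.
  move=> xS lx; have /andP[+ _] := Hr _ xS.
  by rewrite /below lx ltnNge -ltnS lr.
have /card_gt0P[x] : (0 < #|[set x in S | level t x == i]|)%N by apply: leq_ltn_trans cS.
rewrite inE => /andP[xS /eqP lx].
have li : level t r = i by rewrite -lx; apply/esym/ok.1/eqP/ch.
suff : (#|[set x in S | level t x == i]| <= s i)%N by rewrite leqNgt cS.
rewrite -{2}li; apply: leq_trans (ch_s r); apply: subset_leq_card.
by apply/subsetP => y; rewrite !inE => /andP[yS /eqP ly]; apply: ch.
Qed.

Definition tnode i : L := [ffun S => (val S == [set i])%:R].

Lemma tcoef_tnode i S : tcoef (tnode i) S = (S == [set i])%:R.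
Proof.
rewrite /tcoef; case: insubP => [S' _ <-|]; first by rewrite ffunE.
by case: eqP => // ->; rewrite subtree1.
Qed.

End TreeLieAlgebra.

(** The Poisson algebra K + L in which the product of any two elements of the
    Lie algebra L is zero. *)
Section UnitalExtension.
Variables (K : fieldType) (L : lieAlgType K).

Definition uext := (K^o * L)%type.
HB.instance Definition _ := GRing.Lmodule.on uext.
Implicit Types x y z : uext.

Definition uone : uext := (1, 0).
Definition umul x y : uext :=
  (x.1 * y.1, (x.1 : K) *: y.2 + (y.1 : K) *: x.2).
Definition ubr x y : uext := (0, {[x.2, y.2]}).

Lemma uextP x y : x.1 = y.1 -> x.2 = y.2 -> x = y.
Proof. by case: x y => [a u] [b v] /= -> ->. Qed.

Lemma umulA : associative umul.
Proof.
move=> x y z; apply: uextP; rewrite /= ?mulrA // !scalerDr !scalerA addrA.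
by rewrite [z.1 * x.1]mulrC [z.1 * y.1]mulrC.
Qed.
Lemma umulC : commutative umul.
Proof. by move=> x y; apply: uextP; rewrite /= 1?mulrC // addrC. Qed.
Lemma umul1 : left_id uone umul.
Proof. by move=> x; apply: uextP; rewrite /= ?mul1r // scaler0 addr0 scale1r. Qed.
Lemma umulDl : left_distributive umul +%R.
Proof.
move=> x y z; apply: uextP; rewrite /= ?mulrDl //.
by rewrite scalerDl scalerDr addrACA.
Qed.
Lemma uone_neq0 : uone != 0.
Proof. by apply/eqP => /(congr1 fst) /eqP; rewrite /= oner_eq0. Qed.

HB.instance Definition _ := GRing.Zmodule_isComNzRing.Build uext
  umulA umulC umul1 umulDl uone_neq0.

Lemma uscaleAl (a : K) x y : a *: (x * y) = (a *: x) * y.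
Proof.
rewrite /GRing.mul /=; apply: uextP => /=; first by rewrite -mulrA.
rewrite scalerDr !scalerA; congr (_ + _); congr (_ *: _); exact: mulrC.
Qed.

HB.instance Definition _ := GRing.Lmodule_isLalgebra.Build K uext uscaleAl.
HB.instance Definition _ := GRing.Lalgebra_isComAlgebra.Build K uext.

Lemma ubr_linearl a x y z : ubr (a *: x + y) z = a *: ubr x z + ubr y z.
Proof. by apply: uextP; rewrite /= ?lieb_linearl // scaler0 addr0. Qed.
Lemma ubr_linearr a x y z : ubr x (a *: y + z) = a *: ubr x y + ubr x z.
Proof. by apply: uextP; rewrite /= ?lieb_linearr // scaler0 addr0. Qed.
Lemma ubrxx x : ubr x x = 0.
Proof. by apply: uextP; rewrite /= ?liebb. Qed.
Lemma ubr_jacobi x y z :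
  ubr x (ubr y z) + ubr y (ubr z x) + ubr z (ubr x y) = 0.
Proof. by apply: uextP; rewrite /= ?jacobi // !addr0. Qed.

HB.instance Definition _ :=
  Lmodule_isLie.Build K uext ubr_linearl ubr_linearr ubrxx ubr_jacobi.

Lemma uext_leibniz (x y z : uext) : {[x * y, z]} = x * {[y, z]} + y * {[x, z]}.
Proof.
apply: uextP => /=; first by rewrite !mulr0 addr0.
by rewrite lieb_linearl lieZl !scale0r !addr0.
Qed.

HB.instance Definition _ := isPoisson.Build K uext uext_leibniz.

(** K is central, so that brackets lie in L; as s_1 > 0, gamma_(s_1 + 1) of the
    extension is that of L. *)
Lemma uext_polynilpotent q s : (1 <= q)%N -> (0 < s 1%N)%N ->
  lie_polynilpotent q s L -> lie_polynilpotent q s (uext : lieAlgType K).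
Proof.
move=> q0 s1 [J [J1 Jq Jid Jsub Jnil]].
pose J' i : set uext := fun x => ((i <= 1)%N \/ x.1 = 0) /\ J i x.2.
have lcsJ i k x : lcs (J' i) k x -> ((i <= 1)%N /\ k = 0%N \/ x.1 = 0) /\ lcs (J i) k x.2.
  elim: k x => [|k IH] x; first by move=> [[i1|x0] Jx]; split; auto.
  move=> /lin_span_lspan; elim=> [|a _ y [u [v [/IH[_ Hu] [_ Hv] ->]]] _ [IH1 IH2]].
    split; first by right.
    by apply: lspan_lin_span; apply: lspan0.
  split; first by right; case: IH1 => [[_ //]|y1]; rewrite /= y1 scaler0 addr0.
  apply: lspan_lin_span; apply: lspanS; first by exists u.2, v.2.
  exact: lin_span_lspan.
exists J'; split.
- by apply/seteqP; split=> // x _; split; [left|rewrite J1].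
- apply/seteqP; split=> x /=.
    by rewrite /J' ltnNge q0 Jq => -[[//|x1] /= x2]; apply: uextP.
  by move=> ->; split; [right|rewrite Jq].
- move=> i /Jid[[J0 JP] Jbr]; split.
    split; first by split; [right|].
    move=> a x y [x1 x2] [y1 y2]; split; last exact: JP.
    by case: x1 => [->|x1]; [left|case: y1 => [->|y1]; [left|right; rewrite /= x1 y1 scaler0 addr0]].
  by move=> x y [_ y2]; split; [right|apply: Jbr].
- move=> i /Jsub Hs x [x1 x2]; split; last exact: Hs.
  by case: x1 => [x1|x1]; [left; apply: ltnW|right].
move=> i iq x /lcsJ[x1 x2]; split; last exact: Jnil x2.
case: x1 => [[i1 s0]|x1]; last by right.
by move: iq s0; case: i i1 {x2} => [|[|]] // _ _ s0; rewrite s0 in s1.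
Qed.
End UnitalExtension.

(** Commutators with letters in the finite set of nodes, for which sets of letters
    are available. *)
Inductive btree (I : Type) : Type := Leaf of I | Node of btree I & btree I.

Fixpoint leaves (I : Type) (c : btree I) : seq I :=
  match c with Leaf i => [:: i] | Node a b => leaves a ++ leaves b end.

Definition lset (I : finType) (c : btree I) : {set I} := [set i in leaves c].

Lemma lset_Leaf (I : finType) (i : I) : lset (Leaf i) = [set i].
Proof. by apply/setP => j; rewrite !inE. Qed.

Lemma lset_Node (I : finType) (a b : btree I) : lset (Node a b) = lset a :|: lset b.
Proof. by apply/setP => j; rewrite !inE mem_cat. Qed.

Lemma uniq_Node (I : finType) (a b : btree I) : uniq (leaves (Node a b)) =
  [&& uniq (leaves a), uniq (leaves b) & [disjoint lset a & lset b]].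
Proof.
rewrite /= cat_uniq; case: uniq => //=; rewrite andbC; congr (_ && _).
rewrite -all_predC disjoint_sym disjoint_subset; apply/allP/subsetP => H x.
  by rewrite !inE => /H.
by move=> xb; have := H x; rewrite !inE; apply.
Qed.

(** The coefficient of e_S in the commutator of the e_i arranged by c. *)
Fixpoint pairing (K : fieldType) (I : finType) (p : I -> option I) (c : btree I) : K :=
  match c with
  | Leaf _ => 1
  | Node a b => pairing K p a * pairing K p b * edges K p (lset a) (lset b)
  end.

Section Evaluation.
Variables (K : fieldType) (I : finType) (t : forest I).
Variable ok : (forall i j, chain t i = chain t j -> level t i = level t j) *
  (forall i m, parent t i = Some m -> below t i m).

Fixpoint lval (c : btree I) : tlie K ok :=
  match c with
  | Leaf i => tnode K ok i
  | Node a b => {[lval a, lval b]}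
  end.

Lemma tcoef_lval c S : uniq (leaves c) ->
  tcoef (lval c) S = (S == lset c)%:R * pairing K (parent t) c.
Proof.
elim: c S => [i|a IHa b IHb] S; first by rewrite lset_Leaf mulr1 /= tcoef_tnode.
rewrite uniq_Node lset_Node => /and3P[/IHa Ha /IHb Hb dab] /=.
rewrite tcoef_lieb /tbr (bigD1 (lset a)) //= [X in _ + X]big1 => [|A /negbTE Aa]; last first.
  by apply: big1 => B _; rewrite Ha Aa !mul0r mulr0 mul0r.
rewrite (bigD1 (lset b)) //= [X in _ + X + _]big1 => [|B /negbTE Bb]; last first.
  by rewrite Hb Bb mul0r !mulr0 mul0r.
rewrite Ha Hb !eqxx /split2 dab andbT !addr0.
by rewrite (_ : true%:R = 1 :> K) // !mul1r -[LHS]mulrA.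
Qed.
End Evaluation.

Fixpoint to_comm N (c : btree 'I_N) : lie_comm :=
  match c with Leaf i => CVar i.+1 | Node a b => CBr (to_comm a) (to_comm b) end.

Lemma comm_vars_to_comm N (c : btree 'I_N) :
  comm_vars (to_comm c) = [seq i.+1 | i : nat <- [seq val i | i <- leaves c]].
Proof. by elim: c => //= a -> b ->; rewrite !map_cat. Qed.

Section CodimLower.
Variables (K : fieldType) (q : nat) (s : nat -> nat).
Hypotheses (q0 : (1 <= q)%N) (s1 : (0 < s 1%N)%N).
Local Notation W := (PN K q s).
Local Notation pr := (rel_proj W).

Lemma flie_ev_to_comm N (L : lieAlgType K) (e : nat -> uext L)
    (br : btree 'I_N -> L) : (forall i : 'I_N, e i.+1 = (0, br (Leaf i))) ->
  (forall a b, br (Node a b) = {[br a, br b]}) ->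
  forall c, flie_ev e (comm_val K (to_comm c)) = (0, br c).
Proof.
move=> He Hbr; elim=> [i|a IHa b IHb] /=; first by rewrite flie_ev_var He.
by rewrite flie_ev_br IHa IHb Hbr.
Qed.

(** Evaluate X_1, ..., X_N at the nodes of a forest, and X_(N+1), ..., X_n at 1. The
    monomial c_a X_(N+1) ... X_n becomes a multiple of the vector e_S of the set S
    of all nodes, and the coefficient vanishes in the b-th forest unless a = b.
    Hence the l monomials are linearly independent modulo the identities. *)
Theorem codim_lower (R : realType) N n l (c : 'I_l -> btree 'I_N) (t : 'I_l -> forest 'I_N) :
  (N <= n)%N -> (forall a, forest_ok (t a) q s) ->
  (forall a, perm_eq (leaves (c a)) (enum 'I_N)) ->
  (forall a b, (pairing K (parent (t b)) (c a) != 0) = (a == b)) ->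
  (l <= codim W n)%N.
Proof.
move=> Nn tok cN pr_tc.
pose tail := [seq CVar j | j <- iota N.+1 (n - N)].
pose m a := to_comm (c a) :: tail.
have m_lin a : multilinear n (m a).
  rewrite /multilinear /m /= comm_vars_to_comm.
  have -> : flatten (map comm_vars tail) = iota N.+1 (n - N).
    by rewrite -map_comp; elim: (iota _ _) => //= j r ->.
  rewrite -{2}(subnKC Nn) iotaD add1n perm_cat2r.
  apply: perm_trans (perm_map _ (perm_map _ (cN a))) _.
  rewrite val_enum_ord -[1%N]addn0 iotaDl.
  by rewrite (eq_map (g := addn 1)).
have [k [w Hw]] := multilinear_span K s R n q0.
apply: (dimension_ge (v := fun a => pr (monomial_val K (m a))) Hw).
  move=> a; exists (monomial_val K (m a)) => //.
  by apply: lspan_lin_span; apply: lspan1; exists (m a); [exact: m_lin|].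
move=> x Hx b.
have ok : (forall i j, chain (t b) i = chain (t b) j -> level (t b) i = level (t b) j) *
  (forall i m, parent (t b) i = Some m -> below (t b) i m).
  by have [_ H1 _ H2] := tok b.
have WA : W (uext (tlie K ok)).
  by apply: uext_polynilpotent => //; apply: tlie_polynilpotent.
pose e (j : nat) : uext (tlie K ok) :=
  if insub j.-1 is Some i then (if (0 < j)%N then (0, tnode K ok i) else 1) else 1.
have e1 j : (N < j)%N -> e j = 1.
  move=> Nj; rewrite /e insubN //; rewrite -leqNgt -ltnS prednK //.
  by apply: leq_ltn_trans Nj.
have ev a : free_ev e (monomial_val K (m a)) = (0, lval K ok (c a)).
  rewrite /monomial_val big_cons free_evM free_ev_gen.
  rewrite (@flie_ev_to_comm N _ e (lval K ok)) //; last first.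
    by move=> i; rewrite /e /= valK.
  have -> : free_ev e (\prod_(c <- tail) (sa_gen (comm_val K c) : freePoisson K)) = 1.
    rewrite /tail big_map; have : all (fun j => N < j)%N (iota N.+1 (n - N)).
      by apply/allP => j; rewrite mem_iota => /andP[].
    elim: (iota _ _) => [|j r IH] /=; first by rewrite big_nil (phom1 (free_ev_hom e)).
    by move=> /andP[Nj /IH{}IH]; rewrite big_cons free_evM IH mulr1 free_ev_gen flie_ev_var e1.
  by rewrite mulr1.
have Id : poisson_identities W (\sum_a x a *: monomial_val K (m a)).
  apply/rel_proj_ker; rewrite -Hx.
  elim/big_rec2: _ => [|a y1 y2 _ <-]; first exact/rel_proj_ker/Id0.
  by rewrite rel_projD rel_projZ.
have := Id _ WA _ (free_ev_hom e).
have -> : free_ev e (\sum_a x a *: monomial_val K (m a)) =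
    \sum_a x a *: (0, lval K ok (c a) : tlie K ok).
  elim/big_rec2: _ => [|a y1 y2 _ <-]; first exact: phom0 (free_ev_hom e).
  by rewrite (phomP (free_ev_hom e)) ev.
move=> /(congr1 (fun u : uext (tlie K ok) => tcoef u.2 [set: 'I_N])).
have -> : tcoef (\sum_a x a *: (0, lval K ok (c a)) : uext (tlie K ok)).2 [set: 'I_N] =
    \sum_a x a * pairing K (parent (t b)) (c a).
  elim/big_rec2: _ => [|a y1 y2 _ <-]; first by rewrite tcoef0.
  have uc : uniq (leaves (c a)) by rewrite (perm_uniq (cN a)) enum_uniq.
  have -> : (x a *: ((0, lval K ok (c a)) : uext (tlie K ok)) + y2).2 = x a *: lval K ok (c a) + y2.2 by [].
  rewrite tcoefP tcoef_lval // (_ : lset _ = [set: 'I_N]) ?eqxx ?mul1r //.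
  by apply/setP => i; rewrite !inE (perm_mem (cN a)) mem_enum.
rewrite tcoef0 (bigD1 b) //= big1 ?addr0 => [|a ab].
  have pb : pairing K (parent (t b)) (c b) != 0 by rewrite pr_tc.
  by move=> /eqP; rewrite mulf_eq0 (negbTE pb) orbF => /eqP.
by have := pr_tc a b; rewrite (negbTE ab) => /negbFE/eqP->; rewrite mulr0.
Qed.
End CodimLower.

(** * Dual systems of commutators and trees *)

Section Grafting.
Variables (K : fieldType) (I : finType).
Implicit Types (p : I -> option I) (c d : btree I) (A B S X Y : {set I}).
Local Notation edges := (edges K).
Local Notation pairing := (pairing K).

(** Commutators are built by grafting, as trees are by hanging a tree below a
    node; [pairing_graft] compares the two. *)
Fixpoint graft c h d :=
  match c with
  | Leaf i => if i == h then Node (Leaf i) d else Leaf i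
  | Node a b => Node (graft a h d) (graft b h d)
  end.

Lemma graft_notin c h d : h \notin leaves c -> graft c h d = c.
Proof.
elim: c => [i|a IHa b IHb] /=; first by rewrite inE eq_sym => /negbTE->.
by rewrite mem_cat negb_or => /andP[/IHa-> /IHb->].
Qed.

Lemma perm_graft c h d : uniq (leaves c) -> h \in leaves c ->
  perm_eq (leaves (graft c h d)) (leaves c ++ leaves d).
Proof.
elim: c => [i|a IHa b IHb] /=; first by rewrite inE => _ /eqP->; rewrite eqxx.
rewrite cat_uniq => /and3P[ua /hasPn dab ub]; rewrite mem_cat => /orP[ha|hb].
  have hb : h \notin leaves b by apply/negP => /dab; rewrite ha.
  rewrite (graft_notin _ hb).
  apply: perm_trans (perm_cat (IHa ua ha) (perm_refl _)) _.
  by rewrite -!catA perm_cat2l perm_catC.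
rewrite (graft_notin _ (dab _ hb)) -catA perm_cat2l.
exact: IHb.
Qed.

Lemma lset_graft c h d : h \in leaves c -> lset (graft c h d) = lset c :|: lset d.
Proof.
elim: c => [i|a IHa b IHb] /=.
  by rewrite inE => /eqP->; rewrite eqxx lset_Node.
rewrite mem_cat !lset_Node => /orP[ha|hb].
  rewrite IHa //; have [hb|/graft_notin->] := boolP (h \in leaves b).
    by rewrite IHb // setUACA setUid.
  by rewrite setUAC.
rewrite IHb //; have [ha|/graft_notin->] := boolP (h \in leaves a).
  by rewrite IHa // setUACA setUid.
by rewrite setUA.
Qed.

Lemma intoE p x A : into p x A = [exists y in A, p x == Some y].
Proof.
rewrite /into; case: (p x) => [m|]; last by apply/esym/negbTE/exists_inPn.
apply/idP/exists_inP => [mA|[y yA /eqP[->]] //]; by exists m.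
Qed.

Lemma edges_eq0 p A B :
  (forall x y, x \in A -> y \in B -> p x != Some y /\ p y != Some x) -> edges p A B = 0.
Proof.
move=> H; rewrite /edges !big1 ?subrr // => x xS; rewrite intoE; case: exists_inP => // -[y yS pxy].
  by have [] := H _ _ xS yS; rewrite pxy.
by have [] := H _ _ yS xS; rewrite pxy.
Qed.

Lemma edges1_neq0 p h A : edges p [set h] A != 0 ->
  exists2 y, y \in A & p h = Some y \/ p y = Some h.
Proof.
move=> E; apply: contrapT => H; move/eqP: E; apply; apply: edges_eq0 => x y /set1P-> yA.
by split; apply/eqP => E; apply: H; exists y => //; [left|right].
Qed.

Lemma pairing_ext p p' c :
  (forall x y, x \in lset c -> y \in lset c -> (p x == Some y) = (p' x == Some y)) ->
  pairing p c = pairing p' c.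
Proof.
elim: c => //= a IHa b IHb; rewrite lset_Node => H.
have E A B x : x \in A -> A \subset lset a :|: lset b -> B \subset lset a :|: lset b ->
    into p x B = into p' x B.
  move=> xA /subsetP sA /subsetP sB; rewrite !intoE; apply: eq_existsb_in => y yB.
  by apply: H; [apply: sA|apply: sB].
rewrite IHa; last by move=> x y xa ya; apply: H; rewrite inE ?xa ?ya.
rewrite IHb; last by move=> x y xa ya; apply: H; rewrite inE ?xa ?ya orbT.
congr (_ * _); rewrite /edges.
by congr (_ - _); apply: eq_bigr => x xa; rewrite (E _ _ _ xa) ?subsetUl ?subsetUr.
Qed.

(** A commutator that is nonzero in a tree has a connected set of letters. *)
Lemma pairing_connected p X Y c : 
  (forall x y, x \in X -> y \in Y -> p x != Some y /\ p y != Some x) ->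
  lset c \subset X :|: Y -> pairing p c != 0 -> (lset c \subset X) || (lset c \subset Y).
Proof.
move=> XY; elim: c => [i|a IHa b IHb] /=.
  by rewrite lset_Leaf !sub1set inE.
rewrite lset_Node subUset => /andP[/IHa Ha /IHb Hb].
rewrite !mulf_eq0 !negb_or => /andP[/andP[/Ha{}Ha /Hb{}Hb]].
rewrite !subUset; case/orP: Ha => Ha; case/orP: Hb => Hb; rewrite ?Ha ?Hb ?orbT // => /eqP[].
  by apply: edges_eq0 => x y xa yb; apply: XY; [apply: (subsetP Ha)|apply: (subsetP Hb)].
apply: edges_eq0 => x y xa yb.
by have [] := XY _ _ (subsetP Hb _ yb) (subsetP Ha _ xa).
Qed.

Lemma pairing_graft_neq0 p c h d : h \in leaves c -> pairing p (graft c h d) != 0 ->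
  edges p [set h] (lset d) != 0 /\ pairing p d != 0.
Proof.
elim: c => [i|a IHa b IHb] /=.
  rewrite inE => /eqP->; rewrite eqxx /= lset_Leaf mul1r mulf_eq0 negb_or.
  by case/andP.
rewrite mem_cat !mulf_eq0 !negb_or => ab /andP[/andP[Ha Hb] _].
by case/orP: ab => [/IHa|/IHb]; apply.
Qed.

(** If h is the only letter of c that is adjacent to d, the brackets of c are not
    affected by the additional letters of d. *)
Lemma pairing_graft p c h d : uniq (leaves c) -> h \in leaves c ->
  [disjoint lset c & lset d] ->
  (forall x y, x \in lset d -> y \in lset c -> y != h -> p x != Some y /\ p y != Some x) ->
  pairing p (graft c h d) = pairing p c * edges p [set h] (lset d) * pairing p d.
Proof.
elim: c => [i|a IHa b IHb] /=.
  by rewrite inE => _ /eqP-> _ _; rewrite eqxx /= lset_Leaf; ring.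
rewrite lset_Node -[_ ++ _]/(leaves (Node a b)) uniq_Node => /and3P[ua ub dab].
rewrite disjUl => hab /andP[dad dbd] H.
have E A : A \subset lset a :|: lset b -> h \notin A -> edges p (lset d) A = 0.
  move=> /subsetP sA hA; apply: edges_eq0 => x y xd yA; apply: H => //.
    by rewrite inE; have := sA _ yA; rewrite inE.
  by apply: contraNneq hA => <-.
move: hab; rewrite /= mem_cat => /orP[ha|hb].
  have hb : h \notin lset b by rewrite (disjointFr dab) // inE.
  rewrite (@graft_notin b) ?lset_graft //; last by rewrite inE in hb.
  rewrite edges_setUl // E ?subsetUr // addr0 IHa //; first by ring.
  by move=> x y xd ya; apply: H => //; rewrite inE ya.
have ha : h \notin lset a by rewrite (disjointFl dab) // inE.
rewrite (@graft_notin a) ?lset_graft //; last by rewrite inE in ha.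
rewrite edges_setUr // [edges p _ (lset d)]edgesC E ?subsetUl // subr0 IHb //; first by ring.
by move=> x y xd ya; apply: H => //; rewrite inE ya orbT.
Qed.
End Grafting.

Section Families.
Variables (K : fieldType) (I : finType) (s : nat -> nat).
Implicit Types (c : btree I) (t : forest I) (S A H R : {set I}).

Definition dual (T : eqType) (c : T -> btree I) (p : T -> I -> option I) :=
  forall a b, (pairing K (p b) (c a) != 0) = (a == b).

Lemma dual_ord (T : finType) (c : T -> btree I) (t : T -> forest I)
    (P : btree I -> forest I -> Prop) :
  (forall a, P (c a) (t a)) -> dual c (fun a => parent (t a)) ->
  exists (c' : 'I_#|T| -> btree I) (t' : 'I_#|T| -> forest I),
    (forall a, P (c' a) (t' a)) /\ dual c' (fun a => parent (t' a)).
Proof.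
move=> HP Hd; exists (c \o enum_val), (t \o enum_val); split=> [a|a b]; first exact: HP.
by rewrite Hd (inj_eq enum_val_inj).
Qed.

(** Paths ending at x0, with the left-normed commutators starting at x0; the next
    node x1 of the path is the only neighbour of x0, which determines x1 from
    the commutator, and induction applies to the rest. *)
Lemma path_family m S x0 : x0 \in S -> #|S| = m.+1 ->
  exists (c : 'I_m`! -> btree I) (p : 'I_m`! -> I -> option I),
  [/\ forall a, perm_eq (leaves (c a)) (enum S), forall a, p a x0 = None,
      forall a x, x \in S -> x != x0 -> exists2 y, y \in S & p a x = Some y & dual c p].
Proof.
elim: m S x0 => [|m IH] S x0 x0S cS.
  have -> : S = [set x0].
    by apply/esym/eqP; rewrite eqEcard sub1set x0S cS cards1.
  exists (fun _ => Leaf x0), (fun _ _ => None); split=> //=.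
  - by move=> _; rewrite enum_set1.
  - by move=> _ x; rewrite inE => ->.
  by move=> a b; rewrite oner_eq0 (ord1 a) (ord1 b) eqxx.
pose S' := S :\ x0.
have cS' : #|S'| = m.+1 by have := cardsD1 x0 S; rewrite x0S cS => -[].
have /choice[G HG] : forall x1, exists cp : ('I_m`! -> btree I) * ('I_m`! -> I -> option I),
    x1 \in S' -> [/\ forall a, perm_eq (leaves (cp.1 a)) (enum S'), forall a, cp.2 a x1 = None,
      forall a x, x \in S' -> x != x1 -> exists2 y, y \in S' & cp.2 a x = Some y &
      dual cp.1 cp.2].
  move=> x1; have [x1S|nx] := boolP (x1 \in S'); last first.
    by exists (fun _ => Leaf x0, fun _ _ => None).
  by have [c [p H]] := IH _ _ x1S cS'; exists (c, p).
pose T : finType := ({x | x \in S'} * 'I_m`!)%type.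
pose c (a : T) := graft ((G (val a.1)).1 a.2) (val a.1) (Leaf x0).
pose p (a : T) x :=
  if x == x0 then None else if x == val a.1 then Some x0 else (G (val a.1)).2 a.2 x.
have cT : #|T| = (m.+1)`! by rewrite card_prod card_sig card_ord factS cS'.
have S'S x : x \in S' -> x \in S by rewrite inE => /andP[].
have x1n (a : T) : val a.1 != x0 by have := valP a.1; rewrite !inE => /andP[].
have lsetG (a : T) : lset ((G (val a.1)).1 a.2) = S'.
  have [H _ _ _] := HG _ (valP a.1).
  by apply/setP => x; rewrite inE (perm_mem (H a.2)) mem_enum.
have memG (a : T) : val a.1 \in leaves ((G (val a.1)).1 a.2).
  by have /setP/(_ (val a.1)) := lsetG a; rewrite inE (valP a.1).
have uniqG (a : T) : uniq (leaves ((G (val a.1)).1 a.2)).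
  by have [H _ _ _] := HG _ (valP a.1); rewrite (perm_uniq (H a.2)) enum_uniq.
have pS a x : x \in S -> x != x0 -> exists2 y, y \in S & p a x = Some y.
  move=> xS nx; rewrite /p (negbTE nx); case: (eqVneq x (val a.1)) => [_|nx1]; first by exists x0.
  have [_ _ H _] := HG _ (valP a.1).
  have xS' : x \in S' by rewrite !inE nx.
  by have [y yS' ->] := H a.2 _ xS' nx1; exists y => //; apply: S'S.
have px0 (b : T) x : p b x = Some x0 -> x \in S -> x = val b.1.
  rewrite /p; case: eqP => // /eqP nx; case: eqVneq => // nx1 pE xS.
  have [_ _ H _] := HG _ (valP b.1).
  have xS' : x \in S' by rewrite !inE nx.
  by have [y + E] := H b.2 _ xS' nx1; move: E; rewrite pE => -[<-]; rewrite !inE eqxx.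
have pairE (a b : T) : val a.1 = val b.1 -> pairing K (p b) (c a) =
    pairing K ((G (val b.1)).2 b.2) ((G (val a.1)).1 a.2) * -1.
  move=> ab; rewrite /c (pairing_graft _ (uniqG a) (memG a)) ?lset_Leaf ?lsetG //=; last 2 first.
  - by rewrite disjoint_sym disjoints1 !inE eqxx.
  - move=> x y /set1P-> yS' ya; rewrite {1}/p eqxx; split=> //; apply/eqP => /px0.
    by move=> /(_ (S'S _ yS')) yb; rewrite ab yb eqxx in ya.
  rewrite mulr1; congr (_ * _).
    apply: pairing_ext => x y; rewrite lsetG => xS' yS'.
    have nx : x != x0 by move: xS'; rewrite !inE => /andP[].
    rewrite /p (negbTE nx); case: (eqVneq x (val b.1)) => // ->.
    have [_ -> _ _] := HG _ (valP b.1); apply/negbTE/eqP => -[E].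
    by move: yS'; rewrite -E !inE eqxx.
  rewrite /edges !big_set1 !intoE.
  have -> : [exists y in [set val a.1], p b x0 == Some y] = false.
    by apply/exists_inP => -[y _]; rewrite /p eqxx.
  have -> : [exists y in [set x0], p b (val a.1) == Some y].
    by apply/exists_inP; exists x0; rewrite ?inE // /p ab eqxx (negbTE (x1n b)).
  by rewrite sub0r.
have dcp : dual c p.
  move=> a b; apply/idP/eqP => [H|->]; last first.
    rewrite pairE // mulrN1 oppr_eq0.
    by have [_ _ _ ->] := HG _ (valP b.1).
  have ab : val a.1 = val b.1.
    have [/edges1_neq0[y + +] _] := pairing_graft_neq0 (memG a) H.
    rewrite lset_Leaf => /set1P-> []; last by rewrite /p eqxx.
    by move=> /px0; apply; apply: S'S; apply: valP.
  move: H; rewrite pairE // mulrN1 oppr_eq0 => H.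
  case: a b ab H => [[x1 hx] a] [[x2 hx2] b] /= E; subst x2.
  have [_ _ _ ->] := HG _ hx; move=> /eqP->.
  by congr (Sub _ _, _); apply: bool_irrelevance.
rewrite -cT; exists (c \o enum_val), (p \o enum_val); split.
- move=> a; rewrite /= /c; set x := enum_val a.
  apply: perm_trans (perm_graft _ (uniqG _) (memG _)) _.
  have [H _ _ _] := HG _ (valP x.1).
  apply: perm_trans (perm_cat (H _) (perm_refl _)) _.
  apply: uniq_perm; rewrite ?enum_uniq // ?cat_uniq ?enum_uniq /= ?andbT.
    by rewrite orbF mem_enum !inE eqxx.
  move=> y; rewrite mem_cat !mem_enum !inE; case: eqP => [->|] //=; last by rewrite orbF.
- by move=> a; rewrite /= /p eqxx.
- by move=> a x; apply: pS.
by move=> a b; rewrite /= dcp (inj_eq enum_val_inj).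
Qed.

(** Forests are total functions on I, of which only the values on S matter. Chains
    are named by nodes of S, so that disjoint trees have disjoint chains. *)
Record tree_on (i : nat) S r c t : Prop := TreeOn {
  to_root : r \in S;
  to_leaves : perm_eq (leaves c) (enum S);
  to_rootp : parent t r = None;
  to_parent : forall x, x \in S -> x != r ->
    exists y, [/\ y \in S, parent t x = Some y & below t x y];
  to_level : forall x, x \in S -> (1 <= level t x <= i)%N;
  to_chain : forall x, x \in S -> chain t x \in S;
  to_chain_level : forall x y, x \in S -> y \in S -> chain t x = chain t y ->
    level t x = level t y;
  to_card : forall x, x \in S ->
    (#|[set y in S | chain t y == chain t x]| <= s (level t x))%N
}.

Definition tree_system i d l := forall S, #|S| = d ->
  exists (c : 'I_l -> btree I) (t : 'I_l -> forest I),
    (forall a, exists r, tree_on i S r (c a) (t a)) /\ dual c (fun a => parent (t a)).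

Lemma path_system i S r : (1 <= i)%N -> r \in S -> (#|S| <= s i)%N ->
  exists (c : 'I_(#|S|.-1)`! -> btree I) (t : 'I_(#|S|.-1)`! -> forest I),
  (forall a, tree_on i S r (c a) (t a) /\ forall x, x \in S -> level (t a) x = i) /\
  dual c (fun a => parent (t a)).
Proof.
move=> i1 rS cS; have S1 : #|S| = #|S|.-1.+1 by rewrite (cardsD1 r S) rS.
have [c [p [Hc Hr Hp Hd]]] := path_family rS S1.
exists c, (fun a => Forest (p a) (fun=> i) (fun=> r)); split=> // a; split=> //.
split=> //=.
- by move=> x xS xr; have [y yS E] := Hp a _ xS xr; exists y; rewrite /below /= eqxx orbT.
- by move=> x xS; rewrite i1 leqnn.
by move=> x xS; apply: leq_trans cS; apply: subset_leq_card; apply/subsetP => y; rewrite inE => /andP[].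
Qed.
End Families.

(** The number of ways to partition k d letters into k blocks of size d, the block
    of a chosen letter being built first, with one of l structures on each block
    and a place among h heads for it. *)
Fixpoint block_count (h d l k : nat) : nat :=
  if k is k'.+1 then
    'C((k * d).-1, d.-1) * (l * (h * block_count h d l k'))
  else 1.

Lemma card_draws1 (I : finType) (R : {set I}) x d : x \in R -> (0 < d)%N ->
  #|[set A : {set I} | [&& A \subset R, x \in A & #|A| == d]]| = 'C(#|R|.-1, d.-1).
Proof.
move=> xR d0; have -> : #|R|.-1 = #|R :\ x| by rewrite (cardsD1 x R) xR.
rewrite -cards_draws -[RHS](card_in_imset (f := fun B => x |: B)); last first.
  move=> B B'; rewrite !inE !subsetD1 => /andP[/andP[_ xB] _] /andP[/andP[_ xB'] _] E.
  by rewrite -(setU1K xB) E setU1K.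
apply: eq_card => A; rewrite inE; apply/and3P/imsetP => [[AR xA /eqP cA]|[B]].
  exists (A :\ x); last by rewrite setD1K.
  by rewrite inE setSD //= -(eqn_add2l (x \in A)) -cardsD1 cA xA add1n prednK.
rewrite inE subsetD1 => /andP[/andP[BR xB] /eqP cB] ->; split.
- by rewrite subUset sub1set xR.
- by rewrite setU11.
by rewrite cardsU1 xB cB add1n prednK.
Qed.

Section BlockStep.
Variables (K : fieldType) (I : finType) (s : nat -> nat) (i d l : nat).
Hypotheses (sys : @tree_system K I s i d l) (d0 : (0 < d)%N).
Implicit Types (c : btree I) (t : forest I) (S A H R : {set I}).

(** The root of t2, the only node of A without parent, is hung below h. *)
Definition join_forest A h t2 t' : forest I := Forest
  (fun x => if x \in A then Some (odflt h (parent t2 x)) else parent t' x)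
  (fun x => if x \in A then level t2 x else level t' x)
  (fun x => if x \in A then chain t2 x else chain t' x).

(** The trees on H u R whose nodes at the top level are those of H. *)
Definition headed_on H R r c t :=
  [/\ tree_on s i.+1 (H :|: R) r c t,
      forall x, x \in H -> level t x = i.+1 &
      forall x y, x \in H -> y \in R -> parent t x != Some y].

Lemma lset_on j S r c t : tree_on s j S r c t -> lset c = S.
Proof. by move=> [_ H _ _ _ _ _ _]; apply/setP => x; rewrite inE (perm_mem H) mem_enum. Qed.

Lemma uniq_on j S r c t : tree_on s j S r c t -> uniq (leaves c).
Proof. by move=> [_ H _ _ _ _ _ _]; rewrite (perm_uniq H) enum_uniq. Qed.

Lemma headed_join H R r A h r2 c2 t2 c' t' : r \in H -> [disjoint H & R] -> A \subset R ->
  h \in H -> tree_on s i A r2 c2 t2 -> headed_on H (R :\: A) r c' t' ->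
  headed_on H R r (graft c' h c2) (join_forest A h t2 t').
Proof.
move=> rH dHR AR hH T2 [T' lH pH].
have HA x : x \in H -> x \in A = false.
  by move=> xH; apply/negP => /(subsetP AR) xR; rewrite (disjointFr dHR xH) in xR.
have inS x : x \in H :|: R -> x \notin A -> x \in H :|: R :\: A.
  by rewrite !inE => + nA; rewrite nA.
have Sin x : x \in H :|: R :\: A -> (x \in H :|: R) * (x \in A = false).
  by rewrite !inE => /orP[xH|/andP[/negbTE-> ->]]; rewrite ?xH ?HA ?orbT.
have Ain x : x \in A -> x \in H :|: R by move=> /(subsetP AR); rewrite inE orbC => ->.
have lS := lset_on T'; have lA := lset_on T2.
have hc : h \in leaves c' by have /setP/(_ h) := lS; rewrite !inE hH.
split; last first.
- move=> x y xH yR; rewrite /= HA //; have [yA|nA] := boolP (y \in A); last first.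
    by apply: pH; rewrite ?inE ?nA.
  have [->|nx] := eqVneq x r; first by rewrite (to_rootp T').
  have [|m [/Sin[_ mA] -> _]] := to_parent T' (x := x) _ nx; first by rewrite inE xH.
  by apply/eqP => -[E]; rewrite E yA in mA.
- by move=> x xH; rewrite /= HA // lH.
split.
- by rewrite inE rH.
- apply: perm_trans (perm_graft _ (uniq_on T') hc) _.
  apply: perm_trans (perm_cat (to_leaves T') (to_leaves T2)) _.
  apply: uniq_perm; rewrite ?enum_uniq ?cat_uniq ?enum_uniq ?andbT //=.
    by apply/hasPn => x; rewrite !mem_enum => xA; apply/negP => /Sin[_]; rewrite xA.
  move=> x; rewrite mem_cat !mem_enum; have [xA|nA] := boolP (x \in A).
    by rewrite orbT Ain.
  by rewrite orbF; apply/idP/idP => [/Sin[]//|xS]; apply: inS.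
- by rewrite /= HA // (to_rootp T').
- move=> x xS xr; have [xA|nA] := boolP (x \in A); rewrite /= ?xA ?(negbTE nA).
    have [->|xr2] := eqVneq x r2.
      exists h; rewrite (to_rootp T2) inE hH; split=> //.
      by rewrite /below /= (HA h hH) (to_root T2) lH // ltnS; have /andP[_ ->] := to_level T2 (to_root T2).
    have [y [yA E]] := to_parent T2 xA xr2; rewrite E; exists y; split=> //; first exact: Ain.
    by rewrite /below /= xA yA.
  have [y [yA -> b]] := to_parent T' (inS _ xS nA) xr; have [yS ny] := Sin _ yA.
  by exists y; split=> //; rewrite /below /= (negbTE nA) ny.
- move=> x xS /=; case: ifPn => xA; last by apply: (to_level T'); apply: inS.
  by have /andP[-> H2] := to_level T2 xA; apply: leq_trans H2 _.
- move=> x xS /=; case: ifPn => xA; first exact/Ain/(to_chain T2).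
  by have [] := Sin _ (to_chain T' (inS _ xS xA)).
- move=> x y xS yS /=; case: ifPn => xA; case: ifPn => yA E.
  + exact: (to_chain_level T2).
  + have [_] := Sin _ (to_chain T' (inS _ yS yA)).
    by rewrite -E (to_chain T2).
  + have [_] := Sin _ (to_chain T' (inS _ xS xA)).
    by rewrite E (to_chain T2).
  by apply: (to_chain_level T') => //; apply: inS.
move=> x xS /=; case: ifPn => xA.
  apply: leq_trans (to_card T2 xA); apply: subset_leq_card; apply/subsetP => y.
  rewrite !inE => /andP[yS]; case: ifPn => [yA ->//|nA /eqP E].
  have yS' : y \in H :|: R by rewrite inE.
  have [_] := Sin _ (to_chain T' (inS _ yS' nA)).
  by rewrite E (to_chain T2).
apply: leq_trans (to_card T' (inS _ xS xA)); apply: subset_leq_card; apply/subsetP => y.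
rewrite inE => /andP[yS]; case: ifPn => [yA /eqP E|nA E].
  have [_] := Sin _ (to_chain T' (inS _ xS xA)).
  by rewrite -E (to_chain T2).
by rewrite inE E andbT; apply: inS.
Qed.

(** The only edge between the new block A and the other nodes joins the root of A
    to the head h. *)
Lemma pairing_headed_join H R r A h r2 c2 t2 c' t' h1 c1 c1' : r \in H -> [disjoint H & R] ->
  A \subset R -> h \in H -> tree_on s i A r2 c2 t2 -> headed_on H (R :\: A) r c' t' ->
  h1 \in H -> lset c1 = A -> uniq (leaves c1') -> lset c1' = H :|: R :\: A ->
  pairing K (parent (join_forest A h t2 t')) (graft c1' h1 c1) =
  pairing K (parent t') c1' * (h1 == h)%:R * pairing K (parent t2) c1.
Proof.
move=> rH dHR AR hH T2 [T' lH pH] h1H lc1 u1 lc1'.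
have HA x : x \in H -> x \in A = false.
  by move=> xH; apply/negP => /(subsetP AR) xR; rewrite (disjointFr dHR xH) in xR.
have Sin x : x \in H :|: R :\: A -> (x \in A = false).
  by rewrite !inE => /orP[xH|/andP[/negbTE-> _]]; rewrite ?HA.
have pS x y : x \in H :|: R :\: A -> parent t' x = Some y -> y \in H :|: R :\: A.
  move=> xS; have [->|nx] := eqVneq x r; first by rewrite (to_rootp T').
  by have [z [zS -> _]] := to_parent T' xS nx => -[<-].
have pA x y : x \in A -> parent t2 x = Some y -> y \in A.
  move=> xA; have [->|nx] := eqVneq x r2; first by rewrite (to_rootp T2).
  by have [z [zS -> _]] := to_parent T2 xA nx => -[<-].
have out x y : x \in A -> y \notin A -> Some (odflt h (parent t2 x)) = Some y -> y = h.
  move=> xA yA [E]; case pE: (parent t2 x) E => [z|] //= E.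
  by rewrite -E (pA _ _ xA pE) in yA.
have h1A := HA _ h1H.
have h1c : h1 \in leaves c1' by have /setP/(_ h1) := lc1'; rewrite !inE h1H.
have e_h1 : edges K (parent (join_forest A h t2 t')) [set h1] A = (h1 == h)%:R.
  rewrite /edges big_set1 intoE /= h1A.
  have -> : [exists y in A, parent t' h1 == Some y] = false.
    apply/exists_inP => -[y yA /eqP /pS]; rewrite inE h1H => /(_ isT) /Sin.
    by rewrite yA.
  rewrite subr0 (bigD1 r2) ?(to_root T2) //= big1 => [|x /andP[xA xr]].
    rewrite addr0 intoE /= (to_root T2) (to_rootp T2) /=; congr (nat_of_bool _)%:R.
    by apply/exists_inP/eqP => [[y /set1P-> /eqP[]]|<-] //; exists h1; rewrite ?inE.
  rewrite intoE /= xA; case: exists_inP => // -[y /set1P-> /eqP[]].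
  have [z [zA -> _]] := to_parent T2 xA xr => /= E.
  by rewrite -E zA in h1A.
have [E|h1h] := eqVneq h1 h; last first.
  rewrite mulr0 mul0r; apply/eqP; apply/negPn/negP => /(pairing_graft_neq0 h1c)[].
  by rewrite lc1 e_h1 (negbTE h1h) eqxx.
subst h1; rewrite eqxx in e_h1.
rewrite (pairing_graft _ u1 h1c) lc1 ?lc1'; last 2 first.
- by apply/pred0P => x /=; apply/negP => /andP[/Sin->].
- move=> x y xA yS yh; have yA := Sin _ yS; rewrite /= xA yA; split.
    by apply/eqP => /(out _ _ xA (negbT yA)) E; rewrite E eqxx in yh.
  by apply/eqP => /(pS _ _ yS) /Sin; rewrite xA.
rewrite e_h1; congr (_ * _ * _); apply: pairing_ext => x y; rewrite ?lc1 ?lc1'.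
  by move=> /Sin /= ->.
move=> /= xA yA; rewrite xA; case pE: (parent t2 x) => [z|] //=.
by apply/eqP => -[E]; rewrite E yA in h1A.
Qed.

(** The heads form a path at level i + 1. In each step the block A of a chosen
    letter x of R is split off, and a tree on A is hung below one of the heads.
    If the commutator of a is nonzero in the forest of b, then its part on the
    block of a is connected, lies in the block of b because both contain x, and
    therefore equals it; the factor of the block, the head and the rest are then
    determined in turn. *)
Lemma headed_family k H R r : r \in H -> (0 < #|H| <= s i.+1)%N -> [disjoint H & R] ->
  #|R| = (k * d)%N ->
  exists (c : 'I_(block_count #|H| d l k) -> btree I)
    (t : 'I_(block_count #|H| d l k) -> forest I),
  (forall a, headed_on H R r (c a) (t a)) /\ dual K c (fun a => parent (t a)).
Proof.
move=> rH /andP[H0 Hs]; elim: k R => [|k IH] R dHR cR.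
  have -> : R = set0 by apply/eqP; rewrite -cards_eq0 cR.
  have [c [t [Hct Hd]]] := path_system K (ltn0Sn i) rH Hs.
  pose a0 : 'I_(#|H|.-1)`! := Ordinal (fact_gt0 _).
  exists (fun=> c a0), (fun=> t a0); split.
    move=> _; have [T lT] := Hct a0; split; rewrite ?setU0 // => x y _.
    by rewrite inE.
  by move=> a b; rewrite Hd eqxx (ord1 a) (ord1 b) eqxx.
have [x xR] : exists x, x \in R by apply/card_gt0P; rewrite cR mulSn addn_gt0 d0.
pose AA := [set A : {set I} | [&& A \subset R, x \in A & #|A| == d]].
have cAA : #|AA| = 'C((k.+1 * d).-1, d.-1) by rewrite card_draws1 // cR.
set e := block_count #|H| d l k in IH *.
pose dft : forest I := Forest (fun=> None) (fun=> 0%N) (fun=> r).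
have /choice[G HG] : forall A, exists ct : ('I_l -> btree I) * ('I_l -> forest I),
    #|A| = d -> (forall a, exists r, tree_on s i A r (ct.1 a) (ct.2 a)) /\
      dual K ct.1 (fun a => parent (ct.2 a)).
  move=> A; have [/sys[c [t Hct]]|nA] := pselect (#|A| = d); first by exists (c, t).
  by exists (fun=> Leaf r, fun=> dft).
have /choice[G' HG'] : forall A, exists ct : ('I_e -> btree I) * ('I_e -> forest I),
    A \in AA -> (forall a, headed_on H (R :\: A) r (ct.1 a) (ct.2 a)) /\
      dual K ct.1 (fun a => parent (ct.2 a)).
  move=> A; have [|nA] := boolP (A \in AA); last by exists (fun=> Leaf r, fun=> dft).
  rewrite inE => /and3P[AR _ /eqP cA].
  have [] := IH (R :\: A).
  - by apply: disjointWr dHR; apply: subsetDl.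
  - by rewrite cardsD (setIidPr AR) cR cA mulSn addKn.
  by move=> c [t Hct]; exists (c, t).
pose T : finType := ({A | A \in AA} * ('I_l * ({h | h \in H} * 'I_e)))%type.
have cT : #|T| = block_count #|H| d l k.+1.
  by rewrite !card_prod !card_sig !card_ord cAA.
pose c (a : T) := graft ((G' (val a.1)).1 a.2.2.2) (val a.2.2.1) ((G (val a.1)).1 a.2.1).
pose t (a : T) := join_forest (val a.1) (val a.2.2.1)
  ((G (val a.1)).2 a.2.1) ((G' (val a.1)).2 a.2.2.2).
have inAA (a : T) : [/\ val a.1 \in AA, val a.1 \subset R, x \in val a.1 & #|val a.1| = d].
  have aA : val a.1 \in AA := valP a.1.
  have : [&& val a.1 \subset R, x \in val a.1 & #|val a.1| == d].
    by move: (aA); rewrite inE.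
  by move=> /and3P[? ? /eqP ?]; split.
have TG A a : #|A| = d -> exists r, tree_on s i A r ((G A).1 a) ((G A).2 a).
  by move=> /HG[].
have TG' A a : A \in AA -> headed_on H (R :\: A) r ((G' A).1 a) ((G' A).2 a).
  by move=> /HG'[].
have Hct a : headed_on H R r (c a) (t a).
  have [aA AR _ cA] := inAA a; have [r2 Tr] := TG _ a.2.1 cA.
  by apply: headed_join Tr (TG' _ _ aA) => //; apply: valP.
have dct : dual K c (fun a => parent (t a)).
  move=> a b; have [aA AR xA cA] := inAA a; have [bA BR xB cB] := inAA b.
  have [r2 Ta] := TG _ a.2.1 cA; have [r3 Tb] := TG _ b.2.1 cB.
  have [Ta' _ _] := TG' _ a.2.2.2 aA; have Tb' := TG' _ b.2.2.2 bA.
  have E : val a.1 = val b.1 -> pairing K (parent (t b)) (c a) =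
      pairing K (parent ((G' (val b.1)).2 b.2.2.2)) ((G' (val a.1)).1 a.2.2.2) *
      (val a.2.2.1 == val b.2.2.1)%:R *
      pairing K (parent ((G (val b.1)).2 b.2.1)) ((G (val a.1)).1 a.2.1).
    move=> ab; apply: pairing_headed_join Tb Tb' _ _ _ _ => //; try exact: valP.
    - by rewrite (lset_on Ta).
    - exact: uniq_on Ta'.
    by rewrite (lset_on Ta') ab.
  apply/idP/eqP => [Hp|ab]; last first.
    rewrite E ab // eqxx mulr1 mulf_neq0 //.
      by have [_ ->] := HG' _ bA.
    by have [_ ->] := HG _ cB.
  have ab : val a.1 = val b.1.
    have hc : val a.2.2.1 \in leaves ((G' (val a.1)).1 a.2.2.2).
      have /setP/(_ (val a.2.2.1)) := lset_on Ta'.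
      by rewrite !inE (valP a.2.2.1).
    have [_ Hp2] := pairing_graft_neq0 hc Hp.
    have sub : lset ((G (val a.1)).1 a.2.1) \subset val b.1 :|: R :\: val b.1.
      rewrite (lset_on Ta); apply: subset_trans AR _; apply/subsetP => z zR.
      by rewrite !inE zR andbT orbN.
    have [Tb1 _ Hb] := Tb'.
    suff XY y z : y \in val b.1 -> z \in R :\: val b.1 ->
        parent (t b) y != Some z /\ parent (t b) z != Some y.
      apply/eqP; rewrite eqEcard cA cB leqnn andbT.
      case/orP: (pairing_connected XY sub Hp2); rewrite (lset_on Ta) //.
      by move=> /subsetP/(_ _ xA); rewrite inE xB.
    move=> yB; rewrite inE => /andP[zB zR]; split; apply/eqP; rewrite /= ?yB ?(negbTE zB).
      case pE: (parent _ y) => [w|] /= -[E'].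
        have [yr|yr] := eqVneq y r3; first by rewrite yr (to_rootp Tb) in pE.
        have [w' [wB + _]] := to_parent Tb yB yr; rewrite pE => -[E2].
        by rewrite -E' E2 wB in zB.
      by move: (valP b.2.2.1); rewrite /= E' => zH; rewrite (disjointFr dHR zH) in zR.
    have [zr|zr] := eqVneq z r; first by rewrite zr (to_rootp Tb1).
    have zS : z \in H :|: R :\: val b.1 by rewrite !inE zB zR orbT.
    have [w [+ -> _]] := to_parent Tb1 zS zr => /[swap] -[->].
    by rewrite !inE yB orbF => yH; have := subsetP BR _ yB; rewrite (disjointFr dHR yH).
  move: Hp; rewrite E // !mulf_eq0 !negb_or => /andP[/andP[Hp1 Hp2] Hp3].
  move: a b {aA AR xA cA bA BR xB cB Ta Tb r2 r3 Ta' Tb' E} ab Hp1 Hp2 Hp3.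
  move=> [[A hA] [a1 [[h hh] a2]]] [[B hB] [b1 [[h' hh'] b2]]] /= E; subst B.
  have cA : #|A| = d by move: (hA); rewrite inE => /and3P[_ _ /eqP].
  have [_ ->] := HG' _ hA; have [_ ->] := HG _ cA.
  move=> /eqP->; have [E _ /eqP->|_] := eqVneq h h'; last by rewrite eqxx.
  subst h'.
  by rewrite (bool_irrelevance hA hB) (bool_irrelevance hh hh').
rewrite -cT; exact: dual_ord Hct dct.
Qed.

(** One more level: s i.+1 nodes and k copies of trees of size d. *)
Lemma system_step k : (0 < s i.+1)%N ->
  @tree_system K I s i.+1 (s i.+1 + k * d) (block_count (s i.+1) d l k).
Proof.
move=> s0 S cS.
have [H HS cH] : exists2 H : {set I}, H \subset S & #|H| = s i.+1.
  have : (0 < #|[set A : {set I} | (A \subset S) && (#|A| == s i.+1)]|)%N.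
    by rewrite cards_draws bin_gt0 cS leq_addr.
  by move=> /card_gt0P[A]; rewrite inE => /andP[AS /eqP cA]; exists A.
have [r rH] : exists r, r \in H by apply/card_gt0P; rewrite cH.
have [|||c [t [Hct Hd]]] := @headed_family k H (S :\: H) r rH.
- by rewrite cH s0 leqnn.
- by apply/pred0P => x /=; rewrite inE; case: (x \in H).
- by rewrite cardsD (setIidPr HS) cS cH addKn.
rewrite cH in c t Hct Hd; exists c, t; split=> // a; exists r.
have [+ _ _] := Hct a; rewrite (_ : H :|: S :\: H = S) //.
by rewrite -{2}(setID S H) (setIidPr HS).
Qed.
End BlockStep.

Lemma system_base (K : fieldType) (I : finType) (s : nat -> nat) : (0 < s 1%N)%N ->
  @tree_system K I s 1 (s 1%N) (s 1%N).-1`!.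
Proof.
move=> s0 S cS.
have [r rS] : exists r, r \in S by apply/card_gt0P; rewrite cS.
have [|c [t [Hct Hd]]] := @path_system K I s 1 S r isT rS; first by rewrite cS.
rewrite cS in c t Hct Hd; exists c, t; split=> // a; exists r.
by have [] := Hct a.
Qed.

Lemma system_codim (R : realType) (K : fieldType) q s N n l : (1 <= q)%N -> (0 < s 1%N)%N ->
  (N <= n)%N -> @tree_system K 'I_N s q N l -> (l <= codim (PN K q s) n)%N.
Proof.
move=> q0 s0 Nn /(_ [set: 'I_N]); rewrite cardsT card_ord => /(_ erefl)[c [t [Hct Hd]]].
apply: (codim_lower q0 s0 R (c := c) (t := t)) => // a; have [r T] := Hct a; last first.
  by have := to_leaves T; rewrite enum_setT -enumT.
split.
- by move=> i; apply: (to_level T); rewrite inE.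
- by move=> i j; apply: (to_chain_level T); rewrite inE.
- move=> i; apply: leq_trans (to_card T (in_setT i)); apply: subset_leq_card.
  by apply/subsetP => j; rewrite !inE.
move=> i m pE; have [ir|ir] := eqVneq i r; first by rewrite ir (to_rootp T) in pE.
by have [y [_ + b]] := to_parent T (in_setT i) ir; rewrite pE => -[->].
Qed.


Local Open Scope classical_set_scope.
Local Open Scope ring_scope.

(** * Asymptotics of the upper bound *)

Section Growth.
Variable R : realType.
Implicit Types (x y g c M : R).

Lemma near_ge M : \forall x \near +oo, M <= x.
Proof. by apply: nbhs_pinfty_ge; rewrite num_real. Qed.

Lemma near_lin_expR M c : 0 < c -> \forall x \near +oo, M * x <= expR (c * x).
Proof.
move=> c0; near=> x.
have x0 : 0 <= x by near: x; apply: near_ge.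
have xM : 2 * M / c ^+ 2 <= x by near: x; apply: near_ge.
have := @expR_ge1Dxn R (c * x) 1 (mulr_ge0 (ltW c0) x0).
apply: le_trans; rewrite ler_pdivrMr ?exprn_gt0 // in xM.
have : x * (2 * M) <= x * (x * c ^+ 2) by apply: ler_wpM2l.
rewrite (_ : 2`!%:R = 2) //; lra.
Unshelve. all: by end_near. Qed.

Lemma near_exprn_expR n c : 0 < c -> \forall x \near +oo, x ^+ n <= expR (c * x).
Proof.
case: n => [|n] c0.
  near=> x.
  have x0 : 0 <= x by near: x; apply: near_ge.
  by rewrite expr0 -expR0 ler_expR mulr_ge0 // ltW.
have c1 : 0 < c / n.+1%:R by rewrite divr_gt0.
near=> x.
have x0 : 0 <= x by near: x; apply: near_ge.
have : 1 * x <= expR (c / n.+1%:R * x) by near: x; apply: near_lin_expR.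
rewrite mul1r => /(lerXn2r n.+1 _ _)-/(_ x0 (expR_ge0 _)); rewrite -expRM_natl.
by rewrite mulrA mulrCA divff ?mulr1 ?pnatr_eq0.
Unshelve. all: by end_near. Qed.

Lemma near_ln_lin c : 0 < c -> \forall x \near +oo, ln x <= c * x.
Proof.
move=> c0; near=> x.
have x0 : 0 < x by near: x; apply: nbhs_pinfty_gt; rewrite num_real.
rewrite -ler_expR lnK ?posrE // -[leLHS]mul1r.
by near: x; apply: near_lin_expR.
Unshelve. all: by end_near. Qed.

Lemma near_le_expR M c : 0 < c -> \forall x \near +oo, M <= expR (c * x).
Proof.
move=> c0; near=> x.
have x1 : 1 <= x by near: x; apply: near_ge.
have : `|M| * x <= expR (c * x) by near: x; apply: near_lin_expR.
apply: le_trans; apply: le_trans (ler_norm M) _.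
by rewrite ler_peMr.
Unshelve. all: by end_near. Qed.

(** A constant factor is absorbed by a larger exponent. *)
Lemma near_scale_expR M a b : a < b -> \forall x \near +oo, M * expR (a * x) <= expR (b * x).
Proof.
move=> ab; have c0 : 0 < b - a by rewrite subr_gt0.
near=> x.
have Mx : M <= expR ((b - a) * x) by near: x; apply: near_le_expR.
have -> : b * x = (b - a) * x + a * x by ring.
by rewrite expRD ler_wpM2r ?expR_ge0.
Unshelve. all: by end_near. Qed.

Lemma near_lin_absorb M c : 0 < c -> \forall x \near +oo, M * x <= c * expR x.
Proof.
move=> c0; near=> x; rewrite -ler_pdivrMl // mulrA -[x in expR x]mul1r.
by near: x; apply: near_lin_expR.
Unshelve. all: by end_near. Qed.

Lemma near_scale_absorb M b c : 0 < c -> b < 1 ->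
  \forall x \near +oo, M * expR (b * x) <= c * expR x.
Proof.
move=> c0 b1; near=> x; rewrite -ler_pdivrMl // mulrA -[x in leRHS]mul1r.
by near: x; apply: near_scale_expR.
Unshelve. all: by end_near. Qed.
End Growth.

Section PolyBound.
Variable R : realType.
Implicit Types (x y g : R).

Lemma sum_expR_le t y : 0 <= y ->
  \sum_(k < t) expR y ^+ k.+1 <= t%:R * expR (t%:R * y).
Proof.
move=> y0; rewrite mulr_natl -[X in _ *+ X]card_ord -sumr_const; apply: ler_sum => k _.
by rewrite -expRM_natl ler_expR ler_wpM2r // ler_nat.
Qed.

(** Each entry of the list contributes one exponential to poly_bound. As long as
    t y is below x by a constant factor, so is the exponent at the next level
    below exp x, because exp(b x) = o(exp x) for b < 1; only at the last level
    does the constant matter. *)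
Lemma poly_bound_near t l (a kap : R) : 0 < a -> 0 < kap ->
  (if l is [::] then a < kap else a < 1) -> all (leq 1) (t :: l) ->
  \forall x \near +oo, forall y, 0 <= y -> t%:R * y <= a * x ->
    poly_bound (t :: l) (expR y) <= expR (kap * iter (size l) expR x).
Proof.
elim: l t a kap => [|t' l IH] t a kap a0 kap0 ak tl.
  near=> x => y y0 tyx; rewrite /= addr0; apply: le_trans (sum_expR_le t y0) _.
  apply: (@le_trans _ _ (t%:R * expR (a * x))); first by rewrite ler_wpM2l // ler_expR.
  by near: x; apply: near_scale_expR.
have t1 : 1 <= t%:R :> R by move: tl => /= /andP[t1 _]; rewrite ler1n.
pose b := (a + 1) / 2.
have ab : a < b by rewrite /b; lra.
have b1 : b < 1 by rewrite /b; lra.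
pose a' := Num.min (kap / 4) (1 / 2).
have a'0 : 0 < a' by rewrite lt_min; apply/andP; split; lra.
have a'k : a' <= kap / 4 by rewrite ge_min lexx.
have a'1 : a' <= 1 / 2 by rewrite ge_min lexx orbT.
have : \forall x \near +oo, forall y, 0 <= y -> t'%:R * y <= a' * x ->
    poly_bound (t' :: l) (expR y) <= expR (kap / 2 * iter (size l) expR x).
  apply: IH => //; [by rewrite divr_gt0| |by case/andP: tl].
  case: (l) => [|_ _]; last by apply: le_lt_trans a'1 _; lra.
  by apply: le_lt_trans a'k _; rewrite ltr_pM2l // ltf_pV2 ?posrE // ltr_nat.
move=> [X0 [_ HX0]].
near=> x => y y0 tyx.
have x0 : 0 <= x by near: x; apply: near_ge.
pose mu := \sum_(k < t) expR y ^+ k.+1.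
have mu_le : mu <= expR (b * x).
  apply: le_trans (sum_expR_le t y0) _.
  apply: (@le_trans _ _ (t%:R * expR (a * x))); first by rewrite ler_wpM2l // ler_expR.
  by near: x; apply: near_scale_expR.
have mu0 : 0 <= mu by apply: sumr_ge0 => k _; rewrite exprn_ge0 ?expR_ge0.
have ex : x <= expR x by have := expR_ge1Dx x; lra.
have iter_ge k : expR x <= iter k.+1 expR x.
  elim: k => // k; rewrite [iter k.+2 _ _]iterS; move: (iter _ _ _) => z xz.
  by have := expR_ge1Dx z; lra.
have yx : y <= x.
  have : y <= t%:R * y by rewrite ler_peMl.
  have : a * x <= x by rewrite ler_piMl // ltW.
  lra.
have H2 : poly_bound (t' :: l) (expR y ^+ t.+1 * expR mu) <=
    expR (kap / 2 * iter (size l).+1 expR x).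
  rewrite -expRM_natl -expRD iterSr; apply: HX0.
- suff : X0 + 1 <= x by lra.
  by near: x; apply: near_ge.
- by rewrite addr_ge0 // mulr_ge0.
  have E1 : t'%:R * t.+1%:R * x <= a' / 2 * expR x.
    by near: x; apply: near_lin_absorb; rewrite divr_gt0.
  have E2 : t'%:R * expR (b * x) <= a' / 2 * expR x.
    by near: x; apply: near_scale_absorb; rewrite ?divr_gt0.
  have E3 : t'%:R * mu <= t'%:R * expR (b * x) by rewrite ler_wpM2l.
  have E4 : t'%:R * t.+1%:R * y <= t'%:R * t.+1%:R * x by rewrite ler_wpM2l // mulr_ge0.
  rewrite mulrDr mulrA; lra.
have H1 : mu <= expR (kap / 2 * iter (size l).+1 expR x).
  apply: le_trans mu_le _; rewrite ler_expR.
  apply: (@le_trans _ _ (kap / 2 * expR x)).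
    by near: x; apply: near_lin_absorb; rewrite divr_gt0.
  by rewrite ler_wpM2l // ?iter_ge // divr_ge0 // ltW.
rewrite -[poly_bound _ _]/(mu + poly_bound (t' :: l) (expR y ^+ t.+1 * expR mu)).
set E := iter _ _ _ in H1 H2 *.
have H3 : 2 <= expR (kap / 2 * E).
  apply: (@le_trans _ _ (expR (kap / 2 * expR x))); last first.
    by rewrite ler_expR ler_wpM2l ?iter_ge // divr_ge0 // ltW.
  apply: (@le_trans _ _ (expR (kap / 2 * x))).
    by near: x; apply: near_le_expR; rewrite divr_gt0.
  by rewrite ler_expR ler_wpM2l // divr_ge0 // ltW.
have -> : kap * iter (size (t' :: l)) expR x = kap / 2 * E + kap / 2 * E.
  by rewrite -mulrDl -splitr.
rewrite expRD; have := expR_gt0 (kap / 2 * E); nra.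
Unshelve. all: by end_near. Qed.
End PolyBound.

Section IterLn.
Variable R : realType.
Implicit Types x y : R.

Lemma iter_ln_near k (M : R) : \forall n \near \oo, M <= iter_ln k (n%:R : R).
Proof.
elim: k M => [|k IH] M; first exact: nbhs_infty_ger.
near=> n.
have H : expR M <= iter_ln k (n%:R : R) by near: n; apply: IH.
by rewrite -ler_expR lnK // posrE (lt_le_trans _ H) ?expR_gt0.
Unshelve. all: by end_near. Qed.

Lemma near_iter_ln k (P : R -> Prop) : (\forall x \near +oo, P x) ->
  \forall n \near \oo, P (iter_ln k n%:R).
Proof.
move=> [M [_ HM]]; near=> n; apply: HM.
suff : M + 1 <= iter_ln k (n%:R : R) by lra.
by near: n; apply: iter_ln_near.
Unshelve. all: by end_near. Qed.

Lemma near_nat (P : R -> Prop) : (\forall x \near +oo, P x) -> \forall n \near \oo, P n%:R.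
Proof. exact: (near_iter_ln 0). Qed.

Lemma iter_lnK k : \forall n \near \oo, iter k expR (iter_ln k (n%:R : R)) = n%:R.
Proof.
elim: k => [|k IH]; first by near=> n.
near=> n; rewrite iterSr /iter_ln iterS lnK ?posrE; first by near: n.
suff : 1 <= iter_ln k (n%:R : R) by apply: lt_le_trans ltr01.
by near: n; apply: iter_ln_near.
Unshelve. all: by end_near. Qed.

Lemma iter_ln_le k : \forall n \near \oo, iter_ln k.+1 (n%:R : R) <= ln n%:R.
Proof.
elim: k => [|k IH]; first by near=> n.
near=> n.
apply: (@le_trans _ _ (iter_ln k.+1 n%:R)); last by near: n.
apply/ltW/ln_sublinear.
suff : 1 <= iter_ln k.+1 (n%:R : R) by apply: lt_le_trans ltr01.
by near: n; apply: iter_ln_near.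
Unshelve. all: by end_near. Qed.
End IterLn.

Section UpperBound.
Variable R : realType.
Implicit Types (x y z d : R).

(** For rho = exp y one has rho^s1 = (s1/s2) x exp(-d s1). The leading term
    rho^s1 / s1 of mu1, multiplied by s2, is x exp(-d s1), and the other terms are
    o(x): the choice of rho keeps the exponent at the second level strictly
    below x. *)
Lemma mu1_near (s1 s2 : nat) d : (0 < s1)%N -> (0 < s2)%N -> 0 < d ->
  exists2 a : R, 0 < a < 1 & \forall x \near +oo, forall y,
    y = (ln (s1%:R / s2%:R) + ln x) / s1%:R - d -> 0 <= y /\
    s2%:R * (s1.+1%:R * y + mu1 s1 (expR y)) <= a * x.
Proof.
case: s1 => // m _; case: s2 => // s2' _; set s1 := m.+1; set s2 := s2'.+1; move=> d0.
have S1 : 1 <= s1%:R :> R by rewrite ler1n.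
have S2 : 1 <= s2%:R :> R by rewrite ler1n.
pose c : R := expR (- (d * s1%:R)).
have c0 : 0 < c by apply: expR_gt0.
have c1 : c < 1 by rewrite expR_lt1 oppr_lt0 mulr_gt0 //; lra.
exists ((1 + c) / 2); first by apply/andP; split; lra.
have [eta eta0 etaE] : exists2 eta : R, 0 < eta & eta = (1 - c) / 4.
  by exists ((1 - c) / 4) => //; lra.
pose M := ln (s1%:R / s2%:R) : R.
pose Q : R := s2%:R * s1.+1%:R.
have Q1 : 0 < Q by rewrite mulr_gt0 ?ltr0n.
near=> x => y yE.
have x1 : 1 <= x by near: x; apply: near_ge.
have x0 : 0 < x by lra.
have lx0 : 0 <= ln x by apply: ln_ge0.
have y_ge Y : expR (s1%:R * (Y + d) - M) <= x -> Y <= y.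
  rewrite -[X in _ <= X]lnK ?posrE // ler_expR yE lerBrDr ler_pdivlMr ?ltr0n // -/M; lra.
have y0 : 0 <= y by apply: y_ge; near: x; apply: near_ge.
split=> //.
have yle : y <= `|M| + ln x.
  rewrite yE; apply: (@le_trans _ _ ((M + ln x) / s1%:R)); first by rewrite gerBl ltW.
  rewrite ler_pdivrMr ?ltr0n //; have := ler_norm M; have := normr_ge0 M; nra.
have E1 : Q * y <= eta * x.
  apply: (@le_trans _ _ (Q * (`|M| + ln x))); first by rewrite ler_wpM2l // ltW.
  have H1 : ln x <= eta / 2 / Q * x by near: x; apply: near_ln_lin; rewrite !divr_gt0 //.
  have H2 : Q * `|M| / (eta / 2) <= x by near: x; apply: near_ge.
  rewrite ler_pdivrMr ?divr_gt0 // in H2.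
  have : Q * ln x <= eta / 2 * x.
    by rewrite mulrC -ler_pdivlMr //; apply: le_trans H1 _; rewrite mulrAC.
  lra.
have rE : expR y ^+ s1 = s1%:R / s2%:R * x * c.
  rewrite -expRM_natl yE mulrBr mulrCA divff ?mulr1 ?pnatr_eq0 // expRD expRD !lnK ?posrE ?divr_gt0 ?ltr0n //.
  by rewrite /c [d * _]mulrC.
have E2 : mu1 s1 (expR y) <= m%:R * expR y ^+ m + expR y ^+ s1 / s1%:R.
  rewrite /mu1 /s1 big_ord_recr /= lerD2r mulr_natl -[X in _ *+ X]card_ord -sumr_const.
  apply: ler_sum => k _; apply: (@le_trans _ _ (expR y ^+ k.+1)).
    by rewrite ler_pdivrMr ?ltr0n // ler_peMr ?exprn_ge0 ?expR_ge0 // ler1n.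
  by rewrite -!expRM_natl ler_expR ler_wpM2r // ler_nat.
have E3 : s2%:R * (m%:R * expR y ^+ m) <= eta * x.
  have H1 : m%:R * s1%:R / eta <= expR y.
    rewrite -[leLHS]ger0_norm; last by rewrite divr_ge0 ?mulr_ge0 // ltW.
    apply: (@le_trans _ _ (1 + y)); last exact: expR_ge1Dx.
    suff : `|m%:R * s1%:R / eta| <= y by lra.
    by apply: y_ge; near: x; apply: near_ge.
  rewrite ler_pdivrMr // in H1.
  rewrite -(ler_pM2r (expR_gt0 y)).
  have -> : s2%:R * (m%:R * expR y ^+ m) * expR y = s2%:R * m%:R * expR y ^+ s1 by rewrite /s1 exprSr; ring.
  rewrite rE.
  have -> : s2%:R * m%:R * (s1%:R / s2%:R * x * c) = (m%:R * s1%:R) * x * c :> R.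
    by rewrite !mulrA; field; rewrite pnatr_eq0.
  apply: (@le_trans _ _ (m%:R * s1%:R * x)).
    by rewrite ler_piMr ?(ltW c1) // !mulr_ge0 // ltW.
  by rewrite [leRHS]mulrAC ler_wpM2r ?(ltW x0) // [leRHS]mulrC.
have E4 : s2%:R * (expR y ^+ s1 / s1%:R) = c * x.
  by rewrite rE; field; rewrite !pnatr_eq0.
have : s2%:R * (s1.+1%:R * y + mu1 s1 (expR y)) <=
   Q * y + (s2%:R * (m%:R * expR y ^+ m) + s2%:R * (expR y ^+ s1 / s1%:R)).
  by rewrite mulrDr mulrA lerD2l -mulrDr ler_wpM2l.
rewrite E4 => /le_trans; apply; rewrite etaE in E1 E3.
apply: le_trans (lerD E1 (lerD E3 (lexx _))) _; lra.
Unshelve. all: by end_near. Qed.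

(** rho^4 exp(rho) is at most z^4 exp(b z) = o(exp z). *)
Lemma light_near (b kap : R) : 0 < b < 1 -> 0 < kap ->
  \forall z \near +oo, forall rho, 1 <= rho -> rho <= b * z -> light_bound rho <= kap * expR z.
Proof.
move=> /andP[b0 b1] k0; pose c := (1 - b) / 2.
have c0 : 0 < c by rewrite /c; lra.
near=> z => rho r1 rz.
have z0 : 0 <= z by near: z; apply: near_ge.
have zr : rho <= z by apply: le_trans rz _; rewrite ler_piMl // ltW.
have z4 : z ^+ 4 <= expR (c * z) by near: z; apply: near_exprn_expR.
have e1 : 1 <= expR rho by have := expR_ge1Dx rho; lra.
have r4 k : (k <= 4)%N -> rho ^+ k <= z ^+ 4.
  move=> k4; apply: (@le_trans _ _ (z ^+ k)).
    by apply: lerXn2r => //; rewrite nnegrE //; lra.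
  by rewrite ler_weXn2l //; lra.
have P k : (k <= 4)%N -> rho ^+ k * expR rho <= expR ((b + c) * z).
  move=> k4; rewrite mulrDl addrC expRD ler_pM ?exprn_ge0 ?expR_ge0 ?ler_expR //; first by lra.
  exact: le_trans (r4 k k4) z4.
have P1 : rho <= expR ((b + c) * z).
  by apply: le_trans (P 1%N isT); rewrite expr1 ler_peMr //; lra.
have H : 3 * expR ((b + c) * z) <= kap * expR z.
  by near: z; apply: near_scale_absorb => //; rewrite /c; lra.
apply: le_trans H; rewrite /light_bound mulrA -exprD.
have := P 2%N isT; have := P 4%N isT; lra.
Unshelve. all: by end_near. Qed.
End UpperBound.

(** The codimension is n! exp(- n (rate n + o(1))). *)
Definition rate (R : realType) (q : nat) (s : nat -> nat) (n : nat) : R :=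
  (ln ((s 1%N)%:R / (s 2%N)%:R) + iter_ln q.-1 n%:R) / (s 1%N)%:R.

Section UpperBoundCodim.
Variables (R : realType) (K : fieldType) (q : nat) (s : nat -> nat).
Hypothesis hq : (3 <= q)%N.
Hypothesis hs : forall i, (1 <= i <= q)%N -> (0 < s i)%N.
Local Notation rate := (rate R q s).

(** [codim_upper] with rho = exp(rate n - d): all factors other than rho^(-n) are
    exp(o(n)). Here x is ln^(q-2) n, so that the iterated exponential of
    [poly_bound_near] is n, and z = ln n controls the light factors. *)
Theorem codim_upper_near (eps : R) : 0 < eps -> \forall n \near \oo,
  (codim (PN K q s) n)%:R <= n`!%:R * expR (- (n%:R * (rate n - eps))).
Proof.
move=> eps0; have q1 : (1 <= q)%N by apply: leq_trans hq.
have s1 : (0 < s 1%N)%N by apply: hs.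
have s2 : (0 < s 2%N)%N by apply: hs; rewrite /= (leq_trans _ hq).
have [r Hr] := codim_upper K s R q1.
pose d := eps / 2.
have d0 : 0 < d by rewrite divr_gt0.
have d4 : 0 < d / 4 by rewrite divr_gt0.
have [a /andP[a0 a1] Hmu] := mu1_near s1 s2 d0.
have [kap kap0 kapE] : exists2 k : R, 0 < k & k * 8 * r.+1%:R = d.
  exists (d / (8 * r.+1%:R)); first by rewrite !divr_gt0 // mulr_gt0.
  by rewrite -mulrA divfK // mulf_neq0 ?pnatr_eq0.
have [p qE] : exists p, q = p.+3 by exists (q - 3)%N; rewrite -addn3 subnK.
pose l := [seq s j.+1 | j <- iota 2 p.+1].
have lE : [seq s j.+1 | j <- iota 1 q.-1] = s 2%N :: l by rewrite qE.
have szl : size l = p.+1 by rewrite size_map size_iota.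
have Hpb : \forall x \near +oo, forall y, 0 <= y -> (s 2%N)%:R * y <= a * x ->
    poly_bound (s 2%N :: l) (expR y) <= expR (kap * iter (size l) expR x).
  apply: poly_bound_near => //.
  apply/allP => u; rewrite in_cons => /orP[/eqP->//|/mapP[j + ->]].
  rewrite mem_iota => /andP[j2 jp].
  by apply: hs; rewrite qE.
have Hl : \forall z \near +oo, forall rho, 1 <= rho -> rho <= expR (- d) * z ->
    light_bound rho <= d / 4 * expR z.
  by apply: light_near; rewrite ?divr_gt0 // expR_gt0 expR_lt1 oppr_lt0.
near=> n.
set x : R := iter_ln p.+1 n%:R.
have x1 : 1 <= x by rewrite /x; near: n; apply: iter_ln_near.
have n1 : 1 <= n%:R :> R by near: n; apply: nbhs_infty_ger.
have n0 : 0 < n%:R :> R by lra.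
set z : R := ln n%:R.
have z1 : (s 1%N)%:R <= z by rewrite /z; near: n; apply: (iter_ln_near 1).
have ez : expR z = n%:R by rewrite lnK ?posrE.
have xz : x <= z by rewrite /x /z; near: n; apply: iter_ln_le.
pose y : R := (ln ((s 1%N)%:R / (s 2%N)%:R) + ln x) / (s 1%N)%:R - d.
have yE : rate n - eps = y - d 
  by rewrite [eps in LHS]splitr opprD addrA /rate qE.
have [y0 Hy] : 0 <= y /\ (s 2%N)%:R * ((s 1%N).+1%:R * y + mu1 (s 1%N) (expR y)) <= a * x.
  suff : forall y', y' = y -> 0 <= y' /\
    (s 2%N)%:R * ((s 1%N).+1%:R * y' + mu1 (s 1%N) (expR y')) <= a * x by apply.
  rewrite /y /x; near: n; exact: (near_iter_ln p.+1 Hmu).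
have s1R : 1 <= (s 1%N)%:R :> R by rewrite ler1n.
have s2R : 1 <= (s 2%N)%:R :> R by rewrite ler1n.
have mu0 : 0 <= mu1 (s 1%N) (expR y).
  by apply: sumr_ge0 => k _; rewrite divr_ge0 ?exprn_ge0 ?expR_ge0.
have big_n : 1 * n%:R <= expR (kap * n%:R).
  by near: n; exact: (near_nat (near_lin_expR 1 kap0)).
have light : light_bound (expR y) <= d / 4 * n%:R.
  rewrite -ez; move: (expR_ge1Dx y) => ey.
  have e1 : 1 <= expR y by lra.
  have eyz : expR y <= expR (- d) * z.
    rewrite -[z]lnK ?posrE; last by lra.
    rewrite -expRD ler_expR /y addrC lerD2l ler_pdivrMr ?ltr0n //.
    have z0 : 1 <= z by apply: le_trans z1.
    have l0 : 0 <= ln z by apply: ln_ge0.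
    have lx : ln x <= ln z by rewrite ler_ln ?posrE //; lra.
    have ls : ln ((s 1%N)%:R / (s 2%N)%:R) <= ln ((s 1%N)%:R : R).
      by rewrite ler_ln ?posrE ?divr_gt0 ?ltr0n // ler_pdivrMr ?ltr0n // ler_peMr.
    move: ls z1 (s1); case: (s 1%N) => [//|[|m]] ls z1 _.
      by rewrite ln1 in ls; lra.
    have lm : ln (m.+2%:R : R) <= ln z by rewrite ler_ln ?posrE //; lra.
    have : ln z * 2 <= ln z * m.+2%:R by rewrite ler_wpM2l // ler_nat.
    lra.
  move: (expR y) e1 eyz; rewrite /z; near: n.
  exact: (near_iter_ln 1 Hl).
have iterK : iter p.+1 expR x = n%:R by rewrite /x; near: n; apply: iter_lnK.
have lie : lie_bound (s 1%N) (s 2%N :: l) (expR y) <= expR (2 * kap * n%:R).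
  rewrite /lie_bound -expRM_natl -expRD.
  have mux : mu1 (s 1%N) (expR y) <= x.
    have : mu1 (s 1%N) (expR y) <= (s 2%N)%:R * ((s 1%N).+1%:R * y + mu1 (s 1%N) (expR y)).
      have : 0 <= (s 1%N).+1%:R * y by rewrite mulr_ge0.
      nra.
    have : a * x <= x by rewrite ler_piMl //; lra.
    lra.
  have xn : x <= n%:R.
    by apply: le_trans xz _; apply/ltW/ln_sublinear.
  have PB : poly_bound (s 2%N :: l) (expR ((s 1%N).+1%:R * y + mu1 (s 1%N) (expR y))) <=
      expR (kap * n%:R).
    have : 0 <= (s 1%N).+1%:R * y + mu1 (s 1%N) (expR y) by rewrite addr_ge0 // mulr_ge0.
    move: Hy; rewrite -iterK -szl; move: (_ + mu1 _ _) => g Hg g0; move: g g0 Hg.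
    rewrite /x; near: n; exact: (near_iter_ln p.+1 Hpb).
  have two : 2 <= expR (kap * n%:R).
    by near: n; exact: (near_nat (near_le_expR 2 kap0)).
  have -> : 2 * kap * n%:R = kap * n%:R + kap * n%:R by ring.
  rewrite [leRHS]expRD.
  apply: (@le_trans _ _ (2 * expR (kap * n%:R))); last by rewrite ler_wpM2r ?expR_ge0.
  rewrite [leRHS]mulr_natl mulr2n lerD //; apply: le_trans mux (le_trans xn _).
  by rewrite -[leLHS]mul1r.
have lie0 : 0 <= lie_bound (s 1%N) (s 2%N :: l) (expR y).
  have pb0 (g : R) l' : 0 <= g -> 0 <= poly_bound l' g.
    elim: l' g => //= t l' IH g g0; rewrite addr_ge0 //.
      by apply: sumr_ge0 => k _; rewrite exprn_ge0.
    by apply: IH; rewrite mulr_ge0 ?exprn_ge0 ?expR_ge0.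
  by rewrite addr_ge0 // pb0 // mulr_ge0 ?exprn_ge0 ?expR_ge0.
apply: le_trans (Hr n (expR y) (expR_gt0 _)) _.
rewrite lE -expRM_natl -mulrA -expRN ler_wpM2l // yE.
have -> : - (n%:R * (y - d)) = - (n%:R * y) + n%:R * d by ring.
rewrite [leRHS]expRD ler_wpM2l ?expR_ge0 //.
apply: (@le_trans _ _ (\sum_(j < r.+1) expR (2 * kap * r%:R * n%:R + d / 4 * n%:R))).
  apply: ler_sum => j _; rewrite [leRHS]expRD ler_pM ?exprn_ge0 ?expR_ge0 ?ler_expR //.
  apply: (@le_trans _ _ (expR (2 * kap * n%:R) ^+ j)).
    by apply: lerXn2r; rewrite ?nnegrE ?expR_ge0.
  rewrite -expRM_natl ler_expR.
  have -> : 2 * kap * r%:R * n%:R = r%:R * (2 * kap * n%:R) by ring.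
  rewrite ler_wpM2r ?mulr_ge0 // ?(ltW kap0) // ler_nat -ltnS.
  exact: ltn_ord.
rewrite sumr_const card_ord -[leLHS]mulr_natl.
have rn : r.+1%:R <= expR (d / 4 * n%:R).
  by near: n; exact: (near_nat (near_le_expR r.+1%:R d4)).
apply: (@le_trans _ _ (expR (d / 4 * n%:R) * expR (2 * kap * r%:R * n%:R + d / 4 * n%:R))).
  by rewrite ler_wpM2r ?expR_ge0.
rewrite -expRD ler_expR.
have : kap * 8 * r%:R <= d by rewrite -kapE ler_wpM2l ?ler_nat // mulr_ge0 // ltW.
move=> H; have : 2 * kap * r%:R <= d / 4 by lra.
move=> /(ler_wpM2r (ltW n0)) H2.
have : 0 <= d * n%:R by rewrite mulr_ge0 // ltW.
lra.
Unshelve. all: by end_near. Qed.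
End UpperBoundCodim.

(** * Asymptotics of the lower bound *)

Lemma block_countE h d l k : (0 < d)%N ->
  (block_count h d l k * (k`! * d`! ^ k) = (k * d)`! * (l * h) ^ k)%N.
Proof.
move=> d0; elim: k => [|k IH]; first by [].
have binE : (k.+1 * 'C((k.+1 * d).-1, d.-1) = 'C(k.+1 * d, d))%N.
  apply/eqP; rewrite -(eqn_pmul2l d0) mulnA [(d * k.+1)%N]mulnC mul_bin_diag.
  by rewrite prednK.
have binF : ('C(k.+1 * d, d) * (d`! * (k * d)`!) = (k.+1 * d)`!)%N.
  by rewrite -[in RHS](@bin_fact _ d) ?leq_pmull // mulSn addKn.
rewrite -binF -binE factS /= !expnS.
transitivity (k.+1 * 'C((k.+1 * d).-1, d.-1) * d`! * (l * h) *
  (block_count h d l k * (k`! * d`! ^ k)))%N; first by ring.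
by rewrite IH; ring.
Qed.

Lemma factD_le h m n : (h + m <= n)%N -> ((h + m)`! <= n ^ h * m`!)%N.
Proof.
elim: h => [|h IH] hm; first by rewrite mul1n.
rewrite addSn factS expnS -mulnA leq_mul //.
by apply: IH; apply: leq_trans hm; rewrite addSn.
Qed.

Section LogBounds.
Variable R : realType.

(** [block_countE] in logarithmic form: k trees of size d with logarithmic defect
    A each lose k A + ln k!, and the h heads lose at most h ln n. *)
Lemma block_count_ge h d l k n (A B : R) : (0 < d)%N -> (0 < n)%N -> (h + k * d <= n)%N ->
  d`!%:R * expR (- A) <= (l * h)%:R -> ln k`!%:R <= B ->
  (h + k * d)`!%:R * expR (- (h%:R * ln n%:R + k%:R * A + B)) <= (block_count h d l k)%:R.
Proof.
move=> d0 n0 hn Hl Hk.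
have nR : 0 < n%:R :> R by rewrite ltr0n.
have fk : 0 < (k`! * d`! ^ k)%:R :> R by rewrite ltr0n muln_gt0 expn_gt0 !fact_gt0.
rewrite -(ler_pM2r fk) -[leRHS]natrM block_countE //.
have H1 : (h + k * d)`!%:R <= n%:R ^+ h * (k * d)`!%:R :> R.
  by rewrite -natrX -natrM ler_nat factD_le.
have H2 : (d`!%:R * expR (- A)) ^+ k <= (l * h)%:R ^+ k.
  by apply: lerXn2r => //; rewrite nnegrE ?mulr_ge0 ?expR_ge0.
have H3 : k`!%:R * expR (- B) <= 1.
  by rewrite -[X in X * _]lnK ?posrE ?ltr0n ?fact_gt0 // -expRD expR_le1 subr_le0.
have -> : expR (- (h%:R * ln n%:R + k%:R * A + B)) =
    (n%:R ^+ h)^-1 * expR (- A) ^+ k * expR (- B).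
  rewrite !opprD !expRD [expR (- (h%:R * _))]expRN expRM_natl lnK ?posrE // -expRM_natl.
  congr (_ * expR _ * _).
  by rewrite mulrN.
rewrite [leRHS]natrM [((l * h) ^ k)%:R]natrX [(k`! * _)%:R]natrM natrX.
have nh : n%:R ^+ h != 0 :> R by rewrite expf_neq0 // lt0r_neq0.
apply: (@le_trans _ _ ((k * d)`!%:R * (d`!%:R * expR (- A)) ^+ k * (k`!%:R * expR (- B)))).
  have -> : (k * d)`!%:R * (d`!%:R * expR (- A)) ^+ k * (k`!%:R * expR (- B)) =
    (n%:R ^+ h * (k * d)`!%:R) * ((n%:R ^+ h)^-1 * expR (- A) ^+ k * expR (- B) * (k`!%:R * d`!%:R ^+ k)).
    rewrite exprMn; move: (expR (- A) ^+ k) (expR (- B)) => a b.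
    by move: (n%:R ^+ h) nh => x nx; field.
  rewrite -[leLHS]mulrA ler_wpM2r // !mulr_ge0 ?invr_ge0 ?exprn_ge0 ?expR_ge0 //.
rewrite -[leRHS]mulr1 ler_pM ?mulr_ge0 ?exprn_ge0 ?mulr_ge0 ?expR_ge0 //.
by rewrite ler_wpM2l // -natrM.
Qed.

Lemma ln_fact_le k n : (k <= n)%N -> (0 < n)%N -> ln k`!%:R <= k%:R * ln n%:R :> R.
Proof.
move=> kn n0; rewrite -ler_expR lnK ?posrE ?ltr0n ?fact_gt0 //.
rewrite expRM_natl lnK ?posrE ?ltr0n // -natrX ler_nat.
by have := @factD_le k 0 n; rewrite addn0 fact0 muln1; apply.
Qed.

(** The linear term - m is needed: it compensates for another factorial in
    [many_trees3_at]. *)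
Lemma ln_fact_stirling m : (0 < m)%N ->
  ln m`!%:R <= 1 + ln m%:R + m%:R * ln m%:R - m%:R :> R.
Proof.
elim: m => // m IH _; have [->|m0] := posnP m; first by rewrite ln1; lra.
have mR : 0 < m%:R :> R by rewrite ltr0n.
rewrite factS natrM lnM ?posrE ?ltr0n ?fact_gt0 //.
have H : ln (m%:R / m.+1%:R) <= - m.+1%:R^-1 :> R.
  have -> : m%:R / m.+1%:R = 1 + - m.+1%:R^-1 :> R.
    by rewrite -natr1; field; rewrite natr1 pnatr_eq0.
  by apply: le_ln1Dx; rewrite ltrN2 invf_lt1 // ltr1n ltnS.
rewrite ln_div ?posrE ?ltr0n // in H.
have : m.+1%:R * (ln m%:R - ln m.+1%:R) <= -1 :> R.
  apply: le_trans (ler_wpM2l _ H) _; first by [].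
  by rewrite mulrN divff ?pnatr_eq0.
move: (IH m0); rewrite -natr1; nra.
Qed.

Lemma ln_le (x y : R) : x <= y -> 1 <= y -> ln x <= ln y.
Proof.
move=> xy y1; have [x0|x0] := leP x 0; first by rewrite ln0 ?ln_ge0.
by rewrite ler_ln ?posrE //; lra.
Qed.

Lemma ln_addr_le (x y : R) : 0 < x -> 0 <= y -> ln (x + y) <= ln x + y / x.
Proof.
move=> x0 y0; have -> : x + y = x * (1 + y / x) by rewrite mulrDr mulr1 mulrCA divff ?mulr1 // lt0r_neq0.
have yx : 0 <= y / x by rewrite divr_ge0 // ltW.
by rewrite lnM ?posrE //; [rewrite lerD2l le_ln1Dx //; lra|lra].
Qed.

Lemma iter_ln_near_real k (M : R) : \forall x \near +oo, M <= iter_ln k x.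
Proof.
elim: k M => [|k IH] M; first exact: near_ge.
near=> x.
have H : expR M <= iter_ln k x by near: x; apply: IH.
by rewrite -ler_expR lnK // posrE (lt_le_trans _ H) ?expR_gt0.
Unshelve. all: by end_near. Qed.

(** Blocks of ln n lnln n instead of ln n letters change ln^(k+2) by o(1), since
    lnln(z ln z) = lnln z + ln(1 + lnln z / ln z). *)
Lemma iter_ln_xlnx k (e : R) : 0 < e -> \forall z \near +oo, forall w,
  w <= z * ln z -> iter_ln k.+2 w <= iter_ln k.+2 z + e.
Proof.
elim: k e => [|k IH] e e0; have [M [_ HM]] := near_ln_lin e0; near=> z => w wz; last first.
  have H : iter_ln k.+2 w <= iter_ln k.+2 z + e by move: w wz; near: z; exact: IH.
  have z1 : 1 <= iter_ln k.+2 z by near: z; apply: iter_ln_near_real.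
  rewrite -[iter_ln k.+3 w]/(ln (iter_ln k.+2 w)) -[iter_ln k.+3 z]/(ln (iter_ln k.+2 z)).
  apply: le_trans (ln_le H _) _; first by lra.
  apply: le_trans (ln_addr_le _ (ltW e0)) _; first by lra.
  by rewrite lerD2l ler_pdivrMr ?ler_peMr //; lra.
have z1 : 1 <= z by near: z; apply: near_ge.
have lz1 : 1 <= ln z by near: z; apply: (iter_ln_near_real 1).
have l0 : 0 <= ln (ln z) by apply: ln_ge0.
have H1 : ln w <= ln z + ln (ln z).
  rewrite -lnM ?posrE; [|lra|lra]; apply: ln_le => //.
  by rewrite -[1]mulr1 ler_pM.
apply: le_trans (ln_le H1 _) _; first by lra.
apply: le_trans (ln_addr_le _ l0) _; first by lra.
rewrite lerD2l ler_pdivrMr; last by lra.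
apply: HM.
suff : M + 1 <= ln z by lra.
by near: z; apply: (iter_ln_near_real 1).
Unshelve. all: by end_near. Qed.
End LogBounds.

Lemma divn_cover n h d : (0 < d)%N -> (h <= n)%N ->
  let N := (h + (n - h) %/ d * d)%N in (N <= n)%N && (n <= N + d)%N.
Proof.
move=> d0 hn /=; have := divn_eq (n - h) d; have := ltn_pmod (n - h) d0.
set a := ((n - h) %/ d * d)%N; set b := ((n - h) %% d)%N; lia.
Qed.

Section LowerBound.
Variables (R : realType) (K : fieldType) (s : nat -> nat).
Hypotheses (s1 : (0 < s 1%N)%N) (s2 : (0 < s 2%N)%N).
Local Notation rate i := (rate R i s).

(** N is so close to n that n! / N! = exp(o(n)). *)
Definition many_trees (i : nat) := forall eps : R, 0 < eps -> \forall n \near \oo,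
  exists N l, [/\ (N <= n)%N, (n%:R - N%:R) * ln n%:R <= eps * n%:R,
    (forall I, @tree_system K I s i N l) &
    N`!%:R * expR (- (N%:R * (rate i n + eps))) <= l%:R].

(** What is needed of n (with z = ln n) for the trees of level 3 built from
    blocks of about z letters. *)
Definition base_range (a C eps z : R) :=
  [/\ 1 <= z, 4 / eps <= z & C / eps <= z] /\
   [/\ 1 <= a + ln z, (s 2%N)%:R * ln C + 1 + ln 2 <= eps / 4 / 2 * z,
    ln z <= eps / 4 / ((s 2%N)%:R + 1) / 2 * z, z ^+ 3 <= expR (1 * z) &
    ((s 3%N)%:R + eps / 4 * C) * z <= eps / 4 * expR z].

(** Level 2 has m blocks of s_1 letters with m close to z, and level 3 has k blocks
    of N' letters with N' close to s_1 m. The k trees of level 2 lose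
    k (m (a + ln m) - m), and ln k! is at most k z <= k m, which the term - k m
    compensates. What remains is at most N (a + ln z) / s_1 up to o(N). *)
Lemma many_trees3_at n (a C eps z : R) : (0 < s 3%N)%N -> 0 < eps ->
  a = ln ((s 1%N)%:R / (s 2%N)%:R) -> C = (s 2%N)%:R + 2 * (s 1%N)%:R ->
  z = ln n%:R -> (0 < n)%N -> (s 3%N <= n)%N -> base_range a C eps z ->
  exists N l, [/\ (N <= n)%N, (n%:R - N%:R) * ln n%:R <= eps * n%:R,
    (forall I, @tree_system K I s 3 N l) &
    N`!%:R * expR (- (N%:R * (rate 3 n + eps))) <= l%:R].
Proof.
move=> s3 eps0 aE CE zE n0N h3 [[z1 z4 zC] [az lC lz z3 zlin]].
have n0 : 0 < n%:R :> R by rewrite ltr0n.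
have ez : expR z = n%:R by rewrite zE lnK ?posrE.
rewrite -zE.
have S1 : 1 <= (s 1%N)%:R :> R by rewrite ler1n.
have S2 : 1 <= (s 2%N)%:R :> R by rewrite ler1n.
have C1 : 1 <= C by rewrite CE; lra.
have C0 : 0 < C by lra.
have e4 : 0 < eps / 4 by rewrite divr_gt0.
have z0 : 0 < z by apply: lt_le_trans z1.
have lz0 : 0 <= ln z by apply: ln_ge0.
have [m [m0N zm mz]] : exists m, [/\ (0 < m)%N, z <= m%:R & m%:R <= z + 1].
  exists (Num.truncn z).+1; split=> //; first by rewrite ltW // truncnS_gt.
  by rewrite -natr1 lerD2r truncn_le ltW.
have m1 : 1 <= m%:R :> R by rewrite ler1n.
have [N' N'E] : exists N', N' = (s 2%N + m * s 1%N)%N by eexists.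
have N'0 : (0 < N')%N by rewrite N'E addn_gt0 s2.
have mz2 : m%:R <= 2 * z by apply: le_trans mz _; rewrite mulr_natl mulr2n lerD2l.
have NzC : N'%:R <= C * z.
  rewrite N'E natrD natrM CE mulrDl lerD // ?ler_peMr //.
  by rewrite mulrC [2 * _]mulrC -mulrA ler_wpM2l.
have [k kE] : exists k, k = ((n - s 3%N) %/ N')%N by eexists.
have [N NE] : exists N, N = (s 3%N + k * N')%N by eexists.
have /andP[Nn nN] : (N <= n)%N && (n <= N + N')%N by rewrite NE kE; apply: divn_cover.
have nN' : n%:R - N%:R <= N'%:R :> R by rewrite lerBlDl -natrD ler_nat.
exists N, (block_count (s 3%N) N' (block_count (s 2%N) (s 1%N) (s 1%N).-1`! m) k).
split=> //.
- apply: (@le_trans _ _ (C * z * z)).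
    by rewrite ler_wpM2r ?(ltW z0) //; apply: le_trans nN' NzC.
  rewrite ler_pdivrMr // in zC.
  rewrite -ez -[z in expR z]mul1r; apply: (@le_trans _ _ (eps * z ^+ 3)).
    rewrite exprS expr2 [eps * _]mulrCA !mulrA.
    by rewrite -mulrA [leRHS](_ : _ = (z * eps) * (z * z)) ?ler_wpM2r ?mulr_ge0 ?(ltW z0) //; ring.
  by rewrite ler_wpM2l // ltW.
- move=> I; rewrite NE; apply: system_step => //; rewrite N'E; first by apply: system_step => //; apply: system_base.
pose A : R := (s 2%N)%:R * ln N'%:R + m%:R * a + ln m`!%:R.
have lA : N'`!%:R * expR (- A) <= (block_count (s 2%N) (s 1%N) (s 1%N).-1`! m * s 3%N)%:R.
  apply: (@le_trans _ _ (block_count (s 2%N) (s 1%N) (s 1%N).-1`! m)%:R); last first.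
    by rewrite ler_nat leq_pmulr.
  rewrite /A [in leLHS](_ : N'`! = (s 2%N + m * s 1%N)`!)%N; last by rewrite N'E.
  apply: block_count_ge => //; first by rewrite N'E.
  rewrite aE -lnV ?posrE ?divr_gt0 ?ltr0n // lnK ?posrE ?invr_gt0 ?divr_gt0 ?ltr0n // invf_div.
  rewrite -[in leLHS](prednK s1) factS !natrM prednK //.
  have nz : (s 1%N)%:R != 0 :> R by rewrite pnatr_eq0 -lt0n.
  by rewrite le_eqVlt; apply/orP; left; apply/eqP; field.
have lk : ln k`!%:R <= k%:R * z.
  by rewrite zE; apply: ln_fact_le => //; rewrite kE; apply: leq_trans (leq_div _ _) (leq_subr _ _).
have Nn' : (s 3%N + k * N' <= n)%N by rewrite -NE.
apply: le_trans (block_count_ge N'0 n0N Nn' lA lk); rewrite -NE ler_wpM2l // ler_expR lerN2 -zE.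
have st := ln_fact_stirling R m0N.
clear lA lk; move: @A st; move: (ln m`!%:R) => F A st.
have AE : A = (s 2%N)%:R * ln N'%:R + m%:R * a + F by [].
clearbody A.
have kN : k%:R * (m%:R * (s 1%N)%:R) <= N%:R :> R.
  by rewrite -!natrM ler_nat NE N'E mulnDr addnA leq_addl.
have kmN : k%:R * m%:R <= N%:R / (s 1%N)%:R :> R.
  by rewrite ler_pdivlMr ?ltr0n // -mulrA.
have k0 : 0 <= k%:R :> R by [].
have m0 : 0 < m%:R :> R by lra.
have NR : 0 <= N%:R :> R by [].
have kNz : k%:R * z <= N%:R.
  apply: (@le_trans _ _ (k%:R * m%:R)); first by rewrite ler_wpM2l.
  by apply: le_trans kmN _; rewrite ler_pdivrMr ?ltr0n // ler_peMr.
have lm : ln m%:R <= ln z + 1 / z.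
  apply: le_trans (ln_addr_le z0 ler01); by rewrite ler_ln ?posrE //; lra.
have lm2 : ln m%:R <= ln z + ln 2.
  rewrite -lnM ?posrE //; rewrite ler_ln ?posrE //; first by lra.
  by rewrite mulr_gt0.
have lN' : ln N'%:R <= ln C + ln z.
  by rewrite -lnM ?posrE // ler_ln ?posrE ?ltr0n // mulr_gt0.
have E1 : (s 3%N)%:R * z <= eps / 4 * N%:R.
  rewrite ez mulrDl in zlin.
  have : eps / 4 * (n%:R - N%:R) <= eps / 4 * (C * z).
    by rewrite ler_wpM2l ?(ltW e4) //; apply: le_trans nN' NzC.
  lra.
have E2 : k%:R * ((s 2%N)%:R * ln N'%:R + 1 + ln m%:R) <= eps / 4 * N%:R.
  have : (s 2%N)%:R * ln N'%:R + 1 + ln m%:R <= eps / 4 * z.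
    have H1 : (s 2%N)%:R * ln N'%:R <= (s 2%N)%:R * (ln C + ln z) by rewrite ler_wpM2l.
    have H2 : ((s 2%N)%:R + 1) * ln z <= eps / 4 / 2 * z.
      rewrite mulrC -ler_pdivlMr; last by lra.
      by apply: le_trans lz _; rewrite le_eqVlt; apply/orP; left; apply/eqP; field; lra.
    have -> : eps / 4 * z = eps / 4 / 2 * z + eps / 4 / 2 * z by rewrite -mulrDl -splitr.
    lra.
  move=> /(ler_wpM2l k0) /le_trans; apply.
  by rewrite mulrCA ler_wpM2l // ltW.
have E3 : k%:R * (m%:R * (a + ln m%:R)) <= N%:R * (rate 3 n) + eps / 4 * N%:R.
  have -> : rate 3 n = (a + ln z) / (s 1%N)%:R by rewrite aE zE.
  apply: (@le_trans _ _ (k%:R * m%:R * (a + ln z + 1 / z))).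
    by rewrite -mulrA !ler_wpM2l // -addrA lerD2l.
  have z1' : 0 <= 1 / z by rewrite divr_ge0 // ltW.
  apply: (@le_trans _ _ (N%:R / (s 1%N)%:R * (a + ln z + 1 / z))).
    by rewrite ler_wpM2r //; lra.
  rewrite mulrDr; apply: lerD; first by rewrite mulrAC -mulrA.
  have : 1 / z <= eps / 4 by rewrite ler_pdivrMr //; rewrite ler_pdivrMr // in z4; lra.
  rewrite [eps / 4 * _]mulrC; move=> H; apply: ler_pM => //.
  by rewrite ler_pdivrMr ?ltr0n // ler_peMr.
have E4 : k%:R * A + k%:R * z <= k%:R * ((s 2%N)%:R * ln N'%:R + 1 + ln m%:R) + k%:R * (m%:R * (a + ln m%:R)).
  rewrite -!mulrDr ler_wpM2l // AE; lra.
have -> : N%:R * (rate 3 n + eps) = N%:R * rate 3 n + eps * N%:R by ring.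
have : 0 <= eps * N%:R by rewrite mulr_ge0 // ltW.
lra.
Qed.

Lemma many_trees3 : (0 < s 3%N)%N -> many_trees 3.
Proof.
move=> s3 eps eps0.
have e4 : 0 < eps / 4 by rewrite divr_gt0.
have S2 : 1 <= (s 2%N)%:R :> R by rewrite ler1n.
have e8 : 0 < eps / 4 / ((s 2%N)%:R + 1) / 2 by rewrite !divr_gt0 //; lra.
pose a : R := ln ((s 1%N)%:R / (s 2%N)%:R).
pose C : R := (s 2%N)%:R + 2 * (s 1%N)%:R.
have N1 := near_ln_lin e8.
have N2 := near_exprn_expR (R := R) 3 ltr01.
have N3 := near_lin_absorb ((s 3%N)%:R + eps / 4 * C) e4.
near=> n; apply: (many_trees3_at s3 eps0 (erefl a) (erefl C) erefl).
- by near: n; apply: nbhs_infty_gt.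
- by near: n; apply: nbhs_infty_ge.
near: n; apply: (near_iter_ln 1 (P := base_range a C eps)).
near=> z; split; split.
- by near: z; apply: near_ge.
- by near: z; apply: near_ge.
- by near: z; apply: near_ge.
- by rewrite -lerBlDl; near: z; apply: (iter_ln_near_real 1).
- by rewrite [leRHS]mulrC -ler_pdivrMr ?divr_gt0 //; near: z; apply: near_ge.
- by near: z; exact: N1.
- by near: z; exact: N2.
by near: z; exact: N3.
Unshelve. all: by end_near. Qed.
End LowerBound.

Section LowerStep.
Variables (R : realType) (K : fieldType) (s : nat -> nat).
Hypotheses (s1 : (0 < s 1%N)%N) (s2 : (0 < s 2%N)%N).
Local Notation rate i := (rate R i s).

(** What is needed of n (with z = ln n) for the trees of level i.+4 built from
    blocks of about z ln z letters. *)
Definition step_range (i : nat) (e eps M1 M2 h z : R) :=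
  [/\ 4 + expR 1 <= z, 4 / e <= ln z, 4 <= ln z & 1 / eps <= z] /\
   [/\ M1 + 1 <= z, M2 + 1 <= z, z ^+ 4 <= expR (1 * z),
    (forall w, w <= z * ln z -> iter_ln i.+2 w <= iter_ln i.+2 z + e) &
    (h + 1) / e + 1 <= z].

(** Blocks of n' = z ln z letters: their defect per letter is that of level i.+3 at
    n', which is the rate of level i.+4 at n up to o(1), and ln k! <= k z is only
    o(N), as the number k of blocks is at most N / (z ln z). *)
Lemma many_trees_step_at i n n1 n2 h (a e eps z : R) : h = s i.+4 -> (0 < h)%N -> 0 < eps ->
  0 < e -> e <= 1 / 2 -> e <= eps / 4 ->
  a = ln ((s 1%N)%:R / (s 2%N)%:R) -> z = ln n%:R -> (0 < n)%N -> (h <= n)%N ->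
  (forall n', (n1 <= n')%N -> exists N l, [/\ (N <= n')%N,
    (n'%:R - N%:R) * ln n'%:R <= e * n'%:R, (forall I, @tree_system K I s i.+3 N l) &
    N`!%:R * expR (- (N%:R * (rate i.+3 n' + e))) <= l%:R]) ->
  (forall n', (n2 <= n')%N -> - a <= iter_ln i.+2 n'%:R) ->
  step_range i e eps n1%:R n2%:R h%:R z ->
  exists N l, [/\ (N <= n)%N, (n%:R - N%:R) * ln n%:R <= eps * n%:R,
    (forall I, @tree_system K I s i.+4 N l) &
    N`!%:R * expR (- (N%:R * (rate i.+4 n + eps))) <= l%:R].
Proof.
move=> hE s3 eps0 e0 e2 e4 aE zE n0N h3 Hn1 Hn2 [[ze1 lze lz1 zeps] [zn1 zn2 z4 Hw zs]].
have n0 : 0 < n%:R :> R by rewrite ltr0n.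
have ez : expR z = n%:R by rewrite zE lnK ?posrE.
rewrite mul1r ez in z4.
have e1 := expR_gt0 (1 : R).
have z1 : 4 <= z by lra.
have S1 : 1 <= (s 1%N)%:R :> R by rewrite ler1n.
have z0 : 0 < z by lra.
have lzz : ln z <= z by apply/ltW/ln_sublinear.
have [w wE] : exists w, w = z * ln z by eexists.
have w0 : 0 <= w by rewrite wE mulr_ge0 //; lra.
have zw : 4 * z <= w by rewrite wE mulrC ler_wpM2l //; lra.
have wz2 : w <= z ^+ 2 by rewrite wE expr2 ler_wpM2l //; lra.
have [n' [n'w wn']] : exists n' : nat, n'%:R <= w /\ w < n'%:R + 1.
  by exists (Num.truncn w); rewrite natr1; apply/andP/truncn_itv.
have n1n' : (n1 <= n')%N by rewrite -(ler_nat R); lra.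
have n2n' : (n2 <= n')%N by rewrite -(ler_nat R); lra.
have [N' [l' [N'n' nN' Hsys Hl']]] := Hn1 n' n1n'.
have n'1 : 4 <= n'%:R :> R by lra.
have ln'1 : 1 <= ln n'%:R :> R.
  rewrite -ler_expR lnK ?posrE; last by lra.
  lra.
have N'2 : w / 4 <= N'%:R.
  have N'n'R : N'%:R <= n'%:R :> R by rewrite ler_nat.
  have : (n'%:R - N'%:R) * 1 <= (n'%:R - N'%:R) * ln n'%:R :> R by rewrite ler_wpM2l // subr_ge0.
  have : e * n'%:R <= 1 / 2 * n'%:R :> R by rewrite ler_wpM2r.
  lra.
have N'0 : (0 < N')%N by rewrite -(ltr0n R); lra.
have N'w : N'%:R <= w by apply: le_trans n'w; rewrite ler_nat.
have [k kE] : exists k, k = ((n - h) %/ N')%N by eexists.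
have [N NE] : exists N, N = (h + k * N')%N by eexists.
have /andP[Nn nN] : (N <= n)%N && (n <= N + N')%N by rewrite NE kE; apply: divn_cover.
have nNN' : n%:R - N%:R <= N'%:R :> R by rewrite lerBlDl -natrD ler_nat.
have k0 : 0 <= k%:R :> R by [].
have NR : 0 <= N%:R :> R by [].
have z3 : z ^+ 3 <= eps * n%:R.
  apply: le_trans (ler_wpM2l (ltW eps0) z4).
  rewrite [z ^+ 4]exprS mulrA -[leLHS]mul1r ler_wpM2r ?exprn_ge0 ?(ltW z0) //.
  by rewrite mulrC -ler_pdivrMr.
exists N, (block_count h N' l' k); split=> //.
- rewrite -zE; apply: le_trans z3; rewrite exprSr ler_wpM2r ?(ltW z0) //.
  exact: le_trans nNN' (le_trans N'w wz2).
- by move=> I; rewrite NE hE; apply: system_step => //; rewrite -hE.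
have [A AE] : exists A : R, A = N'%:R * (rate i.+3 n' + e) by eexists.
have lA : N'`!%:R * expR (- A) <= (l' * h)%:R.
  by rewrite AE; apply: le_trans Hl' _; rewrite ler_nat leq_pmulr.
have lk : ln k`!%:R <= k%:R * z.
  by rewrite zE; apply: ln_fact_le => //; rewrite kE; apply: leq_trans (leq_div _ _) (leq_subr _ _).
have Nn' : (h + k * N' <= n)%N by rewrite -NE.
apply: le_trans (block_count_ge N'0 n0N Nn' lA lk); rewrite -NE ler_wpM2l // ler_expR lerN2 -zE.
clear lA lk Hl' Hsys.
have kN : k%:R * N'%:R <= N%:R :> R by rewrite -natrM ler_nat NE leq_addl.
have rate0 : 0 <= rate i.+3 n'.
  by rewrite divr_ge0 //; have := Hn2 n' n2n'; rewrite -aE; lra.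
have rate1 : rate i.+3 n' <= rate i.+4 n + e.
  have -> : rate i.+3 n' = (a + iter_ln i.+2 n'%:R) / (s 1%N)%:R by rewrite aE.
  have -> : rate i.+4 n = (a + iter_ln i.+2 z) / (s 1%N)%:R.
    by rewrite aE zE -[iter_ln i.+2 (ln _)]iterSr.
  rewrite ler_pdivrMr ?ltr0n // mulrDl divfK ?pnatr_eq0 -?lt0n // -addrA lerD2l.
  apply: le_trans (Hw _ _) _; first by rewrite -wE.
   rewrite lerD2l ler_peMr //; exact: ltW.
have E1 : k%:R * A <= N%:R * (rate i.+4 n + 2 * e).
  rewrite AE mulrA; apply: ler_pM => //; [by rewrite addr_ge0 // ltW|lra].
have E2 : k%:R * z <= e * N%:R.
  rewrite mulrC; have : z <= e * N'%:R.
    apply: le_trans (ler_wpM2l (ltW e0) N'2); rewrite wE.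
    rewrite ler_pdivrMr // in lze.
    have : z * 4 <= z * (ln z * e) by rewrite ler_wpM2l // ltW.
    by rewrite mulrA; lra.
  move=> /(ler_wpM2r k0) /le_trans; apply.
  by rewrite -mulrA ler_wpM2l ?(ltW e0) // mulrC.
have E3 : h%:R * z <= e * N%:R.
  have : z * z * z <= N%:R.
    have : n%:R - N%:R <= z * z by apply: le_trans nNN' (le_trans N'w _); rewrite -expr2.
    have : 2 * z ^+ 3 <= z ^+ 4 by rewrite [z ^+ 4]exprS ler_wpM2r ?exprn_ge0 ?(ltW z0) //; lra.
    have : z * z <= z ^+ 3.
      by rewrite [z ^+ 3]exprSr -expr2 ler_peMr ?exprn_ge0 ?(ltW z0) //; lra.
    rewrite -[z * z * z]/(z ^+ 2 * z) -exprSr; lra.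
  move=> /(ler_wpM2l (ltW e0)); apply: le_trans.
  rewrite mulrA ler_wpM2r ?(ltW z0) //.
  have : h%:R <= e * z.
    have : (h%:R + 1) / e <= z by lra.
    rewrite ler_pdivrMr //; lra.
  move=> hz; apply: le_trans hz _; rewrite ler_wpM2l ?(ltW e0) // ler_peMr ?(ltW z0) //; lra.
have E4 : N%:R * (4 * e) <= N%:R * eps by rewrite ler_wpM2l //; lra.
rewrite mulrDr in E1; rewrite [leRHS]mulrDr; lra.
Qed.

Lemma many_trees_step i : (3 <= i)%N -> (0 < s i.+1)%N ->
  many_trees R K s i -> many_trees R K s i.+1.
Proof.
case: i => [|[|[|i]]] // _ s3 IH eps eps0.
pose a : R := ln ((s 1%N)%:R / (s 2%N)%:R).
have [e e0 [e2 e4]] : exists2 e : R, 0 < e & e <= 1 / 2 /\ e <= eps / 4.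
  exists (Num.min (1 / 2) (eps / 4)); first by rewrite lt_min !divr_gt0.
  by rewrite !ge_min !lexx orbT.
have [n1 _ Hn1] := IH e e0.
have N1 := iter_ln_xlnx (R := R) i e0.
have N2 := near_exprn_expR (R := R) 4 ltr01.
have [n2 _ Hn2] := iter_ln_near (R := R) i.+2 (- a).
near=> n.
apply: (many_trees_step_at erefl s3 eps0 e0 e2 e4 (erefl a) erefl _ _ Hn1 Hn2).
- by near: n; apply: nbhs_infty_gt.
- by near: n; apply: nbhs_infty_ge.
near: n; apply: (near_iter_ln 1 (P := step_range i e eps n1%:R n2%:R (s i.+4)%:R)).
near=> z; split; split.
- by near: z; apply: near_ge.
- by near: z; apply: (iter_ln_near_real 1).
- by near: z; apply: (iter_ln_near_real 1).
- by near: z; apply: near_ge.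
- by near: z; apply: near_ge.
- by near: z; apply: near_ge.
- by near: z; exact: N2.
- by near: z; exact: N1.
by near: z; apply: near_ge.
Unshelve. all: by end_near. Qed.

Lemma many_trees_all q : (3 <= q)%N -> (forall i, (1 <= i <= q)%N -> (0 < s i)%N) ->
  many_trees R K s q.
Proof.
move=> q3 hs; rewrite -(subnKC q3) in hs *; elim: (q - 3)%N hs => [|j IH] hs.
  by rewrite addn0; apply: many_trees3 => //; apply: hs.
rewrite addnS; apply: many_trees_step; first exact: leq_addr.
  by apply: hs; rewrite addnS ltnSn.
by apply: IH => k /andP[k1 kq]; apply: hs; rewrite k1 addnS ltnW.
Qed.

(** The letters that are not used cost n! / N! <= n^(n - N) = exp(o(n)). *)
Theorem codim_lower_near q (eps : R) : (3 <= q)%N ->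
  (forall i, (1 <= i <= q)%N -> (0 < s i)%N) -> 0 < eps -> \forall n \near \oo,
  n`!%:R * expR (- (n%:R * (rate q n + eps))) <= (codim (PN K q s) n)%:R.
Proof.
move=> q3 hs eps0; have q1 : (1 <= q)%N by apply: leq_trans q3.
have e2 : 0 < eps / 2 by rewrite divr_gt0.
near=> n.
have n0 : 1 <= n%:R :> R by near: n; apply: nbhs_infty_ger.
have rate0 : 0 <= rate q n.
  rewrite divr_ge0 // -lerBlDl sub0r.
  by near: n; apply: iter_ln_near.
have [N [l [Nn nN Hsys Hl]]] : exists N l, [/\ (N <= n)%N,
    (n%:R - N%:R) * ln n%:R <= eps / 2 * n%:R, (forall I, @tree_system K I s q N l) &
    N`!%:R * expR (- (N%:R * (rate q n + eps / 2))) <= l%:R].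
  by near: n; apply: many_trees_all.
apply: le_trans (_ : l%:R <= _); last by rewrite ler_nat (system_codim R q1 s1 Nn (Hsys _)).
apply: le_trans Hl.
have fn : n`!%:R <= expR ((n%:R - N%:R) * ln n%:R) * N`!%:R :> R.
  have : ((n - N + N)`! <= n ^ (n - N) * N`!)%N by apply: factD_le; rewrite subnK.
  rewrite subnK // -(ler_nat R) natrM natrX => /le_trans; apply.
  by rewrite -natrB // expRM_natl lnK ?posrE //; lra.
apply: le_trans (ler_wpM2r (expR_ge0 _) fn) _.
rewrite [X in X * _]mulrC -mulrA ler_wpM2l // -expRD ler_expR.
have NnR : N%:R <= n%:R :> R by rewrite ler_nat.
have : N%:R * (rate q n + eps / 2) <= n%:R * (rate q n + eps / 2).
  by rewrite ler_wpM2r // addr_ge0 // ltW.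
lra.
Unshelve. all: by end_near. Qed.
End LowerStep.

(** * The codimension growth *)

Lemma ln_ratio_rate (R : realType) (x f n r eps : R) : 0 < x -> 0 < f -> 0 < n ->
  x <= f * expR (- (n * (r - eps))) -> f * expR (- (n * (r + eps))) <= x ->
  `|ln (x / f) / n + r| <= eps.
Proof.
move=> x0 f0 n0; have xf : 0 < x / f by rewrite divr_gt0.
have -> : x = f * (x / f) by rewrite mulrC divfK // lt0r_neq0.
rewrite !ler_pM2l // [f * _ / f]mulrAC divff ?lt0r_neq0 // mul1r -[X in X <= _ -> _]lnK ?posrE //.
rewrite -[X in _ -> _ <= X -> _]lnK ?posrE // !ler_expR; move: (ln _) => v up low.
have -> : v / n + r = (v + r * n) / n by rewrite mulrDl mulfK // lt0r_neq0.
rewrite normrM normfV (gtr0_norm n0) ler_pdivrMr // ler_norml; apply/andP; split; lra.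
Qed.

Theorem theorem2p2 (R : realType) (K : fieldType) (q : nat) (s : nat -> nat)
    (hq : (3 <= q)%N) (hs : forall i, (1 <= i <= q)%N -> (0 < s i)%N) :
  exists o : nat -> R, o @ \oo --> (0 : R) /\
    \forall n \near \oo,
      (codim (PN K q s) n)%:R =
      (n`!)%:R / (iter_ln (q - 2)%N (n%:R : R)) `^ (n%:R / (s 1%N)%:R)
      * (((s 2%N)%:R + o n) / (s 1%N)%:R) `^ (n%:R / (s 1%N)%:R).
Proof.
have s1 : (0 < s 1%N)%N by apply: hs; rewrite /= (leq_trans _ hq).
have s2 : (0 < s 2%N)%N by apply: hs; rewrite /= (leq_trans _ hq).
have s1R : 0 < (s 1%N)%:R :> R by rewrite ltr0n.
have s2R : 0 < (s 2%N)%:R :> R by rewrite ltr0n.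
pose c n : R := (codim (PN K q s) n)%:R.
have cpos : \forall n \near \oo, 0 < c n.
  near=> n; apply: (@lt_le_trans _ _ (n`!%:R * expR (- (n%:R * (rate R q s n + 1))))).
    by rewrite mulr_gt0 ?expR_gt0 // ltr0n fact_gt0.
  by near: n; apply: codim_lower_near.
(* u is the error of the rate per letter. Solving the asserted formula for o
   yields s_2 (exp (s_1 u) - 1). *)
pose u n : R := ln (c n / n`!%:R) / n%:R + rate R q s n.
have u0 : u @ \oo --> (0 : R).
  apply/cvgrPdist_le => eps eps0; near=> n.
  have n0 : 0 < n%:R :> R by near: n; apply: nbhs_infty_gtr.
  have fn : 0 < n`!%:R :> R by rewrite ltr0n fact_gt0.
  have cn : 0 < c n by near: n.
  have up : c n <= n`!%:R * expR (- (n%:R * (rate R q s n - eps))).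
    by near: n; apply: codim_upper_near.
  have low : n`!%:R * expR (- (n%:R * (rate R q s n + eps))) <= c n.
    by near: n; apply: codim_lower_near.
  by rewrite sub0r normrN; apply: ln_ratio_rate.
exists (fun n => (s 2%N)%:R * (expR ((s 1%N)%:R * u n) - 1)); split.
  rewrite -[X in _ --> X](_ : (s 2%N)%:R * (expR ((s 1%N)%:R * 0) - 1) = 0); last first.
    by rewrite mulr0 expR0 subrr mulr0.
  apply: cvgMr; apply: cvgB; last exact: cvg_cst.
  apply: continuous_cvg; first exact: continuous_expR.
  exact: cvgMr.
near=> n.
have n0 : 0 < n%:R :> R by near: n; apply: nbhs_infty_gtr.
have fn : 0 < n`!%:R :> R by rewrite ltr0n fact_gt0.
have cn : 0 < c n by near: n.
have x0 : 1 <= iter_ln (q - 2)%N (n%:R : R) by near: n; apply: iter_ln_near.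
have rE : rate R q s n = (ln ((s 1%N)%:R / (s 2%N)%:R) + ln (iter_ln (q - 2)%N n%:R)) / (s 1%N)%:R.
  by rewrite /rate -[q in q.-1](subnK (ltnW hq)) addn2.
have {}x0 : 0 < iter_ln (q - 2)%N (n%:R : R) by apply: lt_le_trans x0.
rewrite -/(c n); have -> : c n = n`!%:R * expR (n%:R * u n - n%:R * rate R q s n).
  rewrite /u mulrDr addrK mulrCA divff ?mulr1 ?lt0r_neq0 // lnK ?posrE ?divr_gt0 //.
  by rewrite mulrC divfK // lt0r_neq0.
rewrite {}rE; move: (iter_ln _ _) x0 (u n) => x x0 v.
have -> : ((s 2%N)%:R + (s 2%N)%:R * (expR ((s 1%N)%:R * v) - 1)) / (s 1%N)%:R =
    expR (- ln ((s 1%N)%:R / (s 2%N)%:R) + (s 1%N)%:R * v).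
  rewrite expRD expRN lnK ?posrE ?divr_gt0 // invf_div.
  by rewrite mulrBr mulr1 addrC subrK mulrAC.
rewrite -[x in x `^ _]lnK ?posrE // -!expRM -expRN -mulrA -expRD; congr (_ * expR _).
move: (ln _) (ln _) => a b; field; exact: lt0r_neq0.
Unshelve. all: by end_near. Qed.
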